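(* Let $k\in\mathbb{N}$, $n>2k$ and $q>k$. Then $\lambda^*$ is a positive finite number, and: \begin{itemize} \item[(a)] if $\lambda\in(0,\lambda^* )$, then $(P_\lambda)$ admits a maximal bounded solution; \item[(b)] if $\lambda=\lambda^*$, then $(P_\lambda)$ admits at least one (possibly unbounded) integral solution; \item[(c)] if $\lambda>\lambda^*$, then $(P_\lambda)$ admits no classical solution. \end{itemize}
   Context: $B$ is the unit ball of $\mathbb{R}^n$; $S_k(D^2u)$ is the $k$-th elementary symmetric polynomial of the eigenvalues of $D^2u$; $c_{n,k}=\binom{n}{k}/n$. Problem $(P_\lambda)$ ($\lambda>0$) is \[ c_{n,k}r^{1-n}\big(r^{n-k}(u')^k\big)'=\lambda(1-u)^q\ (0<r<1),\quad u<0\ (0<r<1),\quad u'(0)=0,\ u(1)=0. \] A classical solution is a function in $\Phi_0^k=\{u\in C^2((0,1))\cap C^1([0,1]): (r^{n-i}(u')^i)'\ge0 \text{ on }(0,1),\ i=1,\dots,k,\ u'(0)=u(1)=0\}$ satisfying the equation. An integral solution is $u\in C([0,1])$, absolutely continuous on $(0,1]$, with $u(1)=0$, $\int_0^1 r^{n-k}(u'(r))^{k+1}dr<\infty$, and $c_{n,k}r^{n-k}(u'(r))^k=\lambda\int_0^r s^{n-1}(1-u(s))^q\,ds$ for a.a. $r\in(0,1)$. A subsolution is $u\in C^2((0,1))\cap C^1([0,1])$ with $(r^{n-i}(u')^i)'\ge0$, $i=1,\dots,k$, $c_{n,k}r^{1-n}(r^{n-k}(u')^k)'\ge\lambda(1-u)^q$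 and $u(1)\le0$. A maximal solution is a solution $v$ such that $u\le v$ for every subsolution $u$. $\lambda^*=\sup\{\lambda>0: S_k(D^2u)=\lambda(1-u)^q \text{ in } B,\ u<0 \text{ in } B,\ u=0 \text{ on } \partial B \text{ has a solution } u\in C^2(B)\}$.
   Formalization: An integral solution is required to be continuous on (0,1] and at 0 either continuous or tending to −∞, instead of u ∈ C([0,1]), since the latter would exclude the unbounded solutions that (b) allows and that are the only ones at λ* for some n and q. *)

(* Defs.v *)
From Stdlib Require Import Reals Lra Lia List Arith.
Import ListNotations.
Open Scope R_scope.

Definition I01c (r : R) : Prop := 0 <= r <= 1.
Definition I01o (r : R) : Prop := 0 < r < 1.
Definition I01l (r : R) : Prop := 0 < r <= 1.

Definition deriv_within (D : R -> Prop) (f : R -> R) (x l : R) : Prop :=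
  forall eps, 0 < eps -> exists del, 0 < del /\
    forall h, h <> 0 -> Rabs h < del -> D (x + h) ->
      Rabs ((f (x + h) - f x) / h - l) < eps.

Definition cont_within (D : R -> Prop) (f : R -> R) (x : R) : Prop :=
  forall eps, 0 < eps -> exists del, 0 < del /\
    forall y, D y -> Rabs (y - x) < del -> Rabs (f y - f x) < eps.

Definition C2C1 (u u' : R -> R) : Prop :=
  (forall r, I01c r -> deriv_within I01c u r (u' r) /\ cont_within I01c u' r) /\
  exists u'' : R -> R, forall r, I01o r ->
    derivable_pt_lim u' r (u'' r) /\ continuity_pt u'' r.

Definition k_admissible (n k : nat) (u' : R -> R) : Prop :=
  forall i, (1 <= i <= k)%nat -> forall r, I01o r ->
    exists l, derivable_pt_lim (fun s => s ^ (n - i) * (u' s) ^ i) r l /\ 0 <= l.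

Definition cnk (n k : nat) : R := C n k / INR n.

Definition op_eq (n k : nat) (u' : R -> R) (r rhs : R) : Prop :=
  exists l, derivable_pt_lim (fun s => s ^ (n - k) * (u' s) ^ k) r l /\
    cnk n k * / r ^ (n - 1) * l = rhs.
Definition op_ge (n k : nat) (u' : R -> R) (r rhs : R) : Prop :=
  exists l, derivable_pt_lim (fun s => s ^ (n - k) * (u' s) ^ k) r l /\
    cnk n k * / r ^ (n - 1) * l >= rhs.

Definition classical_solution (n k : nat) (q lam : R) (u : R -> R) : Prop :=
  exists u' : R -> R,
    C2C1 u u' /\ k_admissible n k u' /\ u' 0 = 0 /\ u 1 = 0 /\
    (forall r, I01o r -> op_eq n k u' r (lam * Rpower (1 - u r) q)) /\
    (forall r, I01o r -> u r < 0).

Definition subsolution (n k : nat) (q lam : R) (u : R -> R) : Prop :=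
  exists u' : R -> R,
    C2C1 u u' /\ k_admissible n k u' /\
    (forall r, I01o r -> op_ge n k u' r (lam * Rpower (1 - u r) q)) /\
    u 1 <= 0.

Definition maximal_bounded_solution (n k : nat) (q lam : R) (v : R -> R) : Prop :=
  classical_solution n k q lam v /\
  (exists M, forall r, I01c r -> Rabs (v r) <= M) /\
  (forall u, subsolution n k q lam u -> forall r, I01c r -> u r <= v r).

Definition null_set (E : R -> Prop) : Prop :=
  forall eps, 0 < eps -> exists a b : nat -> R,
    (forall j, a j <= b j) /\
    (forall x, E x -> exists j, a j < x < b j) /\
    (forall N, sum_f_R0 (fun j => b j - a j) N < eps).

Definition nonoverlap (L : list (R * R)) : Prop :=
  forall i j, (i < j < length L)%nat ->
    snd (nth i L (0, 0)) <= fst (nth j L (0, 0)) \/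
    snd (nth j L (0, 0)) <= fst (nth i L (0, 0)).

Definition abs_cont (a b : R) (u : R -> R) : Prop :=
  forall eps, 0 < eps -> exists del, 0 < del /\
    forall L : list (R * R),
      (forall p, In p L -> a <= fst p <= snd p /\ snd p <= b) ->
      nonoverlap L ->
      fold_right (fun p acc => snd p - fst p + acc) 0 L < del ->
      fold_right (fun p acc => Rabs (u (snd p) - u (fst p)) + acc) 0 L < eps.

(* Henstock-Kurzweil (gauge) integral on [a,b]; tagged partitions are lists
   of (left point, tag, right point). *)
Fixpoint tpart (a b : R) (P : list (R * R * R)) : Prop :=
  match P with
  | nil => a = b
  | (l, t, r) :: P' => l = a /\ l <= t <= r /\ l < r /\ tpart r b P'
  end.

Definition gauge_fine (delta : R -> R) (P : list (R * R * R)) : Prop :=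
  forall l t r, In (l, t, r) P -> t - l < delta t /\ r - t < delta t.

Definition rsum (f : R -> R) (P : list (R * R * R)) : R :=
  fold_right (fun p acc => match p with (l, t, r) => f t * (r - l) + acc end) 0 P.

Definition HKint (a b : R) (f : R -> R) (I : R) : Prop :=
  a <= b /\
  forall eps, 0 < eps -> exists delta : R -> R,
    (forall x, a <= x <= b -> 0 < delta x) /\
    forall P, tpart a b P -> gauge_fine delta P -> Rabs (rsum f P - I) < eps.

(* Lebesgue integrability on [a,b] (= absolute HK integrability) *)
Definition L1 (a b : R) (f : R -> R) : Prop :=
  (exists I, HKint a b f I) /\ (exists J, HKint a b (fun x => Rabs (f x)) J).

Definition integral_solution (n k : nat) (q lam : R) (u : R -> R) : Prop :=
  (* continuity on [0,1], with u(0) possibly equal to -infinity *)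
  (forall r, I01l r -> cont_within I01l u r) /\
  (cont_within I01c u 0 \/
   forall M, exists del, 0 < del /\ forall r, 0 < r < del -> u r < M) /\
  (forall a, 0 < a < 1 -> abs_cont a 1 u) /\
  u 1 = 0 /\
  exists d : R -> R,
    L1 0 1 (fun r => r ^ (n - k) * (d r) ^ (k + 1)) /\
    null_set (fun r => I01o r /\
      ~ (derivable_pt_lim u r (d r) /\
         exists I, HKint 0 r (fun s => s ^ (n - 1) * Rpower (1 - u s) q) I /\
           cnk n k * r ^ (n - k) * (d r) ^ k = lam * I)).

(* points of R^n are x : nat -> R with x i = 0 for i >= n *)
Definition rsumn (n : nat) (f : nat -> R) : R :=
  fold_right Rplus 0 (map f (seq 0 n)).

Definition inSub (n : nat) (x : nat -> R) : Prop := forall i, (n <= i)%nat -> x i = 0.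
Definition sqnorm (n : nat) (x : nat -> R) : R := rsumn n (fun i => x i ^ 2).
Definition inB (n : nat) (x : nat -> R) : Prop := inSub n x /\ sqnorm n x < 1.
Definition inBc (n : nat) (x : nat -> R) : Prop := inSub n x /\ sqnorm n x <= 1.
Definition dist (n : nat) (x y : nat -> R) : R := sqrt (rsumn n (fun i => (x i - y i) ^ 2)).

Definition cont_on (D : (nat -> R) -> Prop) (n : nat) (f : (nat -> R) -> R)
  (x : nat -> R) : Prop :=
  forall eps, 0 < eps -> exists del, 0 < del /\
    forall y, D y -> dist n x y < del -> Rabs (f y - f x) < eps.

Definition upd (x : nat -> R) (i : nat) (t : R) : nat -> R :=
  fun j => if Nat.eqb j i then t else x j.

Definition C2B (n : nat) (u : (nat -> R) -> R) (Du : nat -> (nat -> R) -> R)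
  (D2u : nat -> nat -> (nat -> R) -> R) : Prop :=
  forall x, inB n x ->
    (forall i, (i < n)%nat -> derivable_pt_lim (fun t => u (upd x i t)) (x i) (Du i x)) /\
    (forall i j, (i < n)%nat -> (j < n)%nat ->
       derivable_pt_lim (fun t => Du i (upd x j t)) (x j) (D2u i j x)) /\
    cont_on (inB n) n u x /\
    (forall i, (i < n)%nat -> cont_on (inB n) n (Du i) x) /\
    (forall i j, (i < n)%nat -> (j < n)%nat -> cont_on (inB n) n (D2u i j) x).

Fixpoint det (m : nat) (A : nat -> nat -> R) : R :=
  match m with
  | O => 1
  | S m' => rsumn (S m') (fun j =>
      (-1) ^ j * A 0%nat j * det m' (fun i l => A (S i) (if Nat.ltb l j then l else S l)))
  end.

Fixpoint esym (l : list R) (k : nat) : R :=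
  match l, k with
  | nil, O => 1
  | nil, S _ => 0
  | _ :: _, O => 1
  | x :: l', S k' => esym l' k + x * esym l' k'
  end.

(* S_k(H) = v : v is the k-th elementary symmetric polynomial of the
   eigenvalues (with multiplicity, i.e. roots of the characteristic
   polynomial) of the n x n matrix H *)
Definition Sk_is (n k : nat) (H : nat -> nat -> R) (v : R) : Prop :=
  exists lam : list R, length lam = n /\
    (forall t, det n (fun i j => (if Nat.eqb i j then t else 0) - H i j)
               = fold_right Rmult 1 (map (fun m => t - m) lam)) /\
    esym lam k = v.

(* S_k(D^2 u) = lam (1-u)^q in B, u < 0 in B, u = 0 on ∂B, u ∈ C^2(B)
   (continuous up to the boundary so that the boundary condition makes sense) *)
Definition hessian_problem_solvable (n k : nat) (q lam : R) : Prop :=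
  exists u Du D2u,
    C2B n u Du D2u /\
    (forall x, inBc n x -> cont_on (inBc n) n u x) /\
    (forall x, inB n x -> Sk_is n k (fun i j => D2u i j x) (lam * Rpower (1 - u x) q)) /\
    (forall x, inB n x -> u x < 0) /\
    (forall x, inSub n x -> sqnorm n x = 1 -> u x = 0).

Definition lambda_set (n k : nat) (q : R) (lam : R) : Prop :=
  0 < lam /\ hessian_problem_solvable n k q lam.

(* Main.v *)
(** All radial solutions come from one function. Let [z] solve the initial value problem
    [z(0) = 1], [z' = - r m], [c r^n m^k = int_0^r s^(n-1) z^q ds] (the equation for [1 - u] with
    [lambda = 1]). By scaling, [sol B r = 1 - z(B r) / z(B)] solves the problem for
    [lamf B = B^(2k) z(B)^(q-k)], for every [B] before the first zero of [z], and
    [lambda* = sup lamf].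

    Comparison: if [u] is a subsolution for [lambda] (radial, or a solution of the Hessian equation
    in the ball) and [u <= sol B] with [lamf B < lambda], then [u <= sol B'] for [B' > B] close to
    [B].  Hence [u <= sol B] as long as [lamf < lambda] on [[0, B)]: the first [B] with
    [lamf B = lambda] gives the maximal solution, and if there is no such [B] then
    [u(0) <= 1 - 1 / z(B) -> - oo], so there is no solution.  For the Hessian equation the
    comparison takes place at an interior maximum of [u] minus a radial function, and uses that
    [D^2 u] lies in the Garding cone, where [S_k] is monotone.

    The supremum: with [y = r^2 m / z] and [x = z^q / (c m^k)] one has [lamf = c x y^k] and
    [(x, y)] satisfies an autonomous Lotka-Volterra system in [ln r].  If [y] reaches
    [alpha = 2k / (q - k)], then [lamf] is maximal where it does so first, by a Pohozaev identity
    or by a Lyapunov function according to the sign of [q - k (n + 2) / (n - 2k)].  Otherwise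
    [(x, y)] tends to the equilibrium, and [1 - r^(-alpha)] is an integral solution for
    [lambda*]. *)
Require Import Defs.
From Stdlib Require Import Reals Lra Lia List Arith Permutation Classical.
From Stdlib Require Import FunctionalExtensionality ClassicalEpsilon.
From mathcomp Require all_boot all_order all_algebra spectral complex Rstruct.
From Coquelicot Require Import Rcomplements Rbar Hierarchy Continuity Derive AutoDerive.
From Coquelicot Require Import RInt RInt_analysis Lim_seq Derive_2d.
Import ListNotations Defs.
Open Scope R_scope.

(** * Determinants and eigenvalues *)

(** [lambda*] is defined by solutions in the ball that are assumed neither radial nor admissible,
    whereas (a), (b) and (c) concern radial functions. Comparing such a solution directly with the
    radial branch avoids a symmetry theorem, but the equation alone gives only [e_k > 0] for the
    eigenvalues of [D^2 u]. The remaining inequalities of the cone are carried along a segment from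
    the minimum point of [u], where all eigenvalues are nonnegative; this is why continuity of the
    symmetric functions of the spectrum is needed.

    The passage from [sol B] to [sol B'] is a gain in the right-hand side. If [u <= sol B], then
    [lam (1 - u)^q] is at least [lam / lamf B > 1] times the right-hand side for [sol B]. Hence [u]
    lies below a multiple of [sol B] with a factor larger than 1, and this multiple lies below
    [sol B'] for all [B'] slightly larger than [B]. The sign conditions behind all of this are that
    [z] and [m] decrease. *)

Module MatrixFacts.
Import all_boot all_order all_algebra spectral complex Rstruct.
Import Order.TTheory GRing.Theory Num.Theory Num.Def.
Set Implicit Arguments. Unset Strict Implicit. Unset Printing Implicit Defensive.
Local Open Scope ring_scope.

Definition mxof (n : nat) (A : nat -> nat -> R) : 'M[R]_n := \matrix_(i, j) A i j.

Lemma rsumnE (n : nat) (f : nat -> R) : rsumn n f = \sum_(i < n) f i.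
Proof.
rewrite /rsumn -(big_mkord xpredT f) /index_iota subn0.
have -> : List.seq 0 n = iota 0 n.
  by elim: n 0%N => //= n IH m; rewrite IH.
by elim: (iota 0 n) => [|a s IH] /=; rewrite ?big_nil // big_cons IH.
Qed.

(** The recursion of [det] is [expand_det_row] for row 0; the test [l < j] in the column index is
    MathComp's [bump j]. *)
Lemma detE (n : nat) (A : nat -> nat -> R) : det n A = \det (mxof n A).
Proof.
elim: n A => [|n IH] A; first by rewrite /= det_mx00.
rewrite [LHS]/= (expand_det_row _ ord0) rsumnE; apply: eq_bigr => j _.
rewrite IH /cofactor mxE /= add0n.
have -> : pow (-1) j = (-1) ^+ j :> R.
  by elim: (nat_of_ord j) => //= m ->; rewrite exprS.
have -> : mxof n (fun i l => A (S i) (if Nat.ltb l j then l else S l)) =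
          row' ord0 (col' j (mxof n.+1 A)).
  apply/matrixP=> a b; rewrite !mxE /= /bump /=.
  have -> : Nat.ltb b j = (b < j)%N.
    by apply/idP/idP => [/Nat.ltb_lt/ssrnat.ltP|/ssrnat.ltP/Nat.ltb_lt].
  by rewrite ltnNge; case: (j <= b)%N.
by rewrite !RmultE -mulrA mulrCA.
Qed.

Lemma char_mxE (n : nat) (H : nat -> nat -> R) (t : R) :
  mxof n (fun i j => ((if Nat.eqb i j then t else 0) - H i j)%R) = t%:M - mxof n H.
Proof.
apply/matrixP=> i j; rewrite !mxE; congr (_ - _).
have -> : Nat.eqb i j = (i == j).
  by apply/idP/eqP => [/Nat.eqb_eq/val_inj|->] //; apply/Nat.eqb_eq.
by case: (i == j); rewrite ?mulr1n ?mulr0n.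
Qed.

Lemma eigenvector_of_root (n : nat) (H : nat -> nat -> R) (t : R) :
  det n (fun i j => ((if Nat.eqb i j then t else 0) - H i j)%R) = 0%R ->
  exists v : nat -> R, (exists i, (i < n)%coq_nat /\ v i <> 0%R) /\
    forall i, (i < n)%coq_nat -> rsumn n (fun j => Rmult (H i j) (v j)) = Rmult t (v i).
Proof.
(* [det0P] yields a vector of the left kernel, so the matrix is transposed first; [insub] then
   extends the vector by 0 to all of nat. *)
rewrite detE char_mxE -det_tr => /eqP/det0P [v vn0 /eqP].
rewrite linearB /= tr_scalar_mx mulmxBr subr_eq0 mul_mx_scalar => /eqP Hv.
pose w (i : nat) : R := if insub i is Some j then v 0 j else 0.
have wE (i : 'I_n) : w i = v 0 i by rewrite /w valK.
exists w; split.
  have [/existsP[i vi]|/existsPn h] := boolP [exists i, v 0 i != 0].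
    by exists i; split; [apply/ssrnat.ltP | rewrite wE; apply/eqP].
  case/negP: vn0; apply/eqP/rowP => i; rewrite mxE; apply/eqP.
  by have := h i; rewrite negbK.
move=> i /ssrnat.ltP ltin; rewrite rsumnE RmultE.
have := congr1 (fun M : 'rV_n => M 0 (Ordinal ltin)) Hv.
rewrite !mxE -wE /= => ->; apply: eq_bigr => j _.
by rewrite !mxE -wE /= RmultE mulrC.
Qed.

(** The block determinants [h1] and [h2] reduce the determinant of [s - c r] to the scalar
    [s - r c], up to a factor [s] that is cancelled at the end. For [s = 0] this is impossible, and
    there the determinant vanishes because [c r] has rank at most 1 < n. *)
Lemma det_rank_one (n : nat) (s N : R) (x : nat -> R) : (1 < n)%coq_nat ->
  det n (fun i j => ((if Nat.eqb i j then s else 0) - N * (x i * x j))%R) =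
  pow s (n - 1)%coq_nat * (s - N * rsumn n (fun i => pow (x i) 2)).
Proof.
move=> /ssrnat.ltP n_gt1; rewrite detE (char_mxE n (fun i j => N * (x i * x j))) rsumnE.
have powE m : pow s m = s ^+ m by elim: m => //= m ->; rewrite exprS.
rewrite powE minusE.
pose c : 'cV[R]_n := \col_i x i; pose r : 'rV[R]_n := \row_j (N * x j).
have -> : mxof n (fun i j => N * (x i * x j)) = c *m r.
  apply/matrixP=> i j; rewrite !mxE big_ord1 !mxE.
  by rewrite [LHS]mulrCA.
have rcE : r *m c = (N * \sum_(i < n) pow (x i) 2)%:M.
  apply/matrixP=> i j; rewrite !ord1 !mxE eqxx mulr1n mulr_sumr; apply: eq_bigr => l _.
  by rewrite !mxE RpowE expr2 mulrA.
have [s0|s_neq0] := eqVneq s 0.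
  rewrite s0 expr0n subn_eq0 leqNgt n_gt1 /= [RHS]mul0r.
  apply/eqP; rewrite -[_ == 0]negbK -unitfE -unitmxE.
  apply/negP => /mxrank_unit; rewrite raddf0 sub0r mxrank_opp => rk.
  have := leq_trans (mxrankM_maxl c r) (rank_leq_col c).
  by rewrite rk leqNgt n_gt1.
have h1 : \det (block_mx 1%:M r c s%:M) = \det (s%:M - c *m r).
  have /(congr1 determinant) :
    block_mx 1%:M 0 (- c) 1%:M *m block_mx 1%:M r c s%:M = block_mx 1%:M r 0 (s%:M - c *m r).
    by rewrite mulmx_block !mul1mx !mul0mx !addr0 mulNmx mulmx1 addNr mulNmx addrC.
  by rewrite det_mulmx det_lblock det_ublock !det1 !mul1r.
have h2 : \det (block_mx 1%:M r c s%:M) * s = (s - N * \sum_(i < n) pow (x i) 2) * s ^+ n.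
  have /(congr1 determinant) :
    block_mx 1%:M r c s%:M *m block_mx s%:M 0 (- c) 1%:M =
    block_mx (s%:M - r *m c) r 0 s%:M.
    rewrite mulmx_block !mul1mx !mulmx0 !mulmx1 !add0r mulmxN mul_mx_scalar mulmxN.
    by rewrite mul_scalar_mx subrr.
  rewrite det_mulmx det_lblock det_ublock !det1 mulr1 det_scalar.
  rewrite rcE -raddfB /= !det_scalar expr1 => ->; by rewrite expr1.
apply: (mulIf s_neq0); rewrite -h1 h2 [RHS]mulrAC -exprSr subn1 prednK ?(ltnW n_gt1) //.
by rewrite mulrC.
Qed.

(** In an orthonormal eigenbasis the quadratic form is a sum of [e_i |w_i|^2], so the smallest
    eigenvalue is a witness. The diagonalisation takes place over [complex R], where a real
    symmetric matrix is Hermitian with real spectrum; each [e_i] is then a real root of the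
    characteristic polynomial, hence in [lam]. *)
Lemma eigenvalue_le_quadratic_form (n : nat) (H : nat -> nat -> R) (lam : list R) (xi : nat -> R) :
  (0 < n)%coq_nat ->
  (forall i j, (i < n)%coq_nat -> (j < n)%coq_nat -> H i j = H j i) ->
  (forall t, det n (fun i j => ((if Nat.eqb i j then t else 0) - H i j)%R)
             = fold_right Rmult 1%R (List.map (fun m => (t - m)%R) lam)) ->
  exists y, List.In y lam /\
    Rle (Rmult y (rsumn n (fun i => pow (xi i) 2)))
        (rsumn n (fun i => rsumn n (fun j => (xi i * H i j * xi j)%R))).
Proof.
move=> /ssrnat.ltP n_gt0 Hsym Hchar.
pose rc : {rmorphism R -> complex R} := real_complex R.
pose A := map_mx rc (mxof n H).
have A_herm : A \is hermsymmx.
  apply: realsym_hermsym.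
    apply/is_hermitianmxP; rewrite expr0 scale1r.
    by apply/matrixP=> i j; rewrite !mxE /= Hsym //; apply/ssrnat.ltP.
  by apply/mxOverP => i j; rewrite !mxE complex_real.
have A_norm := hermitian_normalmx A_herm.
have := orthomx_spectralP A_norm.
set U := spectralmx A; set d := spectral_diag A => AE.
have Uu : U \is unitarymx := spectral_unitarymx A.
have d_real := hermitian_spectral_diag_real A_herm.
have dr i : d 0 i = rc (complex.Re (d 0 i)).
  have /mxOverP/(_ 0 i) := d_real.
  by case: (d 0 i) => a b /complex_realP [x ->].
pose e i : R := complex.Re (d 0 i).
have root_e i : List.In (e i) lam.
  have : \det ((e i)%:M - mxof n H) = 0.
    apply: (fmorph_inj rc); rewrite -det_map_mx map_mxB map_scalar_mx rmorph0 -/A -dr.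
    have -> : (d 0 i)%:M - A = invmx U *m diag_mx (const_mx (d 0 i) - d) *m U.
      rewrite AE raddfB /= diag_const_mx mulmxBr mulmxBl; congr (_ - _).
      by rewrite mul_mx_scalar -scalemxAl mulVmx ?unitarymx_unit // scalemx1.
    by rewrite !det_mulmx det_diag (bigD1 i) //= !mxE subrr mul0r mulr0 mul0r.
  rewrite -char_mxE -detE Hchar; elim: (lam) => [/eqP|a l IH] /=; first by rewrite oner_eq0.
  move=> /eqP; rewrite [X in X == _](_ : _ = (e i - a) * fold_right Rmult 1%R (List.map (fun m : R => (e i - m)%R) l)) //.
  by rewrite mulf_eq0 subr_eq0 => /orP[/eqP->|/eqP/IH]; [left | right].
pose i0 : 'I_n := Ordinal n_gt0.
pose im := [arg min_(i < i0) e i]%O.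
have im_min i : e im <= e i by rewrite /im; case: arg_minP => //= j _; apply.
exists (e im); split; first exact: root_e.
(* [w] below holds the coordinates of the real vector [xi] in the eigenbasis; they may be complex,
   so squares turn into products with the conjugate. *)
pose v : 'rV[complex R]_n := \row_j rc (xi j).
pose w := v *m invmx U.
have UVE : invmx U = map_mx conjC U^T by rewrite invmx_unitary.
have vtE : map_mx conjC v^T = v^T.
  by apply/matrixP=> a b; rewrite !mxE; apply/CrealP; rewrite complex_real.
have wtE : map_mx conjC w^T = U *m v^T.
  by rewrite /w UVE trmx_mul map_mxM vtE -map_trmx trmxK -map_mx_comp (map_mx_id (@conjCK _)).
have formE : (v *m A *m v^T) 0 0 = \sum_i rc (e i) * (w 0 i * (w 0 i)^*).
  rewrite AE !mulmxA -/w -mulmxA -wtE mxE; apply: eq_bigr => i _.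
  by rewrite mul_mx_diag !mxE (dr i) mulrAC mulrC mulrA.
have normE : (v *m v^T) 0 0 = \sum_i (w 0 i * (w 0 i)^*).
  have -> : v *m v^T = w *m map_mx conjC w^T.
    by rewrite wtE /w mulmxA mulmxKV // unitarymx_unit.
  by rewrite mxE; apply: eq_bigr => i _; rewrite !mxE.
have formE2 : (v *m A *m v^T) 0 0 =
   rc (rsumn n (fun i => rsumn n (fun j => (xi i * H i j * xi j)%R))).
  rewrite rsumnE; under eq_bigr do rewrite rsumnE.
  rewrite exchange_big rmorph_sum mxE; apply: eq_bigr => j _.
  rewrite [in LHS]mxE big_distrl rmorph_sum; apply: eq_bigr => i _.
  by rewrite !mxE /= -!rmorphM.
have normE2 : (v *m v^T) 0 0 = rc (rsumn n (fun i => pow (xi i) 2)).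
  rewrite rsumnE rmorph_sum mxE; apply: eq_bigr => i _.
  by rewrite !mxE -rmorphM; congr (rc _); rewrite RpowE expr2.
apply/RleP; rewrite -(lecR (R := R)).
change (rc (e im * rsumn n (fun i => pow (xi i) 2)) <=
  rc (rsumn n (fun i => rsumn n (fun j => (xi i * H i j * xi j)%R)))).
rewrite rmorphM -formE2 -normE2 formE normE mulr_sumr; apply: ler_sum => i _.
by apply: ler_wpM2r; [exact: mul_conjC_ge0 | rewrite lecR].
Qed.
End MatrixFacts.

(** * Elementary symmetric polynomials *)

Lemma esym_0 (l : list R) : esym l 0 = 1.
Proof. destruct l; reflexivity. Qed.

Lemma esym_cons (x : R) (l : list R) (j : nat) :
  esym (x :: l) (S j) = esym l (S j) + x * esym l j.
Proof. reflexivity. Qed.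

Lemma esym_perm (l l' : list R) : Permutation l l' -> forall j, esym l j = esym l' j.
Proof.
  induction 1; intros j.
  - reflexivity.
  - destruct j; [reflexivity|]. rewrite !esym_cons, !IHPermutation. reflexivity.
  - destruct j; [reflexivity|]. rewrite !esym_cons.
    destruct j; [rewrite !esym_0; ring|]. rewrite !esym_cons. ring.
  - rewrite IHPermutation1. apply IHPermutation2.
Qed.

Lemma esym_oversize (l : list R) (j : nat) : (length l < j)%nat -> esym l j = 0.
Proof.
  revert j; induction l as [|x l IH]; intros [|j] Hj; cbn [length] in Hj; try lia.
  - reflexivity.
  - rewrite esym_cons, !IH by lia. ring.
Qed.

Lemma esym_pos_length (l : list R) (j : nat) : 0 < esym l j -> (j <= length l)%nat.
Proof.
  intros H. destruct (le_lt_dec j (length l)) as [h|h]; [exact h|].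
  rewrite esym_oversize in H by exact h. lra.
Qed.

Lemma esym_pos_of_nonneg (l : list R) (j : nat) :
  (forall x, In x l -> 0 <= x) -> 0 <= esym l j.
Proof.
  revert j; induction l as [|x l IH]; intros [|j] Hl; try (cbn; lra).
  rewrite esym_cons.
  assert (Hx := Hl x (or_introl eq_refl)).
  assert (H1 := IH (S j) (fun y hy => Hl y (or_intror hy))).
  assert (H2 := IH j (fun y hy => Hl y (or_intror hy))).
  nra.
Qed.

Lemma esym_pos_of_pos (l : list R) (j : nat) :
  (forall x, In x l -> 0 < x) -> (j <= length l)%nat -> 0 < esym l j.
Proof.
  revert j; induction l as [|x l IH]; intros [|j] Hl Hj; cbn [length] in Hj; try (cbn; lra); try lia.
  rewrite esym_cons.
  assert (Hx := Hl x (or_introl eq_refl)).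
  assert (H1 : 0 <= esym l (S j))
    by (apply esym_pos_of_nonneg; intros y hy; left; apply Hl; right; exact hy).
  assert (H2 : 0 < esym l j) by (apply IH; [intros y hy; apply Hl; right; exact hy|lia]).
  nra.
Qed.

Fixpoint picks (l : list R) : list (R * list R) :=
  match l with
  | nil => nil
  | x :: l' => (x, l') :: map (fun p => (fst p, x :: snd p)) (picks l')
  end.

Lemma picks_perm (l : list R) (p : R * list R) :
  In p (picks l) -> Permutation l (fst p :: snd p).
Proof.
  revert p; induction l as [|x l IH]; cbn; intros p Hp; [contradiction|].
  destruct Hp as [<-|Hp]; [reflexivity|].
  apply in_map_iff in Hp. destruct Hp as [p' [<- Hp']]. cbn.
  rewrite perm_swap. apply perm_skip. apply IH, Hp'.
Qed.

Definition rsuml {A : Type} (F : A -> R) (L : list A) : R := fold_right (fun p acc => F p + acc) 0 L.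

Lemma rsuml_map {A B : Type} (F : B -> R) (g : A -> B) (L : list A) :
  rsuml F (map g L) = rsuml (fun a => F (g a)) L.
Proof. induction L; cbn; [reflexivity|]. unfold rsuml in *. rewrite IHL. reflexivity. Qed.

Lemma rsuml_lin {A : Type} (F G : A -> R) (c : R) (L : list A) :
  rsuml (fun a => F a + c * G a) L = rsuml F L + c * rsuml G L.
Proof. induction L; cbn; [ring|]. unfold rsuml in *. rewrite IHL. ring. Qed.

Lemma rsuml_ext {A : Type} (F G : A -> R) (L : list A) :
  (forall a, In a L -> F a = G a) -> rsuml F L = rsuml G L.
Proof.
  induction L as [|a L IH]; intros H; cbn; [reflexivity|].
  rewrite (H a (or_introl eq_refl)). f_equal. apply IH. intros b hb; apply H; right; exact hb.
Qed.

Lemma rsuml_nonpos {A : Type} (F : A -> R) (L : list A) :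
  (forall a, In a L -> F a <= 0) -> rsuml F L <= 0.
Proof.
  induction L as [|a L IH]; intros H; cbn; [lra|].
  assert (H1 := H a (or_introl eq_refl)).
  assert (H2 := IH (fun b hb => H b (or_intror hb))). unfold rsuml in H2. lra.
Qed.

(** Euler's identity for a homogeneous polynomial of degree j + 1: the partial derivative of
    [e_(j+1)] in one entry is [e_j] of the others. [picks] goes by position, so repeated entries are
    counted separately. *)
Lemma esym_euler (l : list R) (j : nat) :
  rsuml (fun p => fst p * esym (snd p) j) (picks l) = INR (S j) * esym l (S j).
Proof.
  revert j; induction l as [|x l IH]; intros j; [cbn [picks rsuml fold_right esym]; ring|].
  cbn [picks]. unfold rsuml. cbn [fold_right fst snd]. fold (@rsuml (R * list R)).
  change (fold_right _ 0 ?L) with (rsuml (fun p : R * list R => fst p * esym (snd p) j) L).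
  rewrite rsuml_map. cbn [fst snd].
  destruct j as [|j].
  - rewrite (rsuml_ext _ (fun p => fst p * esym (snd p) 0)).
    + rewrite IH, esym_cons, !esym_0. cbn [INR]. ring.
    + intros p _. rewrite !esym_0. reflexivity.
  - rewrite (rsuml_ext _ (fun p => fst p * esym (snd p) (S j) + x * (fst p * esym (snd p) j))).
    + rewrite rsuml_lin, !IH, esym_cons, !S_INR. ring.
    + intros p _. rewrite esym_cons. ring.
Qed.

(* If [e_m = 0], Euler's identity becomes
   [(m+1) e_(m+1) = - sum_i x_i^2 e_(m-1)(the others)]. *)
Lemma esym_nonpos_after_zero (l : list R) (m : nat) :
  esym l (S m) = 0 ->
  (forall x f, Permutation l (x :: f) -> 0 <= esym f m) ->
  esym l (S (S m)) <= 0.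
Proof.
  intros H0 Hf.
  assert (HE := esym_euler l (S m)).
  assert (Hle : rsuml (fun p => fst p * esym (snd p) (S m)) (picks l) <= 0).
  { apply rsuml_nonpos. intros [x f] Hp. cbn [fst snd].
    assert (HP := picks_perm l _ Hp). cbn [fst snd] in HP.
    assert (H1 := Hf x f HP).
    rewrite (esym_perm _ _ HP), esym_cons in H0.
    replace (esym f (S m)) with (- x * esym f m) by lra. nra. }
  rewrite HE in Hle.
  assert (0 < INR (S (S m))) by (apply lt_0_INR; lia).
  apply Rnot_lt_le. intros h. nra.
Qed.

Definition shift (t : R) (l : list R) : list R := map (fun x => x + t) l.

Lemma shift_length (t : R) (l : list R) : length (shift t l) = length l.
Proof. apply length_map. Qed.

Lemma shift_0 (l : list R) : shift 0 l = l.
Proof.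
  unfold shift. rewrite <- (map_id l) at 2. apply map_ext. intros; ring.
Qed.

(** Along the direction (1, .., 1) the derivative is the sum of all partial derivatives, in which
    every product of j entries occurs once for each of the other [length l - j] entries. *)
Lemma esym_shift_deriv (l : list R) (j : nat) (t : R) :
  derivable_pt_lim (fun t => esym (shift t l) (S j)) t
    ((INR (length l) - INR j) * esym (shift t l) j).
Proof.
  revert j; induction l as [|x l IH]; intros j.
  - destruct j.
    + apply derivable_pt_lim_ext with (fun _ => 0); [reflexivity|].
      cbn. replace ((0 - 0) * 1) with 0 by ring. apply derivable_pt_lim_const.
    + apply derivable_pt_lim_ext with (fun _ => 0); [reflexivity|].
      cbn [shift map esym]. rewrite Rmult_0_r. apply derivable_pt_lim_const.
  - apply derivable_pt_lim_ext with
      (fun t => esym (shift t l) (S j) + (x + t) * esym (shift t l) j).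
    { intros s. reflexivity. }
    assert (Hx : derivable_pt_lim (fun t => x + t) t 1).
    { replace 1 with (0 + 1) by ring. apply derivable_pt_lim_plus.
      - apply derivable_pt_lim_const. - apply derivable_pt_lim_id. }
    destruct j as [|j].
    + apply derivable_pt_lim_ext with (fun t => esym (shift t l) 1 + (x + t)).
      { intros s. rewrite esym_0. ring. }
      replace ((INR (length (x :: l)) - INR 0) * esym (shift t (x :: l)) 0)
        with ((INR (length l) - INR 0) * esym (shift t l) 0 + 1).
      * apply derivable_pt_lim_plus; [apply IH|exact Hx].
      * rewrite !esym_0. cbn [length]. rewrite S_INR. cbn [INR]. ring.
    + replace ((INR (length (x :: l)) - INR (S j)) * esym (shift t (x :: l)) (S j))
        with ((INR (length l) - INR (S j)) * esym (shift t l) (S j) +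
              (1 * esym (shift t l) (S j) +
               (x + t) * ((INR (length l) - INR j) * esym (shift t l) j))).
      * apply derivable_pt_lim_plus; [apply IH|].
        apply (derivable_pt_lim_mult (fun t => x + t) (fun t => esym (shift t l) (S j)));
          [exact Hx|apply IH].
      * cbn [shift map]. rewrite esym_cons. cbn [length]. fold (shift t l). rewrite !S_INR. ring.
Qed.

Lemma esym_shift_cont (l : list R) (j : nat) : continuity (fun t => esym (shift t l) j).
Proof.
  intros t. destruct j as [|j].
  - apply continuity_pt_ext with (fun _ => 1); [intros s; symmetry; apply esym_0|].
    apply continuity_pt_const. intros a b; reflexivity.
  - apply derivable_continuous_pt. eexists. apply esym_shift_deriv.
Qed.

Lemma MVT_lim (f f' : R -> R) (a b : R) : a < b ->
  (forall x, a <= x <= b -> derivable_pt_lim f x (f' x)) ->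
  exists x, a < x < b /\ f b - f a = f' x * (b - a).
Proof.
  intros Hab Hd.
  assert (pr : forall x, a < x < b -> derivable_pt f x)
    by (intros x Hx; exists (f' x); apply Hd; lra).
  destruct (MVT_cor2 f f' a b Hab) as [x [H1 H2]]; [intros; apply Hd; lra|].
  exists x. split; [exact H2|lra].
Qed.

(** Induction on j: the derivative of [e_(j+1)] is a positive multiple of [e_j], which is already
    positive for t > 0, and [e_(j+1)] starts from a nonnegative value. *)
Lemma esym_shift_pos (l : list R) (k : nat) :
  (k <= length l)%nat -> (forall j, (j <= k)%nat -> 0 <= esym l j) ->
  forall j, (j <= k)%nat -> forall t, 0 < t -> 0 < esym (shift t l) j.
Proof.
  intros Hk Hl. induction j as [|j IH]; intros Hj t Ht.
  - rewrite esym_0. lra.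
  - destruct (MVT_lim (fun t => esym (shift t l) (S j))
       (fun t => (INR (length l) - INR j) * esym (shift t l) j) 0 t Ht) as [s [Hs Heq]].
    { intros; apply esym_shift_deriv. }
    assert (H1 := IH ltac:(lia) s ltac:(lra)).
    assert (H2 := Hl (S j) Hj).
    assert (H3 : INR j < INR (length l)) by (apply lt_INR; lia).
    rewrite shift_0 in Heq.
    assert (0 < (INR (length l) - INR j) * esym (shift s l) j * (t - 0)).
    { apply Rmult_lt_0_compat; [apply Rmult_lt_0_compat|]; lra. }
    lra.
Qed.

Lemma shift_eventually_pos (l : list R) :
  exists T, 0 < T /\ forall x, In x (shift T l) -> 0 < x.
Proof.
  induction l as [|x l [T [HT IH]]].
  - exists 1. split; [lra|]. cbn; tauto.
  - exists (Rmax T (1 - x)). split; [apply Rlt_le_trans with T; [lra|apply Rmax_l]|].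
    intros y [<-|Hy].
    + pose proof (Rmax_r T (1 - x)). lra.
    + apply in_map_iff in Hy. destruct Hy as [w [<- Hw]].
      assert (0 < w + T) by (apply IH; apply in_map_iff; exists w; auto).
      pose proof (Rmax_l T (1 - x)). lra.
Qed.

Lemma limit_nonneg_at_right (f : R -> R) :
  continuity_pt f 0 -> (forall t, 0 < t -> 0 < f t) -> 0 <= f 0.
Proof.
  intros Hc Hp. apply Rnot_lt_le. intros h.
  destruct (Hc (- f 0) ltac:(lra)) as [d [Hd H]].
  assert (H1 := Hp (d / 2) ltac:(lra)).
  specialize (H (d / 2)).
  assert (H2 : Rabs (f (d / 2) - f 0) < - f 0).
  { apply H. split; [split; [exact I|lra]|].
    simpl. unfold Rdist. rewrite Rabs_right; lra. }
  apply Rabs_def2 in H2. lra.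
Qed.

(* The cone [e_1, .., e_k > 0] is stable (at level [k - 1]) under deleting one entry:
   otherwise, moving along [l + t] from [t] large, some [e_m] of the remaining entries
   would vanish first, contradicting [esym_nonpos_after_zero]. *)
Lemma esym_tail_pos (k : nat) : forall (x : R) (f : list R),
  (forall j, (j <= k)%nat -> 0 < esym (x :: f) j) ->
  forall j, (j < k)%nat -> 0 < esym f j.
Proof.
  induction k as [|m IH]; intros x f H j Hj; [lia|].
  destruct (Nat.eq_dec j m) as [->|Hne].
  2: { apply (IH x f); [intros; apply H; lia|lia]. }
  destruct m as [|m]; [rewrite esym_0; lra|].
  apply Rnot_le_lt. intros Hle.
  assert (Hlen : (S m <= length f)%nat).
  { assert (h := esym_pos_length _ _ (H (S (S m)) ltac:(lia))). cbn [length] in h. lia. }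
  destruct (shift_eventually_pos f) as [T [HT HTp]].
  assert (Hex : exists t0, 0 <= t0 /\ esym (shift t0 f) (S m) = 0).
  { destruct (IVT_cor (fun t => esym (shift t f) (S m)) 0 T (esym_shift_cont f (S m)) ltac:(lra))
      as [t0 [Ht0 H0]].
    - assert (0 < esym (shift T f) (S m)) by (apply esym_pos_of_pos; [exact HTp|rewrite shift_length; lia]).
      rewrite shift_0. nra.
    - exists t0. split; [lra|exact H0]. }
  destruct Hex as [t0 [Ht0 Hz]].
  set (h := shift t0 f) in *.
  assert (Hsh : forall j, (j <= S (S m))%nat -> 0 < esym ((x + t0) :: h) j).
  { intros i Hi. change ((x + t0) :: h) with (shift t0 (x :: f)).
    destruct (Req_dec t0 0) as [->|hn].
    - rewrite shift_0. apply H. exact Hi.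
    - apply (esym_shift_pos (x :: f) (S (S m))); [cbn; lia|intros; left; apply H; lia|exact Hi|lra]. }
  assert (Hh : forall j, (j < S m)%nat -> 0 < esym h j).
  { intros i Hi. apply (IH (x + t0) h); [|exact Hi]. intros; apply Hsh; lia. }
  assert (Hpos : 0 < esym h (S (S m))).
  { assert (h1 := Hsh (S (S m)) ltac:(lia)). rewrite esym_cons, Hz in h1. lra. }
  apply (Rlt_irrefl 0). apply Rlt_le_trans with (1 := Hpos).
  apply esym_nonpos_after_zero; [exact Hz|].
  intros y g HP.
  (* Since [e_(S m)] vanishes at [h], the induction hypothesis is applied to [h] shifted by e > 0,
     where [e_0, .., e_(S m)] are all positive; then e tends to 0. *)
  rewrite <- (shift_0 g). apply (limit_nonneg_at_right (fun e => esym (shift e g) m)).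
  - apply esym_shift_cont.
  - intros e He. apply (IH (y + e) (shift e g)); [|lia].
    intros i Hi. change ((y + e) :: shift e g) with (shift e (y :: g)).
    rewrite <- (esym_perm (shift e h)) by (apply Permutation_map; exact HP).
    apply (esym_shift_pos h (S m)); [unfold h; rewrite shift_length; lia| |exact Hi|exact He].
    intros i' Hi'. destruct (Nat.eq_dec i' (S m)) as [->|hn]; [rewrite Hz; lra|left; apply Hh; lia].
Qed.

(** A zero of [e_m] with 0 < m < k would force [e_(m+1) <= 0] by [esym_nonpos_after_zero], so
    positivity descends from [e_k]. What that lemma asks of the lists with one entry deleted comes
    from [esym_tail_pos] on a small shift. *)
Lemma esym_pos_of_nonneg_top (l : list R) (k : nat) :
  (forall j, (j <= k)%nat -> 0 <= esym l j) -> 0 < esym l k ->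
  forall j, (j <= k)%nat -> 0 < esym l j.
Proof.
  intros Hn Hk.
  assert (Hlen := esym_pos_length _ _ Hk).
  assert (Hdel : forall x f, Permutation l (x :: f) -> forall j, (j < k)%nat -> 0 <= esym f j).
  { intros x f HP j Hj. rewrite <- (shift_0 f).
    apply (limit_nonneg_at_right (fun e => esym (shift e f) j)); [apply esym_shift_cont|].
    intros e He. apply (esym_tail_pos k (x + e) (shift e f)); [|exact Hj].
    intros i Hi. change ((x + e) :: shift e f) with (shift e (x :: f)).
    rewrite <- (esym_perm (shift e l)) by (apply Permutation_map; exact HP).
    apply (esym_shift_pos l k); auto. }
  assert (Hdown : forall d j, (j + d = k)%nat -> 0 < esym l j).
  { induction d as [|d IH]; intros j Hj; [replace j with k by lia; exact Hk|].
    assert (H1 := IH (S j) ltac:(lia)).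
    destruct j as [|j]; [rewrite esym_0; lra|].
    destruct (Hn (S j) ltac:(lia)) as [h|h]; [exact h|exfalso].
    assert (esym l (S (S j)) <= 0); [|lra].
    apply esym_nonpos_after_zero; [auto|]. intros x f HP. apply (Hdel x f HP). lia. }
  intros j Hj. apply (Hdown (k - j)%nat). lia.
Qed.

(** The derivative of [e_i] in one entry is [e_(i-1)] of the others, positive in the cone by
    [esym_tail_pos]. Entries are raised one at a time, which does not leave the cone; [pre] collects
    those already raised. *)
Lemma esym_mono (k : nat) (l l' : list R) : Forall2 Rle l l' -> forall pre,
  (forall j, (j <= k)%nat -> 0 < esym (pre ++ l) j) ->
  forall j, (j <= k)%nat -> esym (pre ++ l) j <= esym (pre ++ l') j.
Proof.
  induction 1 as [|x x' l l' Hx Hl IH]; intros pre Hp j Hj; [lra|].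
  assert (P1 : forall y f, Permutation (pre ++ y :: f) (y :: pre ++ f))
    by (intros; symmetry; apply Permutation_middle).
  assert (Hc : forall i, (i <= k)%nat -> esym (pre ++ x :: l) i <= esym (pre ++ x' :: l) i).
  { intros i Hi. rewrite (esym_perm _ _ (P1 x l)), (esym_perm _ _ (P1 x' l)).
    destruct i as [|i]; [rewrite !esym_0; lra|]. rewrite !esym_cons.
    assert (0 < esym (pre ++ l) i).
    { apply (esym_tail_pos k x); [|lia]. intros i' Hi'. rewrite <- (esym_perm _ _ (P1 x l)). auto. }
    nra. }
  apply Rle_trans with (1 := Hc j Hj).
  specialize (IH (pre ++ [x'])). rewrite <- !app_assoc in IH. cbn [app] in IH.
  apply IH; [|exact Hj].
  intros i Hi. apply Rlt_le_trans with (1 := Hp i Hi). apply Hc, Hi.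
Qed.

(** The list on the right will be the spectrum of [a I + N x x^T], so a sharper bound is available
    for a single entry only. *)
Lemma esym_le_of_bounds (k n : nat) (a b y : R) (l : list R) :
  length l = S n -> (forall j, (j <= k)%nat -> 0 < esym l j) ->
  (forall x, In x l -> x <= a) -> In y l -> y <= b ->
  esym l k <= esym (b :: repeat a n) k.
Proof.
  intros Hlen Hp Ha Hy Hb.
  destruct (in_split _ _ Hy) as [l1 [l2 ->]].
  assert (HP : Permutation (l1 ++ y :: l2) (y :: l1 ++ l2)) by (symmetry; apply Permutation_middle).
  rewrite (esym_perm _ _ HP).
  apply (esym_mono k (y :: l1 ++ l2) (b :: repeat a n)) with (pre := nil).
  - constructor; [exact Hb|].
    assert (Hl : length (l1 ++ l2) = n).
    { apply Permutation_length in HP. cbn [length] in HP. lia. }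
    assert (Hin : forall x, In x (l1 ++ l2) -> x <= a).
    { intros x hx. apply Ha. apply in_app_iff in hx. apply in_app_iff. cbn. tauto. }
    clear -Hl Hin. revert n Hl; induction (l1 ++ l2) as [|x l IH]; intros n Hl; subst n; cbn; constructor.
    + apply Hin. left; reflexivity.
    + apply IH; [intros; apply Hin; right; assumption|reflexivity].
  - intros j Hj. cbn [app]. rewrite <- (esym_perm _ _ HP). auto.
  - lia.
Qed.

Lemma esym_repeat (a : R) (n k : nat) : (k <= n)%nat -> esym (repeat a n) k = C n k * a ^ k.
Proof.
  revert k; induction n as [|n IH]; intros [|k] Hk; try lia.
  - cbn. unfold C. cbn. field.
  - rewrite esym_0. unfold C. rewrite Nat.sub_0_r. change (INR (fact 0)) with 1. cbn [pow].
    field. apply INR_fact_neq_0.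
  - cbn [repeat]. rewrite esym_cons, (IH k) by lia.
    destruct (Nat.eq_dec k n) as [->|hn].
    + rewrite esym_oversize by (rewrite repeat_length; lia).
      unfold C. rewrite !Nat.sub_diag. cbn [pow]. 
      assert (INR (fact n) <> 0) by apply INR_fact_neq_0.
      assert (INR (fact (S n)) <> 0) by apply INR_fact_neq_0.
      cbn [fact INR] . field. split; auto.
    + rewrite IH by lia. rewrite <- pascal by lia. cbn [pow]. ring.
Qed.

(** * Calculus in the unit ball *)

Lemma seq_snoc (a n : nat) : seq a (S n) = seq a n ++ [(a + n)%nat].
Proof. rewrite <- seq_S. reflexivity. Qed.

Lemma fold_right_Rplus_app (l l' : list R) :
  fold_right Rplus 0 (l ++ l') = fold_right Rplus 0 l + fold_right Rplus 0 l'.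
Proof. induction l; cbn; [ring|]. rewrite IHl. ring. Qed.

Lemma rsumn_S (n : nat) (f : nat -> R) : rsumn (S n) f = rsumn n f + f n.
Proof.
  unfold rsumn. rewrite seq_snoc, map_app, fold_right_Rplus_app. cbn. ring.
Qed.

Lemma rsumn_0 (f : nat -> R) : rsumn 0 f = 0.
Proof. reflexivity. Qed.

Lemma rsumn_ext (n : nat) (f g : nat -> R) :
  (forall i, (i < n)%nat -> f i = g i) -> rsumn n f = rsumn n g.
Proof.
  induction n as [|n IH]; intros H; [reflexivity|].
  rewrite !rsumn_S, IH, H by (intros; try apply H; lia). reflexivity.
Qed.

Lemma rsumn_plus (n : nat) (f g : nat -> R) :
  rsumn n (fun i => f i + g i) = rsumn n f + rsumn n g.
Proof. induction n as [|n IH]; [rewrite !rsumn_0; ring|]. rewrite !rsumn_S, IH. ring. Qed.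

Lemma rsumn_scal (n : nat) (c : R) (f : nat -> R) :
  rsumn n (fun i => c * f i) = c * rsumn n f.
Proof. induction n as [|n IH]; [rewrite !rsumn_0; ring|]. rewrite !rsumn_S, IH. ring. Qed.

Lemma rsumn_le (n : nat) (f g : nat -> R) :
  (forall i, (i < n)%nat -> f i <= g i) -> rsumn n f <= rsumn n g.
Proof.
  induction n as [|n IH]; intros H; [rewrite !rsumn_0; lra|].
  rewrite !rsumn_S. assert (h1 := H n ltac:(lia)).
  assert (h2 : rsumn n f <= rsumn n g) by (apply IH; intros; apply H; lia). lra.
Qed.

Lemma rsumn_const (n : nat) (c : R) : rsumn n (fun _ => c) = INR n * c.
Proof. induction n as [|n IH]; [rewrite rsumn_0; cbn; ring|]. rewrite rsumn_S, IH, S_INR. ring. Qed.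

Lemma rsumn_nonneg (n : nat) (f : nat -> R) :
  (forall i, (i < n)%nat -> 0 <= f i) -> 0 <= rsumn n f.
Proof.
  intros H. rewrite <- (Rmult_0_r (INR n)), <- rsumn_const. apply rsumn_le, H.
Qed.

Lemma rsumn_term_le (n : nat) (f : nat -> R) (i : nat) :
  (forall i, (i < n)%nat -> 0 <= f i) -> (i < n)%nat -> f i <= rsumn n f.
Proof.
  induction n as [|n IH]; intros H Hi; [lia|]. rewrite rsumn_S.
  assert (0 <= f n) by (apply H; lia).
  destruct (Nat.eq_dec i n) as [->|hn].
  - assert (0 <= rsumn n f) by (apply rsumn_nonneg; intros; apply H; lia). lra.
  - assert (f i <= rsumn n f) by (apply IH; [intros; apply H; lia|lia]). lra.
Qed.

Lemma rsumn_single (n i : nat) (c : R) : (i < n)%nat ->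
  rsumn n (fun j => if Nat.eqb j i then c else 0) = c.
Proof.
  induction n as [|n IH]; intros Hi; [lia|]. rewrite rsumn_S.
  destruct (Nat.eq_dec i n) as [->|hn].
  - rewrite Nat.eqb_refl. rewrite (rsumn_ext n _ (fun _ => 0)).
    + rewrite rsumn_const. ring.
    + intros j Hj. destruct (Nat.eqb_spec j n); [lia|reflexivity].
  - rewrite IH by lia. destruct (Nat.eqb_spec n i); [lia|ring].
Qed.

Lemma derivable_pt_lim_rsumn (n : nat) (f : nat -> R -> R) (l : nat -> R) (x : R) :
  (forall i, (i < n)%nat -> derivable_pt_lim (f i) x (l i)) ->
  derivable_pt_lim (fun t => rsumn n (fun i => f i t)) x (rsumn n l).
Proof.
  induction n as [|n IH]; intros H.
  - apply derivable_pt_lim_const.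
  - rewrite rsumn_S. apply derivable_pt_lim_ext with (fun t => rsumn n (fun i => f i t) + f n t).
    + intros t. rewrite rsumn_S. reflexivity.
    + apply derivable_pt_lim_plus; [apply IH; intros; apply H; lia|apply H; lia].
Qed.

Lemma continuity_pt_rsumn (n : nat) (f : nat -> R -> R) (x : R) :
  (forall i, (i < n)%nat -> continuity_pt (f i) x) ->
  continuity_pt (fun t => rsumn n (fun i => f i t)) x.
Proof.
  induction n as [|n IH]; intros H.
  - apply continuity_pt_const. intros a b; reflexivity.
  - apply continuity_pt_ext with (fun t => rsumn n (fun i => f i t) + f n t).
    + intros t. rewrite rsumn_S. reflexivity.
    + apply continuity_pt_plus; [apply IH; intros; apply H; lia|apply H; lia].
Qed.

Lemma dist_lt_of_coords (n : nat) (x y : nat -> R) (e d : R) : 0 <= d ->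
  (forall i, (i < n)%nat -> Rabs (x i - y i) < d) -> INR n * d < e -> 0 < e -> dist n x y < e.
Proof.
  intros Hd H Hn He. unfold dist.
  rewrite <- (sqrt_pow2 e) by lra. apply sqrt_lt_1.
  - apply rsumn_nonneg. intros; apply pow2_ge_0.
  - apply pow2_ge_0.
  - apply Rle_lt_trans with (INR n * d ^ 2).
    + rewrite <- rsumn_const. apply rsumn_le. intros i Hi.
      rewrite <- (pow2_abs (x i - y i)). apply pow_incr. split; [apply Rabs_pos|left; auto].
    + assert (H0 : 0 <= INR n) by apply pos_INR.
      destruct n as [|n]; [cbn; nra|].
      assert (1 <= INR (S n)) by (rewrite S_INR; pose proof (pos_INR n); lra).
      apply Rle_lt_trans with ((INR (S n) * d) ^ 2); [nra|].
      assert (0 <= INR (S n) * d) by nra. nra.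
Qed.

Lemma coord_le_dist (n : nat) (x y : nat -> R) (i : nat) : (i < n)%nat ->
  Rabs (x i - y i) <= dist n x y.
Proof.
  intros Hi. unfold dist. rewrite <- sqrt_Rsqr_abs. apply sqrt_le_1_alt.
  unfold Rsqr. replace ((x i - y i) * (x i - y i)) with ((x i - y i) ^ 2) by ring.
  apply (rsumn_term_le n (fun i => (x i - y i) ^ 2)); [intros; apply pow2_ge_0|exact Hi].
Qed.

Lemma sqnorm_nonneg (n : nat) (x : nat -> R) : 0 <= sqnorm n x.
Proof. apply rsumn_nonneg. intros; apply pow2_ge_0. Qed.

Lemma sqnorm_zero (n : nat) (x : nat -> R) : sqnorm n x = 0 -> forall i, (i < n)%nat -> x i = 0.
Proof.
  intros H i Hi.
  assert (h := rsumn_term_le n (fun i => x i ^ 2) i (fun i _ => pow2_ge_0 (x i)) Hi).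
  cbv beta in h. fold (sqnorm n x) in h. nra.
Qed.

Lemma sqnorm_cont (n : nat) (x : nat -> R) (e : R) : 0 < e ->
  exists d, 0 < d /\ forall y, (forall i, (i < n)%nat -> Rabs (y i - x i) < d) ->
    Rabs (sqnorm n y - sqnorm n x) < e.
Proof.
  unfold sqnorm. revert e. induction n as [|n IH]; intros e He.
  - exists 1. split; [lra|]. intros y _. rewrite !rsumn_0, Rminus_diag, Rabs_R0. exact He.
  - destruct (IH (e / 2) ltac:(lra)) as [d [Hd Hn]].
    set (M := 2 * Rabs (x n) + 1).
    assert (HM : 0 < M) by (unfold M; pose proof (Rabs_pos (x n)); lra).
    exists (Rmin (Rmin d 1) (e / 2 / M)). split.
    + repeat apply Rmin_pos; try lra. apply Rdiv_lt_0_compat; lra.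
    + intros y Hy. rewrite !rsumn_S.
      assert (h1 := Hn y). 
      assert (h2 : Rabs (rsumn n (fun i => y i ^ 2) - rsumn n (fun i => x i ^ 2)) < e / 2).
      { apply h1. intros i Hi. apply Rlt_le_trans with (1 := Hy i ltac:(lia)).
        apply Rle_trans with (1 := Rmin_l _ _), Rmin_l. }
      assert (h3 := Hy n ltac:(lia)).
      assert (h4 : Rabs (y n - x n) < 1).
      { apply Rlt_le_trans with (1 := h3). apply Rle_trans with (1 := Rmin_l _ _), Rmin_r. }
      assert (h5 : Rabs (y n - x n) < e / 2 / M) by (apply Rlt_le_trans with (1 := h3), Rmin_r).
      assert (h6 : Rabs (y n ^ 2 - x n ^ 2) < e / 2).
      { replace (y n ^ 2 - x n ^ 2) with ((y n - x n) * (y n + x n)) by ring.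
        rewrite Rabs_mult.
        assert (h7 : Rabs (y n + x n) <= M).
        { replace (y n + x n) with ((y n - x n) + 2 * x n) by ring.
          apply Rle_trans with (1 := Rabs_triang _ _). rewrite Rabs_mult, (Rabs_right 2) by lra.
          unfold M. lra. }
        apply Rle_lt_trans with (Rabs (y n - x n) * M).
        - apply Rmult_le_compat_l; [apply Rabs_pos|exact h7].
        - apply Rmult_lt_reg_r with (/ M); [apply Rinv_0_lt_compat; exact HM|].
          replace (Rabs (y n - x n) * M * / M) with (Rabs (y n - x n)) by (field; lra). exact h5. }
      apply Rabs_def2 in h2. apply Rabs_def2 in h6. apply Rabs_def1; lra.
Qed.

(* Coordinates of a cluster point are found one at a time, each as the supremum of the
   levels [t] for which every member of the chain meets [y_i >= t] near the previous ones. *)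
Lemma chain_cluster_point (n : nat) (I : Type) (S : I -> (nat -> R) -> Prop) (i0 : I) :
  (forall a, exists y, S a y) ->
  (forall a b, (forall y, S a y -> S b y) \/ (forall y, S b y -> S a y)) ->
  (forall a y, S a y -> forall i, (i < n)%nat -> -1 <= y i <= 1) ->
  exists x, inSub n x /\ forall a e, 0 < e -> exists y, S a y /\
    forall i, (i < n)%nat -> Rabs (y i - x i) < e.
Proof.
  intros Hne Htot Hb.
  assert (H : forall m, (m <= n)%nat -> exists x, inSub m x /\ forall a e, 0 < e -> exists y, S a y /\
    forall i, (i < m)%nat -> Rabs (y i - x i) < e).
  { induction m as [|m IH]; intros Hm.
    - exists (fun _ => 0). split; [intros ? _; reflexivity|].
      intros a e _. destruct (Hne a) as [y Hy]. exists y. split; [exact Hy|]. lia.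
    - destruct (IH ltac:(lia)) as [x [Hx Hc]].
      set (T := fun t => forall a e, 0 < e -> exists y, S a y /\
        (forall i, (i < m)%nat -> Rabs (y i - x i) < e) /\ t <= y m).
      assert (Tn : T (-1)).
      { intros a e He. destruct (Hc a e He) as [y [H1 H2]]. exists y.
        split; [exact H1|split; [exact H2|]]. apply (Hb a y H1 m). lia. }
      assert (Tb : bound T).
      { exists 1. intros t Ht. destruct (Ht i0 1 Rlt_0_1) as [y [H1 [_ H2]]].
        assert (h := Hb i0 y H1 m ltac:(lia)). lra. }
      destruct (completeness T Tb (ex_intro _ _ Tn)) as [t [Hub Hlub]].
      exists (fun i => if Nat.eqb i m then t else x i). split.
      { intros i Hi. destruct (Nat.eqb_spec i m); [lia|]. apply Hx. lia. }
      intros a e He.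
      assert (Hn : ~ T (t + e)) by (intros h; apply Hub in h; lra).
      assert (Hn' : exists b d, 0 < d /\ forall y, S b y ->
         (forall i, (i < m)%nat -> Rabs (y i - x i) < d) -> y m < t + e).
      { apply NNPP. intros h. apply Hn. intros b d Hd. apply NNPP. intros h'. apply h.
        exists b, d. split; [exact Hd|]. intros y h1 h2. apply Rnot_le_lt. intros h3.
        apply h'. exists y. auto. }
      destruct Hn' as [b [d [Hd Hbd]]].
      assert (Ht' : exists t', T t' /\ t - e < t').
      { apply NNPP. intros h. assert (t <= t - e); [|lra].
        apply Hlub. intros s Hs. apply Rnot_lt_le. intros h'. apply h. exists s. auto. }
      destruct Ht' as [t' [Ht' Hte]].
      (* In a chain one of the two members contains the other; a point of the smaller one obeys both
         the lower bound from [t'] and the upper bound from [b]. *)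
      assert (Hab : exists c, (forall y, S c y -> S a y) /\ (forall y, S c y -> S b y)).
      { destruct (Htot a b) as [h|h]; [exists a|exists b]; auto. }
      destruct Hab as [c [Hca Hcb]].
      destruct (Ht' c (Rmin d e) (Rmin_pos _ _ Hd He)) as [y [H1 [H2 H3]]].
      exists y. split; [auto|].
      intros i Hi. destruct (Nat.eqb_spec i m) as [->|hn].
      + assert (y m < t + e).
        { apply Hbd; [auto|]. intros j Hj. apply Rlt_le_trans with (1 := H2 j Hj), Rmin_l. }
        apply Rabs_def1; lra.
      + apply Rlt_le_trans with (1 := H2 i ltac:(lia)), Rmin_r. }
  destruct (H n (Nat.le_refl n)) as [x Hx]. exists x. exact Hx.
Qed.

Lemma ball_coord (n : nat) (y : nat -> R) (i : nat) : inBc n y -> (i < n)%nat -> -1 <= y i <= 1.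
Proof.
  intros [_ Hy] Hi.
  assert (h := rsumn_term_le n (fun i => y i ^ 2) i (fun i _ => pow2_ge_0 (y i)) Hi).
  cbv beta in h. fold (sqnorm n y) in h. nra.
Qed.

Lemma zero_in_ball (n : nat) : inB n (fun _ => 0).
Proof.
  split; [intros ? _; reflexivity|]. unfold sqnorm.
  rewrite (rsumn_ext n _ (fun _ => 0)) by (intros; ring). rewrite rsumn_const. lra.
Qed.

(** The superlevel sets [f a <= f y] form a chain of nonempty sets. A cluster point of the chain
    lies in the closed ball, and by continuity [f] is there at least as large as every [f a]. *)
Lemma closed_ball_max (n : nat) (f : (nat -> R) -> R) :
  (forall x, inBc n x -> cont_on (inBc n) n f x) ->
  exists x, inBc n x /\ forall y, inBc n y -> f y <= f x.
Proof.
  intros Hf.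
  assert (H0 : inBc n (fun _ => 0)) by (destruct (zero_in_ball n); split; [assumption|lra]).
  destruct (chain_cluster_point n {a | inBc n a} (fun a y => inBc n y /\ f (proj1_sig a) <= f y)
    (exist _ _ H0)) as [x [Hx Hc]].
  - intros [a Ha]. exists a. cbn. split; [exact Ha|lra].
  - intros [a Ha] [b Hb]. cbn. destruct (Rle_dec (f b) (f a)); [left|right]; intros y [h1 h2];
      split; try assumption; lra.
  - intros [a Ha] y [Hy _] i Hi. apply (ball_coord n y i Hy Hi).
  - assert (Hxb : inBc n x).
    { split; [exact Hx|]. apply Rnot_lt_le. intros h.
      destruct (sqnorm_cont n x (sqnorm n x - 1) ltac:(lra)) as [d [Hd H]].
      destruct (Hc (exist _ _ H0) d Hd) as [y [[[_ Hy] _] Hyx]].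
      assert (h' := H y Hyx). apply Rabs_def2 in h'. lra. }
    exists x. split; [exact Hxb|]. intros y Hy.
    apply le_epsilon. intros e He.
    destruct (Hf x Hxb e He) as [d [Hd H]].
    assert (HN : 0 < INR n + 1) by (pose proof (pos_INR n); lra).
    destruct (Hc (exist _ y Hy) (d / (INR n + 1))) as [w [[Hw Hfw] Hwx]].
    { apply Rdiv_lt_0_compat; lra. }
    cbn in Hfw.
    assert (h : Rabs (f w - f x) < e).
    { apply H; [exact Hw|]. apply dist_lt_of_coords with (d / (INR n + 1)); [|intros i Hi| |exact Hd].
      - left. apply Rdiv_lt_0_compat; lra.
      - rewrite Rabs_minus_sym. apply Hwx, Hi.
      - apply Rmult_lt_reg_r with (INR n + 1); [exact HN|].
        replace (INR n * (d / (INR n + 1)) * (INR n + 1)) with (INR n * d) by (field; lra). nra. }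
    apply Rabs_def2 in h. lra.
Qed.

Lemma upd_inSub (n : nat) (x : nat -> R) (i : nat) (t : R) :
  (i < n)%nat -> inSub n x -> inSub n (upd x i t).
Proof. intros Hi Hx j Hj. unfold upd. destruct (Nat.eqb_spec j i); [lia|]. apply Hx, Hj. Qed.

Lemma inB_open (n : nat) (x : nat -> R) : inB n x -> exists d, 0 < d /\
  forall y, inSub n y -> (forall i, (i < n)%nat -> Rabs (y i - x i) < d) -> inB n y.
Proof.
  intros [Hx Hs]. destruct (sqnorm_cont n x (1 - sqnorm n x) ltac:(lra)) as [d [Hd H]].
  exists d. split; [exact Hd|]. intros y Hy Hyx. split; [exact Hy|].
  assert (h := H y Hyx). apply Rabs_def2 in h. lra.
Qed.

Lemma cont_on_coords (D : (nat -> R) -> Prop) (n : nat) (f : (nat -> R) -> R) (x : nat -> R) (e : R) :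
  cont_on D n f x -> 0 < e -> exists d, 0 < d /\
  forall y, D y -> (forall i, (i < n)%nat -> Rabs (y i - x i) < d) -> Rabs (f y - f x) < e.
Proof.
  intros Hf He. destruct (Hf e He) as [d [Hd H]].
  assert (HN : 0 < INR n + 1) by (pose proof (pos_INR n); lra).
  exists (d / (INR n + 1)). split; [apply Rdiv_lt_0_compat; lra|].
  intros y Hy Hyx. apply H; [exact Hy|].
  apply dist_lt_of_coords with (d / (INR n + 1)); [|intros i Hi| |exact Hd].
  - left. apply Rdiv_lt_0_compat; lra.
  - rewrite Rabs_minus_sym. apply Hyx, Hi.
  - apply Rmult_lt_reg_r with (INR n + 1); [exact HN|].
    replace (INR n * (d / (INR n + 1)) * (INR n + 1)) with (INR n * d) by (field; lra). nra.
Qed.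

Lemma cont_on_of_coords (D : (nat -> R) -> Prop) (n : nat) (f : (nat -> R) -> R) (x : nat -> R) :
  (forall e, 0 < e -> exists d, 0 < d /\
    forall y, D y -> (forall i, (i < n)%nat -> Rabs (y i - x i) < d) -> Rabs (f y - f x) < e) ->
  cont_on D n f x.
Proof.
  intros H e He. destruct (H e He) as [d [Hd Hf]]. exists d. split; [exact Hd|].
  intros y Hy Hyx. apply Hf; [exact Hy|]. intros i Hi.
  apply Rle_lt_trans with (2 := Hyx). rewrite Rabs_minus_sym. apply coord_le_dist, Hi.
Qed.

(** * Derivatives along lines and second-order conditions at a maximum *)

Definition along (x xi : nat -> R) (t : R) : nat -> R := fun i => x i + t * xi i.

Lemma derivable_pt_lim_affine (a b s : R) : derivable_pt_lim (fun s => a + s * b) s b.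
Proof.
  apply is_derive_Reals. auto_derive; [exact I|ring].
Qed.

Lemma bounded_coords (n : nat) (xi : nat -> R) : exists M, 0 < M /\ forall i, (i < n)%nat -> Rabs (xi i) <= M.
Proof.
  exists (rsumn n (fun i => Rabs (xi i)) + 1). split.
  - assert (0 <= rsumn n (fun i => Rabs (xi i))) by (apply rsumn_nonneg; intros; apply Rabs_pos). lra.
  - intros i Hi. assert (h := rsumn_term_le n (fun i => Rabs (xi i)) i (fun i _ => Rabs_pos _) Hi).
    cbv beta in h. lra.
Qed.

(* Telescoping over the coordinates, with the mean value theorem in each of them. *)
Lemma increment_bound (n : nat) (f : (nat -> R) -> R) (Df : nat -> (nat -> R) -> R) (x xi : nat -> R) :
  inB n x -> inSub n xi ->
  (forall y, inB n y -> forall i, (i < n)%nat ->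
     derivable_pt_lim (fun t => f (upd y i t)) (y i) (Df i y)) ->
  (forall i, (i < n)%nat -> cont_on (inB n) n (Df i) x) ->
  forall m, (m <= n)%nat -> forall e, 0 < e -> exists d, 0 < d /\ forall h, Rabs h < d ->
    Rabs (f (fun i => if Nat.ltb i m then x i + h * xi i else x i) - f x
          - h * rsumn m (fun i => xi i * Df i x)) <= e * Rabs h.
Proof.
  intros Hx Hxi Hder Hcont. induction m as [|m IH]; intros Hm e He.
  - exists 1. split; [lra|]. intros h _. rewrite rsumn_0.
    change (fun i => if Nat.ltb i 0 then x i + h * xi i else x i) with (fun i => x i).
    change (fun i => x i) with x.
    replace (f x - f x - h * 0) with 0 by ring. rewrite Rabs_R0.
    apply Rmult_le_pos; [lra|apply Rabs_pos].
  - destruct (IH ltac:(lia) (e / 2) ltac:(lra)) as [d1 [Hd1 H1]].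
    destruct (bounded_coords n xi) as [M [HM HMb]].
    destruct (inB_open n x Hx) as [d2 [Hd2 H2]].
    destruct (cont_on_coords _ _ _ _ (e / 2 / M) (Hcont m ltac:(lia))) as [d3 [Hd3 H3]].
    { apply Rdiv_lt_0_compat; lra. }
    exists (Rmin d1 (Rmin (d2 / M) (d3 / M))). split.
    { repeat apply Rmin_pos; try lra; apply Rdiv_lt_0_compat; lra. }
    intros h Hh.
    assert (Hh1 : Rabs h < d1) by (apply Rlt_le_trans with (1 := Hh), Rmin_l).
    assert (Hh2 : Rabs h * M < d2).
    { apply Rmult_lt_reg_r with (/ M); [apply Rinv_0_lt_compat; exact HM|].
      replace (Rabs h * M * / M) with (Rabs h) by (field; lra).
      apply Rlt_le_trans with (1 := Hh). apply Rle_trans with (1 := Rmin_r _ _), Rmin_l. }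
    assert (Hh3 : Rabs h * M < d3).
    { apply Rmult_lt_reg_r with (/ M); [apply Rinv_0_lt_compat; exact HM|].
      replace (Rabs h * M * / M) with (Rabs h) by (field; lra).
      apply Rlt_le_trans with (1 := Hh). apply Rle_trans with (1 := Rmin_r _ _), Rmin_r. }
    set (p := fun i => if Nat.ltb i m then x i + h * xi i else x i).
    assert (Hp1 : (fun i => if Nat.ltb i (S m) then x i + h * xi i else x i)
       = upd p m (x m + h * xi m)).
    { apply FunctionalExtensionality.functional_extensionality. intros i. unfold upd, p.
      destruct (Nat.eqb_spec i m) as [->|hn].
      - destruct (Nat.ltb_spec m (S m)); [reflexivity|lia].
      - destruct (Nat.ltb_spec i (S m)), (Nat.ltb_spec i m); try reflexivity; lia. }
    assert (Hp0 : p = upd p m (x m)).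
    { apply FunctionalExtensionality.functional_extensionality. intros i. unfold upd, p.
      destruct (Nat.eqb_spec i m) as [->|hn]; [|reflexivity].
      destruct (Nat.ltb_spec m m); [lia|reflexivity]. }
    assert (Hnear : forall s, 0 <= s <= 1 -> forall i, (i < n)%nat ->
       Rabs (upd p m (x m + s * (h * xi m)) i - x i) <= Rabs h * M).
    { intros s Hs i Hi. unfold upd, p. destruct (Nat.eqb_spec i m) as [->|hn].
      - replace (x m + s * (h * xi m) - x m) with (s * (h * xi m)) by ring.
        rewrite !Rabs_mult, (Rabs_right s) by lra.
        assert (h1 := HMb m Hi). pose proof (Rabs_pos h). pose proof (Rabs_pos (xi m)).
        assert (Rabs h * Rabs (xi m) <= Rabs h * M) by (apply Rmult_le_compat_l; lra).
        assert (0 <= Rabs h * Rabs (xi m)) by (apply Rmult_le_pos; lra). nra.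
      - destruct (Nat.ltb_spec i m).
        + replace (x i + h * xi i - x i) with (h * xi i) by ring. rewrite Rabs_mult.
          apply Rmult_le_compat_l; [apply Rabs_pos|apply HMb, Hi].
        + rewrite Rminus_diag, Rabs_R0. apply Rmult_le_pos; [apply Rabs_pos|lra]. }
    assert (HpS : inSub n p).
    { intros i Hi. unfold p. destruct (Nat.ltb_spec i m); [lia|]. apply (proj1 Hx), Hi. }
    assert (HqB : forall s, 0 <= s <= 1 -> inB n (upd p m (x m + s * (h * xi m)))).
    { intros s Hs. apply H2.
      - apply upd_inSub; [lia|exact HpS].
      - intros i Hi. apply Rle_lt_trans with (1 := Hnear s Hs i Hi). exact Hh2. }
    assert (Hmv : exists s, 0 < s < 1 /\
       f (upd p m (x m + h * xi m)) - f p = h * xi m * Df m (upd p m (x m + s * (h * xi m)))).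
    { destruct (MVT_lim (fun s => f (upd p m (x m + s * (h * xi m))))
        (fun s => h * xi m * Df m (upd p m (x m + s * (h * xi m)))) 0 1 Rlt_0_1) as [s [Hs Heq]].
      - intros s Hs.
        assert (hd := Hder _ (HqB s Hs) m ltac:(lia)).
        apply derivable_pt_lim_ext with
          (comp (fun t => f (upd p m t)) (fun s => x m + s * (h * xi m))); [reflexivity|].
        rewrite (Rmult_comm (h * xi m) (Df _ _)). apply derivable_pt_lim_comp.
        + apply derivable_pt_lim_affine.
        + replace (upd p m (x m + s * (h * xi m)) m) with (x m + s * (h * xi m)) in hd
            by (unfold upd; rewrite Nat.eqb_refl; reflexivity).
          apply derivable_pt_lim_ext with (2 := hd). intros t. f_equal.
          apply FunctionalExtensionality.functional_extensionality. intros i. unfold upd.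
          destruct (Nat.eqb i m); reflexivity.
      - exists s. split; [exact Hs|].
        rewrite Rmult_0_l, Rplus_0_r, <- Hp0, Rmult_1_l in Heq. rewrite Heq. ring. }
    destruct Hmv as [s [Hs Heq]].
    rewrite Hp1, rsumn_S.
    assert (h3 : Rabs (Df m (upd p m (x m + s * (h * xi m))) - Df m x) < e / 2 / M).
    { apply H3; [apply HqB; lra|]. intros i Hi.
      apply Rle_lt_trans with (1 := Hnear s ltac:(lra) i Hi). exact Hh3. }
    assert (h1 := H1 h Hh1). fold p in h1.
    replace (f (upd p m (x m + h * xi m)) - f x - h * (rsumn m (fun i => xi i * Df i x) + xi m * Df m x))
      with ((f p - f x - h * rsumn m (fun i => xi i * Df i x)) +
            h * xi m * (Df m (upd p m (x m + s * (h * xi m))) - Df m x))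
      by (rewrite Rmult_minus_distr_l, <- Heq; ring).
    apply Rle_trans with (1 := Rabs_triang _ _).
    assert (h4 : Rabs (h * xi m * (Df m (upd p m (x m + s * (h * xi m))) - Df m x)) <= e / 2 * Rabs h).
    { rewrite !Rabs_mult. rewrite Rmult_assoc, (Rmult_comm (e / 2)).
      apply Rmult_le_compat_l; [apply Rabs_pos|].
      replace (e / 2) with (M * (e / 2 / M)) by (field; lra).
      apply Rmult_le_compat; try apply Rabs_pos; [apply HMb; lia|lra]. }
    lra.
Qed.

Lemma derivable_along (n : nat) (f : (nat -> R) -> R) (Df : nat -> (nat -> R) -> R) (x xi : nat -> R) (t : R) :
  inB n (along x xi t) -> inSub n xi ->
  (forall y, inB n y -> forall i, (i < n)%nat ->
     derivable_pt_lim (fun t => f (upd y i t)) (y i) (Df i y)) ->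
  (forall y, inB n y -> forall i, (i < n)%nat -> cont_on (inB n) n (Df i) y) ->
  derivable_pt_lim (fun s => f (along x xi s)) t (rsumn n (fun i => xi i * Df i (along x xi t))).
Proof.
  intros Hx Hxi Hder Hcont e He.
  destruct (increment_bound n f Df (along x xi t) xi Hx Hxi Hder (Hcont _ Hx) n (Nat.le_refl n)
    (e / 2) ltac:(lra)) as [d [Hd H]].
  exists (mkposreal d Hd). intros h Hh0 Hh. cbn in Hh. specialize (H h Hh).
  assert (Heq : (fun i => if Nat.ltb i n then along x xi t i + h * xi i else along x xi t i)
     = along x xi (t + h)).
  { apply FunctionalExtensionality.functional_extensionality. intros i. unfold along.
    destruct (Nat.ltb_spec i n) as [hi|hi]; [ring|]. rewrite (Hxi i hi). ring. }
  rewrite Heq in H. set (S := rsumn n _) in *.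
  assert (Hp : 0 < Rabs h) by (apply Rabs_pos_lt, Hh0).
  replace ((f (along x xi (t + h)) - f (along x xi t)) / h - S)
    with ((f (along x xi (t + h)) - f (along x xi t) - h * S) / h) by (field; exact Hh0).
  unfold Rdiv. rewrite Rabs_mult, Rabs_inv.
  apply Rmult_lt_reg_r with (Rabs h); [exact Hp|].
  rewrite Rmult_assoc, Rinv_l, Rmult_1_r by lra. nra.
Qed.

(** If [l > 0], then [h1], which vanishes at 0, is positive just to the right of 0, and [h] would
    increase there. *)
Lemma second_derivative_nonpos_at_max (h h1 : R -> R) (l d : R) : 0 < d ->
  (forall t, Rabs t < d -> h t <= h 0) ->
  (forall t, Rabs t < d -> derivable_pt_lim h t (h1 t)) ->
  derivable_pt_lim h1 0 l -> l <= 0.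
Proof.
  intros Hd Hmax Hder Hl.
  assert (H10 : h1 0 = 0).
  { assert (pr : derivable_pt h 0) by (exists (h1 0); apply Hder; rewrite Rabs_R0; exact Hd).
    assert (h0 : derive_pt h 0 pr = 0).
    { apply (deriv_maximum h (- d) d 0 pr); try lra.
      intros x H1 H2. apply Hmax. apply Rabs_def1; lra. }
    apply (uniqueness_limite h 0).
    - apply Hder. rewrite Rabs_R0; exact Hd.
    - apply derive_pt_eq_1 with pr. exact h0. }
  apply Rnot_lt_le. intros Hlp.
  destruct (Hl (l / 2) ltac:(lra)) as [[d' Hd'] H]. cbn in H.
  set (t := Rmin d d' / 2).
  assert (Ht : 0 < t /\ t < d /\ t < d').
  { unfold t. assert (0 < Rmin d d') by (apply Rmin_pos; lra).
    pose proof (Rmin_l d d'). pose proof (Rmin_r d d'). lra. }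
  destruct (MVT_lim h h1 0 t ltac:(lra)) as [s [Hs Heq]].
  { intros s Hs. apply Hder. apply Rabs_def1; lra. }
  assert (hs := H s ltac:(lra) ltac:(apply Rabs_def1; lra)).
  rewrite Rplus_0_l, H10, Rminus_0_r in hs. apply Rabs_def2 in hs.
  assert (0 < h1 s).
  { replace (h1 s) with (h1 s / s * s) by (field; lra). apply Rmult_lt_0_compat; lra. }
  assert (h t <= h 0) by (apply Hmax; apply Rabs_def1; lra).
  assert (0 < h1 s * (t - 0)) by (apply Rmult_lt_0_compat; lra). lra.
Qed.

Lemma along_0 (x xi : nat -> R) : along x xi 0 = x.
Proof. apply FunctionalExtensionality.functional_extensionality. intros i. unfold along. ring. Qed.

Lemma along_inSub (n : nat) (x xi : nat -> R) (t : R) : inSub n x -> inSub n xi -> inSub n (along x xi t).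
Proof. intros Hx Hxi i Hi. unfold along. rewrite Hx, Hxi by exact Hi. ring. Qed.

Lemma along_near (n : nat) (x xi : nat -> R) (d : R) : 0 < d -> exists e, 0 < e /\
  forall t, Rabs t < e -> forall i, (i < n)%nat -> Rabs (along x xi t i - x i) < d.
Proof.
  intros Hd. destruct (bounded_coords n xi) as [M [HM HMb]].
  exists (d / M). split; [apply Rdiv_lt_0_compat; lra|].
  intros t Ht i Hi. unfold along. replace (x i + t * xi i - x i) with (t * xi i) by ring.
  rewrite Rabs_mult. apply Rle_lt_trans with (Rabs t * M).
  - apply Rmult_le_compat_l; [apply Rabs_pos|apply HMb, Hi].
  - apply Rmult_lt_reg_r with (/ M); [apply Rinv_0_lt_compat; exact HM|].
    replace (Rabs t * M * / M) with (Rabs t) by (field; lra). exact Ht.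
Qed.

Definition qform (n : nat) (H : nat -> nat -> R) (xi : nat -> R) : R :=
  rsumn n (fun i => rsumn n (fun j => xi i * H i j * xi j)).

(** On the line [x + t xi] the function [u - w] has a maximum at t = 0, and its second derivative
    there is the difference of the two quadratic forms. *)
Lemma hessian_le_at_max (n : nat) (u w : (nat -> R) -> R) (Du Dw : nat -> (nat -> R) -> R)
  (D2u D2w : nat -> nat -> (nat -> R) -> R) (x xi : nat -> R) :
  C2B n u Du D2u -> C2B n w Dw D2w -> inB n x -> inSub n xi ->
  (forall y, inB n y -> u y - w y <= u x - w x) ->
  qform n (fun i j => D2u i j x) xi <= qform n (fun i j => D2w i j x) xi.
Proof.
  intros Hu Hw Hx Hxi Hmax.
  destruct (inB_open n x Hx) as [d [Hd HB]].
  destruct (along_near n x xi d Hd) as [e [He Hnear]].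
  assert (HBt : forall t, Rabs t < e -> inB n (along x xi t)).
  { intros t Ht. apply HB; [apply along_inSub; [apply Hx|exact Hxi]|]. apply Hnear, Ht. }
  assert (Hfirst : forall v Dv D2v, C2B n v Dv D2v -> forall t, Rabs t < e ->
    derivable_pt_lim (fun s => v (along x xi s)) t (rsumn n (fun i => xi i * Dv i (along x xi t)))).
  { intros v Dv D2v Hv t Ht. apply derivable_along; [apply HBt, Ht|exact Hxi| |].
    - intros y Hy. apply (Hv y Hy).
    - intros y Hy. apply (Hv y Hy). }
  assert (Hsecond : forall v Dv D2v, C2B n v Dv D2v ->
    derivable_pt_lim (fun s => rsumn n (fun i => xi i * Dv i (along x xi s))) 0
      (qform n (fun i j => D2v i j x) xi)).
  { intros v Dv D2v Hv. unfold qform.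
    apply (derivable_pt_lim_rsumn n (fun i s => xi i * Dv i (along x xi s))).
    intros i Hi.
    replace (rsumn n (fun j => xi i * D2v i j x * xi j))
      with (xi i * rsumn n (fun j => xi j * D2v i j (along x xi 0))).
    - apply (derivable_pt_lim_scal (fun s => Dv i (along x xi s))).
      apply (derivable_along n (Dv i) (D2v i)); [rewrite along_0; exact Hx|exact Hxi| |].
      + intros y Hy j Hj. apply (Hv y Hy); assumption.
      + intros y Hy j Hj. apply (Hv y Hy); assumption.
    - rewrite <- rsumn_scal. apply rsumn_ext. intros j Hj. rewrite along_0. ring. }
  assert (H := second_derivative_nonpos_at_max
    (fun s => u (along x xi s) - w (along x xi s))
    (fun s => rsumn n (fun i => xi i * Du i (along x xi s)) - rsumn n (fun i => xi i * Dw i (along x xi s)))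
    (qform n (fun i j => D2u i j x) xi - qform n (fun i j => D2w i j x) xi) e He).
  enough (qform n (fun i j => D2u i j x) xi - qform n (fun i j => D2w i j x) xi <= 0) by lra.
  apply H.
  - intros t Ht. rewrite along_0. apply Hmax, HBt, Ht.
  - intros t Ht. apply derivable_pt_lim_minus; [apply (Hfirst u Du D2u Hu t Ht)|apply (Hfirst w Dw D2w Hw t Ht)].
  - apply derivable_pt_lim_minus; [apply (Hsecond u Du D2u Hu)|apply (Hsecond w Dw D2w Hw)].
Qed.

Lemma upd_id (x : nat -> R) (i : nat) : upd x i (x i) = x.
Proof. apply functional_extensionality. intros j. unfold upd. destruct (Nat.eqb_spec j i); congruence. Qed.

Lemma upd_upd (x : nat -> R) (i : nat) (s t : R) : upd (upd x i s) i t = upd x i t.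
Proof. apply functional_extensionality. intros j. unfold upd. destruct (Nat.eqb j i); reflexivity. Qed.

Lemma upd_comm (x : nat -> R) (i j : nat) (s t : R) : i <> j -> upd (upd x i s) j t = upd (upd x j t) i s.
Proof.
  intros H. apply functional_extensionality. intros l. unfold upd.
  destruct (Nat.eqb_spec l j), (Nat.eqb_spec l i); congruence.
Qed.

Lemma upd_same (x : nat -> R) (i : nat) (s : R) : upd x i s i = s.
Proof. unfold upd. rewrite Nat.eqb_refl. reflexivity. Qed.

Lemma upd_other (x : nat -> R) (i j : nat) (s : R) : i <> j -> upd x i s j = x j.
Proof. intros H. unfold upd. destruct (Nat.eqb_spec j i); congruence. Qed.

(** Schwarz's theorem on the plane through [x] in the coordinates i and j. Symmetry opens [D^2 u] to
    the spectral theorem. *)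
Lemma hessian_symmetric (n : nat) (u : (nat -> R) -> R) (Du : nat -> (nat -> R) -> R)
  (D2u : nat -> nat -> (nat -> R) -> R) (x : nat -> R) (i j : nat) :
  C2B n u Du D2u -> inB n x -> (i < n)%nat -> (j < n)%nat -> D2u i j x = D2u j i x.
Proof.
  intros Hu Hx Hi Hj. destruct (Nat.eq_dec i j) as [->|Hij]; [reflexivity|].
  destruct (inB_open n x Hx) as [d [Hd HB]].
  set (p := fun s t => upd (upd x i s) j t).
  assert (Hp0 : p (x i) (x j) = x).
  { unfold p. rewrite upd_id. apply upd_id. }
  assert (Hnear : forall s t r, 0 < r -> Rabs (s - x i) < r -> Rabs (t - x j) < r -> forall l, (l < n)%nat ->
     Rabs (p s t l - x l) < r).
  { intros s t r Hr Hs Ht l Hl. unfold p, upd.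
    destruct (Nat.eqb_spec l j) as [->|]; [exact Ht|]. destruct (Nat.eqb_spec l i) as [->|]; [exact Hs|].
    rewrite Rminus_diag, Rabs_R0. exact Hr. }
  assert (HpB : forall s t, Rabs (s - x i) < d -> Rabs (t - x j) < d -> inB n (p s t)).
  { intros s t Hs Ht. apply HB; [|apply Hnear; assumption].
    apply upd_inSub; [exact Hj|]. apply upd_inSub; [exact Hi|]. apply Hx. }
  set (f := fun s t => u (p s t)).
  assert (Hd1 : forall s t, Rabs (s - x i) < d -> Rabs (t - x j) < d ->
     is_derive (fun s => f s t) s (Du i (p s t))).
  { intros s t Hs Ht. apply is_derive_Reals.
    destruct (Hu _ (HpB s t Hs Ht)) as [h _]. specialize (h i Hi).
    unfold p in h at 2. rewrite (upd_other _ j i), upd_same in h by auto.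
    apply derivable_pt_lim_ext with (2 := h). intros w. unfold f, p.
    rewrite (upd_comm x i j s t Hij), upd_upd, (upd_comm x j i) by auto. reflexivity. }
  assert (Hd2 : forall s t, Rabs (s - x i) < d -> Rabs (t - x j) < d ->
     is_derive (fun t => f s t) t (Du j (p s t))).
  { intros s t Hs Ht. apply is_derive_Reals.
    destruct (Hu _ (HpB s t Hs Ht)) as [h _]. specialize (h j Hj).
    unfold p in h at 2. rewrite upd_same in h.
    apply derivable_pt_lim_ext with (2 := h). intros w. unfold f, p. rewrite upd_upd. reflexivity. }
  assert (Hd12 : forall s t, Rabs (s - x i) < d -> Rabs (t - x j) < d ->
     is_derive (fun t => Du i (p s t)) t (D2u i j (p s t))).
  { intros s t Hs Ht. apply is_derive_Reals.
    destruct (Hu _ (HpB s t Hs Ht)) as [_ [h _]]. specialize (h i j Hi Hj).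
    unfold p in h at 2. rewrite upd_same in h.
    apply derivable_pt_lim_ext with (2 := h). intros w. unfold p. rewrite upd_upd. reflexivity. }
  assert (Hd21 : forall s t, Rabs (s - x i) < d -> Rabs (t - x j) < d ->
     is_derive (fun s => Du j (p s t)) s (D2u j i (p s t))).
  { intros s t Hs Ht. apply is_derive_Reals.
    destruct (Hu _ (HpB s t Hs Ht)) as [_ [h _]]. specialize (h j i Hj Hi).
    unfold p in h at 2. rewrite (upd_other _ j i), upd_same in h by auto.
    apply derivable_pt_lim_ext with (2 := h). intros w. unfold p.
    rewrite (upd_comm x i j s t Hij), upd_upd, (upd_comm x j i) by auto. reflexivity. }
  assert (Hloc : forall s, Rabs (s - x i) < d -> locally s (fun w => Rabs (w - x i) < d)).
  { intros s Hs. exists (mkposreal (d - Rabs (s - x i)) ltac:(lra)). intros w Hw.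
    change (Rabs (w - s) < d - Rabs (s - x i)) in Hw.
    replace (w - x i) with ((w - s) + (s - x i)) by ring.
    apply Rle_lt_trans with (1 := Rabs_triang _ _). lra. }
  assert (Hloc' : forall s, Rabs (s - x j) < d -> locally s (fun w => Rabs (w - x j) < d)).
  { intros s Hs. exists (mkposreal (d - Rabs (s - x j)) ltac:(lra)). intros w Hw.
    change (Rabs (w - s) < d - Rabs (s - x j)) in Hw.
    replace (w - x j) with ((w - s) + (s - x j)) by ring.
    apply Rle_lt_trans with (1 := Rabs_triang _ _). lra. }
  assert (HD21 : forall s t, Rabs (s - x i) < d -> Rabs (t - x j) < d ->
     is_derive (fun z => Derive (fun t => f z t) t) s (D2u j i (p s t))).
  { intros s t Hs Ht. apply is_derive_ext_loc with (2 := Hd21 s t Hs Ht).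
    apply filter_imp with (2 := Hloc s Hs). intros w Hw. symmetry.
    apply is_derive_unique, Hd2; assumption. }
  assert (HD12 : forall s t, Rabs (s - x i) < d -> Rabs (t - x j) < d ->
     is_derive (fun z => Derive (fun t => f t z) s) t (D2u i j (p s t))).
  { intros s t Hs Ht. apply is_derive_ext_loc with (2 := Hd12 s t Hs Ht).
    apply filter_imp with (2 := Hloc' t Ht). intros w Hw. symmetry.
    apply is_derive_unique, Hd1; assumption. }
  assert (Hcont : forall a b, (a < n)%nat -> (b < n)%nat -> forall g : R -> R -> R,
     (forall s t, Rabs (s - x i) < d -> Rabs (t - x j) < d -> g s t = D2u a b (p s t)) ->
     continuity_2d_pt g (x i) (x j)).
  { intros a b Ha Hb g Hg [e He].
    destruct (Hu x Hx) as [_ [_ [_ [_ hc]]]].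
    destruct (cont_on_coords _ _ _ _ e (hc a b Ha Hb) He) as [d' [Hd' H]].
    exists (mkposreal (Rmin d d') (Rmin_pos _ _ Hd Hd')). cbn. intros s t Hs Ht.
    assert (Hs1 : Rabs (s - x i) < d) by (apply Rlt_le_trans with (1 := Hs), Rmin_l).
    assert (Ht1 : Rabs (t - x j) < d) by (apply Rlt_le_trans with (1 := Ht), Rmin_l).
    rewrite (Hg s t Hs1 Ht1), (Hg (x i) (x j)) by (rewrite Rminus_diag, Rabs_R0; exact Hd).
    rewrite Hp0. apply H; [apply HpB; assumption|].
    apply Hnear; [exact Hd'| |].
    - apply Rlt_le_trans with (1 := Hs), Rmin_r.
    - apply Rlt_le_trans with (1 := Ht), Rmin_r. }
  assert (H0 : forall a : R, Rabs (a - a) < d) by (intros a; rewrite Rminus_diag, Rabs_R0; exact Hd).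
  assert (E1 := is_derive_unique _ _ _ (HD21 _ _ (H0 _) (H0 _))). rewrite Hp0 in E1.
  assert (E2 := is_derive_unique _ _ _ (HD12 _ _ (H0 _) (H0 _))). rewrite Hp0 in E2.
  rewrite <- E1, <- E2. symmetry. apply Schwarz.
  - exists (mkposreal d Hd). cbn. intros s t Hs Ht. repeat split.
    + exists (Du i (p s t)); auto.
    + exists (Du j (p s t)); auto.
    + exists (D2u j i (p s t)); auto.
    + exists (D2u i j (p s t)); auto.
  - apply (Hcont j i Hj Hi). intros s t Hs Ht. apply is_derive_unique, HD21; assumption.
  - apply (Hcont i j Hi Hj). intros s t Hs Ht. apply is_derive_unique, HD12; assumption.
Qed.

(* If the values [P_s(t)] of a polynomial depend continuously on [s] for all large [t], so do its
   coefficients: the divided difference in [t] lowers the degree and keeps the leading one. *)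
Lemma coefficients_continuous (n : nat) : forall (c : nat -> R -> R) (T s0 : R),
  (forall t, T < t -> continuity_pt (fun s => sum_f_R0 (fun j => c j s * t ^ j) n) s0) ->
  forall j, (j <= n)%nat -> continuity_pt (c j) s0.
Proof.
  induction n as [|n IH]; intros c T s0 H j Hj.
  - replace j with 0%nat by lia.
    apply continuity_pt_ext with (2 := H (T + 1) ltac:(lra)). intros s. cbn. ring.
  - set (t0 := T + 1).
    (* [d i s] is the coefficient of [t^i] in the quotient of [P_s(t) - P_s(t0)] by [t - t0]. *)
    set (d := fun i s => sum_f_R0 (fun l => c (i + 1 + l)%nat s * t0 ^ l) (n - i)).
    assert (Hdd : forall s t, (t - t0) * sum_f_R0 (fun i => d i s * t ^ i) n
        = sum_f_R0 (fun j => c j s * t ^ j) (S n) - sum_f_R0 (fun j => c j s * t0 ^ j) (S n)).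
    { clear -t0. intros s t. subst d. revert c.
      assert (G : forall m (b : nat -> R), 
         (t - t0) * sum_f_R0 (fun i => sum_f_R0 (fun l => b (i + 1 + l)%nat * t0 ^ l) (m - i) * t ^ i) m
         = sum_f_R0 (fun j => b j * t ^ j) (S m) - sum_f_R0 (fun j => b j * t0 ^ j) (S m)).
      { induction m as [|m IHm]; intros b.
        - cbn. ring.
        - rewrite (decomp_sum (fun i => _ * t ^ i)) by lia.
          cbn [Init.Nat.pred].
          rewrite (sum_eq (fun i => sum_f_R0 (fun l => b (S i + 1 + l)%nat * t0 ^ l) (S m - S i) * t ^ S i)
            (fun i => (sum_f_R0 (fun l => b (S (i + 1 + l))%nat * t0 ^ l) (m - i) * t ^ i) * t)).
          2: { intros i Hi. cbv beta. replace (t ^ S i) with (t ^ i * t) by (cbn [pow]; ring).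
               rewrite <- Rmult_assoc. reflexivity. }
          rewrite <- scal_sum.
          specialize (IHm (fun i => b (S i))).
          rewrite (decomp_sum (fun j => b j * t ^ j)) by lia.
          rewrite (decomp_sum (fun j => b j * t0 ^ j)) by lia. cbn [Init.Nat.pred].
          rewrite (sum_eq (fun i => b (S i) * t ^ S i) (fun i => b (S i) * t ^ i * t)) by (intros; cbn [pow]; ring).
          rewrite (sum_eq (fun i => b (S i) * t0 ^ S i) (fun i => b (S i) * t0 ^ i * t0)) by (intros; cbn [pow]; ring).
          rewrite <- !scal_sum.
          rewrite (sum_eq (fun l => b (0 + 1 + l)%nat * t0 ^ l) (fun l => b (S l) * t0 ^ l)) by (intros; reflexivity).
          rewrite Nat.sub_0_r. cbn [pow]. nra. }
      intros c. exact (G n (fun j => c j s)). }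
    assert (Hlead : continuity_pt (c (S n)) s0).
    { apply continuity_pt_ext with (d n).
      { intros s. unfold d. rewrite Nat.sub_diag. cbn.
        replace (n + 1 + 0)%nat with (S n) by lia. ring. }
      apply (IH d t0); [|lia]. intros t Ht.
      apply continuity_pt_ext with (fun s => / (t - t0) *
         (sum_f_R0 (fun j => c j s * t ^ j) (S n) - sum_f_R0 (fun j => c j s * t0 ^ j) (S n))).
      { intros s. rewrite <- Hdd. field. lra. }
      apply (continuity_pt_scal (fun s => _ - _)). apply continuity_pt_minus; apply H; unfold t0 in *; lra. }
    destruct (Nat.eq_dec j (S n)) as [->|hn]; [exact Hlead|].
    apply (IH c T); [|lia]. intros t Ht.
    apply continuity_pt_ext with (fun s => sum_f_R0 (fun j => c j s * t ^ j) (S n) - c (S n) s * t ^ (S n)).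
    { intros s. cbn [sum_f_R0]. ring. }
    apply (continuity_pt_minus (fun s => sum_f_R0 (fun j => c j s * t ^ j) (S n))); [apply H, Ht|].
    apply (continuity_pt_mult (c (S n)) (fun _ => t ^ S n)); [exact Hlead|].
    apply continuity_pt_const. intros a b; reflexivity.
Qed.

Lemma prod_esym (l : list R) (t : R) :
  fold_right Rmult 1 (map (fun m => 1 + t * m) l) = sum_f_R0 (fun j => esym l j * t ^ j) (length l).
Proof.
  induction l as [|x l IH]; [cbn; ring|].
  cbn [map fold_right length]. rewrite IH.
  rewrite (decomp_sum (fun j => esym (x :: l) j * t ^ j)) by lia. cbn [Init.Nat.pred].
  rewrite (sum_eq (fun i => esym (x :: l) (S i) * t ^ S i) (fun j => esym l (S j) * t ^ S j + (esym l j * t ^ j) * (t * x))).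
  2: { intros i Hi. rewrite esym_cons. cbn [pow]. ring. }
  rewrite sum_plus, <- scal_sum.
  assert (Hs : sum_f_R0 (fun j => esym l (S j) * t ^ S j) (length l) + 1 =
     sum_f_R0 (fun j => esym l j * t ^ j) (length l)).
  { assert (h := tech5 (fun j => esym l j * t ^ j) (length l)). cbv beta in h.
    rewrite (esym_oversize l (S (length l))) in h by lia.
    rewrite (decomp_sum _ (S (length l))) in h by lia. cbn [Init.Nat.pred] in h.
    rewrite esym_0 in h. cbn [pow] in h |- *. lra. }
  rewrite !esym_0. cbn [pow] in *. lra.
Qed.

Lemma det_continuous (n : nat) : forall (A : nat -> nat -> R -> R) (s0 : R),
  (forall i j, (i < n)%nat -> (j < n)%nat -> continuity_pt (A i j) s0) ->
  continuity_pt (fun s => det n (fun i j => A i j s)) s0.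
Proof.
  induction n as [|n IH]; intros A s0 H.
  - apply continuity_pt_const. intros a b; reflexivity.
  - cbn [det]. apply (continuity_pt_rsumn (S n) (fun j s => (-1) ^ j * A 0%nat j s *
      det n (fun i l => A (S i) (if (l <? j)%nat then l else S l) s))).
    intros j Hj. apply (continuity_pt_mult (fun s => (-1) ^ j * A 0%nat j s)).
    + apply (continuity_pt_scal (A 0%nat j)). apply H; lia.
    + apply (IH (fun i l => A (S i) (if (l <? j)%nat then l else S l))).
      intros i l Hi Hl. apply H; [lia|]. destruct (Nat.ltb_spec l j); lia.
Qed.

(** The lists [lam s] are arbitrary choices, with entries in any order, but their symmetric
    functions are coefficients of the characteristic polynomial. *)
Lemma esym_eigenvalues_continuous (n : nat) (H : nat -> nat -> R -> R) (lam : R -> list R) (s0 : R) :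
  (forall i j, (i < n)%nat -> (j < n)%nat -> continuity_pt (H i j) s0) ->
  (forall s, length (lam s) = n) ->
  (forall s t, det n (fun i j => (if Nat.eqb i j then t else 0) - H i j s)
               = fold_right Rmult 1 (map (fun m => t - m) (lam s))) ->
  forall j, (j <= n)%nat -> continuity_pt (fun s => esym (lam s) j) s0.
Proof.
  intros Hc Hlen Hdet. apply (coefficients_continuous n (fun j s => esym (lam s) j) 0 s0).
  intros t Ht.
  (* [(-t)^n] times the characteristic polynomial at [-1/t] is the product of the [1 + t m], whose
     coefficients in t are the [e_j]. *)
  apply continuity_pt_ext with
    (fun s => (- t) ^ n * det n (fun i j => (if Nat.eqb i j then - / t else 0) - H i j s)).
  - intros s. rewrite Hdet. rewrite <- (Hlen s) at 2. rewrite <- prod_esym, <- (Hlen s).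
    induction (lam s) as [|x l IH]; cbn [map fold_right length pow]; [ring|].
    rewrite <- IH. field. lra.
  - apply (continuity_pt_scal (fun s => det n _)).
    apply (det_continuous n (fun i j s => (if Nat.eqb i j then - / t else 0) - H i j s)).
    intros i j Hi Hj. apply (continuity_pt_minus (fun _ => if Nat.eqb i j then - / t else 0)).
    + apply continuity_pt_const. intros a b; reflexivity.
    + apply Hc; assumption.
Qed.

(** * Comparison for the Hessian operator *)

Definition dotn (n : nat) (x y : nat -> R) : R := rsumn n (fun i => x i * y i).

Definition splits (n : nat) (H : nat -> nat -> R) (lam : list R) : Prop :=
  forall t, det n (fun i j => (if Nat.eqb i j then t else 0) - H i j)
            = fold_right Rmult 1 (map (fun m => t - m) lam).

Lemma sqnorm_pos (n : nat) (v : nat -> R) (i : nat) : (i < n)%nat -> v i <> 0 -> 0 < sqnorm n v.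
Proof.
  intros Hi Hv. apply Rlt_le_trans with (v i ^ 2).
  - assert (0 < (v i)²) by (apply Rsqr_pos_lt, Hv). unfold Rsqr in *. lra.
  - apply (rsumn_term_le n (fun i => v i ^ 2)); [intros; apply pow2_ge_0|exact Hi].
Qed.

Lemma eigenvalue_qform (n : nat) (H : nat -> nat -> R) (lam : list R) (y : R) :
  splits n H lam -> In y lam ->
  exists v, inSub n v /\ 0 < sqnorm n v /\ qform n H v = y * sqnorm n v.
Proof.
  intros Hs Hy.
  assert (H0 : det n (fun i j => (if Nat.eqb i j then y else 0) - H i j) = 0).
  { rewrite Hs. induction lam as [|a l IH]; [contradiction|]. cbn.
    destruct Hy as [->|Hy]; [ring|].
    enough (fold_right Rmult 1 (map (fun m => y - m) l) = 0) as -> by ring.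
    clear -Hy. induction l as [|b l IH]; [contradiction|]. cbn. destruct Hy as [->|Hy]; [ring|].
    rewrite IH by exact Hy. ring. }
  destruct (@MatrixFacts.eigenvector_of_root n H y H0) as [v [[i [Hi Hv]] Heig]].
  (* The eigenvector is unconstrained from index n on; cutting it off there puts it in [inSub]. *)
  set (w := fun i => if Nat.ltb i n then v i else 0).
  assert (Hw : forall i, (i < n)%nat -> w i = v i).
  { intros l Hl. unfold w. destruct (Nat.ltb_spec l n); [reflexivity|lia]. }
  exists w. split; [|split].
  - intros l Hl. unfold w. destruct (Nat.ltb_spec l n); [lia|reflexivity].
  - apply (sqnorm_pos n w i Hi). rewrite Hw by exact Hi. exact Hv.
  - unfold qform, sqnorm. rewrite <- rsumn_scal. apply rsumn_ext. intros l Hl.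
    rewrite (rsumn_ext n _ (fun j => w l * (H l j * v j))).
    + rewrite rsumn_scal, Heig, Hw by exact Hl. ring.
    + intros j Hj. rewrite (Hw j Hj). ring.
Qed.

(* For [W = a I + N x x^T] with [N <= 0], the eigenvalues of [H <= W] are all at most [a], and the
   smallest is at most [a + N |x|^2]; these are exactly the eigenvalues of [W]. *)
Lemma esym_le_rank_one (n k : nat) (H : nat -> nat -> R) (lam : list R) (a N : R) (x : nat -> R) :
  (0 < n)%nat -> inSub n x -> N <= 0 -> length lam = n -> splits n H lam ->
  (forall i j, (i < n)%nat -> (j < n)%nat -> H i j = H j i) ->
  (forall xi, inSub n xi -> qform n H xi <= a * sqnorm n xi + N * dotn n x xi ^ 2) ->
  (forall j, (j <= k)%nat -> 0 < esym lam j) ->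
  esym lam k <= esym ((a + N * sqnorm n x) :: repeat a (n - 1)) k.
Proof.
  intros Hn Hx HN Hlen Hs Hsym Hq Hp.
  assert (Ha : forall y, In y lam -> y <= a).
  { intros y Hy. destruct (eigenvalue_qform n H lam y Hs Hy) as [v [H1 [H2 H3]]].
    assert (h := Hq v H1). rewrite H3 in h.
    assert (0 <= dotn n x v ^ 2) by apply pow2_ge_0.
    apply Rmult_le_reg_r with (sqnorm n v); [exact H2|]. nra. }
  destruct (@MatrixFacts.eigenvalue_le_quadratic_form n H lam x Hn Hsym Hs) as [y [Hy Hle]].
  change (y * sqnorm n x <= qform n H x) in Hle.
  apply (esym_le_of_bounds k (n - 1) a (a + N * sqnorm n x) y lam); auto; [lia|].
  destruct (Req_dec (sqnorm n x) 0) as [H0|H0].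
  - rewrite H0, Rmult_0_r, Rplus_0_r. auto.
  - assert (0 < sqnorm n x) by (destruct (sqnorm_nonneg n x); [assumption|congruence]).
    assert (h := Hq x Hx).
    assert (Hd : dotn n x x = sqnorm n x) by (apply rsumn_ext; intros; ring).
    rewrite Hd in h.
    apply Rmult_le_reg_r with (sqnorm n x); [assumption|]. nra.
Qed.

Lemma C2B_zero (n : nat) : C2B n (fun _ => 0) (fun _ _ => 0) (fun _ _ _ => 0).
Proof.
  assert (Hc : forall x, cont_on (inB n) n (fun _ => 0) x).
  { intros x e He. exists 1. split; [lra|]. intros. rewrite Rminus_diag, Rabs_R0. exact He. }
  intros x Hx. repeat split; intros; try apply Hc; apply derivable_pt_lim_const.
Qed.

Lemma along_convex (n : nat) (x y : nat -> R) (s : R) : inB n x -> inB n y -> 0 <= s <= 1 ->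
  inB n (along x (fun i => y i - x i) s).
Proof.
  intros [Hx Hx1] [Hy Hy1] Hs. split.
  - intros i Hi. unfold along. rewrite Hx, Hy by exact Hi. ring.
  - apply Rle_lt_trans with ((1 - s) * sqnorm n x + s * sqnorm n y).
    + unfold sqnorm. rewrite <- !rsumn_scal, <- rsumn_plus. apply rsumn_le. intros i _. unfold along.
      assert (0 <= s * (1 - s) * (x i - y i) ^ 2).
      { apply Rmult_le_pos; [nra|apply pow2_ge_0]. }
      nra.
    + destruct (Req_dec s 0) as [->|h]; [lra|]. nra.
Qed.

(** Projection onto [0, 1]. Composition with it extends a function on the interval to all of R,
    since [IVT_cor] asks for continuity everywhere and [mono_of_deriv] for two-sided continuity at
    the end points. *)
Definition clamp (s : R) : R := Rmax 0 (Rmin 1 s).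

Lemma clamp_range (s : R) : 0 <= clamp s <= 1.
Proof. unfold clamp. split; [apply Rmax_l|]. apply Rmax_lub; [lra|apply Rmin_l]. Qed.

Lemma clamp_id (s : R) : 0 <= s <= 1 -> clamp s = s.
Proof. intros H. unfold clamp. rewrite Rmin_right, Rmax_right; lra. Qed.

Lemma clamp_lipschitz (s t : R) : Rabs (clamp s - clamp t) <= Rabs (s - t).
Proof.
  unfold clamp, Rmax, Rmin. repeat destruct (Rle_dec _ _);
    unfold Rabs; repeat destruct (Rcase_abs _); lra.
Qed.

Fixpoint min_upto (k : nat) (f : nat -> R) : R :=
  match k with O => f O | S k' => Rmin (min_upto k' f) (f (S k')) end.

Lemma min_upto_le (k : nat) (f : nat -> R) (j : nat) : (j <= k)%nat -> min_upto k f <= f j.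
Proof.
  induction k as [|k IH]; intros Hj; cbn.
  - replace j with 0%nat by lia. lra.
  - destruct (Nat.eq_dec j (S k)) as [->|h]; [apply Rmin_r|].
    apply Rle_trans with (1 := Rmin_l _ _), IH. lia.
Qed.

Lemma min_upto_attained (k : nat) (f : nat -> R) : exists j, (j <= k)%nat /\ min_upto k f = f j.
Proof.
  induction k as [|k [j [Hj IH]]]; cbn; [exists 0%nat; auto|].
  unfold Rmin. destruct (Rle_dec _ _); [exists j; split; [lia|exact IH]|exists (S k); auto].
Qed.

Lemma min_upto_continuous (k : nat) (f : nat -> R -> R) (s : R) :
  (forall j, (j <= k)%nat -> continuity_pt (f j) s) -> continuity_pt (fun s => min_upto k (fun j => f j s)) s.
Proof.
  induction k as [|k IH]; intros H; cbn; [apply H; lia|].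
  set (g := fun s => min_upto k (fun j => f j s)).
  apply continuity_pt_ext with (fun s => (g s + f (S k) s - Rabs (g s - f (S k) s)) * / 2).
  { intros t. fold (g t). unfold Rmin, Rabs. destruct (Rle_dec _ _), (Rcase_abs _); lra. }
  assert (Hg : continuity_pt g s) by (apply IH; intros; apply H; lia).
  assert (Hf : continuity_pt (f (S k)) s) by (apply H; lia).
  apply (continuity_pt_mult (fun s => g s + f (S k) s - Rabs (g s - f (S k) s)) (fun _ => / 2)).
  - apply (continuity_pt_minus (fun s => g s + f (S k) s)); [apply continuity_pt_plus; assumption|].
    apply (continuity_pt_comp (fun s => g s - f (S k) s) Rabs).
    + apply continuity_pt_minus; assumption.
    + apply Rcontinuity_abs.
  - apply continuity_pt_const. intros a b; reflexivity.
Qed.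

(* [D^2 u >= 0] at an interior minimum, and on the segment from there to [x] the smallest of
   [e_0, .., e_k] cannot vanish by [esym_pos_of_nonneg_top]. *)
Lemma hessian_in_cone (n k : nat) (u : (nat -> R) -> R) (Du : nat -> (nat -> R) -> R)
  (D2u : nat -> nat -> (nat -> R) -> R) (g : (nat -> R) -> R) :
  (k <= n)%nat ->
  C2B n u Du D2u ->
  (forall x, inBc n x -> cont_on (inBc n) n u x) ->
  (forall x, inB n x -> Sk_is n k (fun i j => D2u i j x) (g x)) ->
  (forall x, inB n x -> 0 < g x) ->
  (forall x, inB n x -> u x < 0) ->
  (forall x, inSub n x -> sqnorm n x = 1 -> u x = 0) ->
  forall x, inB n x -> exists lam, length lam = n /\ splits n (fun i j => D2u i j x) lam /\
    esym lam k = g x /\ forall j, (j <= k)%nat -> 0 < esym lam j.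
Proof.
  intros Hkn Hu Hcont HSk Hg Hneg Hbd x Hx.
  destruct (closed_ball_max n (fun y => - u y)) as [xm [Hxm Hmin]].
  { intros y Hy e He. destruct (Hcont y Hy e He) as [d [Hd H]]. exists d. split; [exact Hd|].
    intros w Hw Hyw. replace (- u w - - u y) with (- (u w - u y)) by ring. rewrite Rabs_Ropp. auto. }
  assert (HxmB : inB n xm).
  { split; [apply Hxm|]. destruct (Rle_lt_or_eq_dec _ _ (proj2 Hxm)) as [h|h]; [exact h|exfalso].
    assert (h0 := Hbd xm (proj1 Hxm) h).
    destruct (zero_in_ball n) as [z1 z2].
    assert (h1 := Hneg _ (zero_in_ball n)).
    assert (h2 := Hmin (fun _ => 0) (conj z1 (Rlt_le _ _ z2))). cbv beta in h2. lra. }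
  set (p := fun s => along xm (fun i => x i - xm i) (clamp s)).
  assert (HpB : forall s, inB n (p s)) by (intros s; apply along_convex; [exact HxmB|exact Hx|apply clamp_range]).
  assert (Hch : forall s, exists lam, length lam = n /\ splits n (fun i j => D2u i j (p s)) lam /\ esym lam k = g (p s)).
  { intros s. destruct (HSk _ (HpB s)) as [lam H]. exists lam. exact H. }
  set (lam := fun s => proj1_sig (constructive_indefinite_description _ (Hch s))).
  assert (Hlam : forall s, length (lam s) = n /\ splits n (fun i j => D2u i j (p s)) (lam s) /\ esym (lam s) k = g (p s)).
  { intros s. exact (proj2_sig (constructive_indefinite_description _ (Hch s))). }
  assert (Hpc : forall s i j, (i < n)%nat -> (j < n)%nat -> continuity_pt (fun s => D2u i j (p s)) s).
  { intros s i j Hi Hj e He.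
    destruct (Hu _ (HpB s)) as [_ [_ [_ [_ hc]]]].
    destruct (cont_on_coords _ _ _ _ e (hc i j Hi Hj) He) as [d [Hd H]].
    destruct (bounded_coords n (fun i => x i - xm i)) as [M [HM HMb]].
    exists (d / M). split; [apply Rdiv_lt_0_compat; lra|].
    intros t [_ Ht]. simpl in Ht. unfold Rdist in Ht. apply H; [apply HpB|].
    intros l Hl. unfold p, along.
    replace (xm l + clamp t * (x l - xm l) - (xm l + clamp s * (x l - xm l)))
      with ((clamp t - clamp s) * (x l - xm l)) by ring.
    rewrite Rabs_mult. apply Rle_lt_trans with (Rabs (t - s) * M).
    - apply Rmult_le_compat; try apply Rabs_pos; [apply clamp_lipschitz|apply HMb, Hl].
    - apply Rmult_lt_reg_r with (/ M); [apply Rinv_0_lt_compat; exact HM|].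
      replace (Rabs (t - s) * M * / M) with (Rabs (t - s)) by (field; lra). exact Ht. }
  set (F := fun s => min_upto k (fun j => esym (lam s) j)).
  assert (HF : continuity F).
  { intros s. apply (min_upto_continuous k (fun j s => esym (lam s) j)). intros j Hj.
    apply (esym_eigenvalues_continuous n (fun i j s => D2u i j (p s))).
    - intros i l Hi Hl. apply Hpc; assumption.
    - intros t. apply Hlam.
    - intros t. apply Hlam.
    - lia. }
  assert (Hpos : forall s, 0 <= F s -> 0 < F s).
  { intros s Hs. destruct (min_upto_attained k (fun j => esym (lam s) j)) as [j [Hj Heq]].
    unfold F. rewrite Heq. apply (esym_pos_of_nonneg_top (lam s) k); [|destruct (Hlam s) as [_ [_ ->]]; auto|exact Hj].
    intros i Hi. apply Rle_trans with (1 := Hs). apply (min_upto_le k (fun j => esym (lam s) j)), Hi. }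
  assert (HF0 : 0 <= F 0).
  { destruct (min_upto_attained k (fun j => esym (lam 0) j)) as [j [Hj Heq]].
    unfold F. rewrite Heq. apply esym_pos_of_nonneg. intros y Hy.
    destruct (Hlam 0) as [_ [Hs _]].
    assert (Hp0 : p 0 = xm) by (unfold p; rewrite clamp_id, along_0 by lra; reflexivity).
    rewrite Hp0 in Hs.
    destruct (eigenvalue_qform n _ _ y Hs Hy) as [v [H1 [H2 H3]]].
    (* [0 - u] has a maximum at [xm], so the form of [D^2 u] dominates that of the zero function
       there. *)
    assert (h := hessian_le_at_max n (fun _ => 0) u _ Du _ D2u xm v (C2B_zero n) Hu HxmB H1).
    cbv beta in h. rewrite H3 in h.
    assert (h0 : qform n (fun _ _ => 0) v = 0).
    { unfold qform. rewrite (rsumn_ext n _ (fun _ => 0)); [rewrite rsumn_const; ring|].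
      intros i _. rewrite (rsumn_ext n _ (fun _ => 0)); [rewrite rsumn_const; ring|]. intros; ring. }
    rewrite h0 in h.
    assert (h1 : 0 <= y * sqnorm n v).
    { apply h. intros w [Hw1 Hw2]. assert (h2 := Hmin w (conj Hw1 (Rlt_le _ _ Hw2))). cbv beta in h2. lra. }
    apply Rnot_lt_le. intros hy. nra. }
  assert (HF1 : 0 < F 1).
  { destruct (Rlt_dec 0 (F 1)) as [h|h]; [exact h|exfalso].
    destruct (IVT_cor F 0 1 HF ltac:(lra)) as [s [_ Hs]].
    - assert (h0 := Hpos 0 HF0). nra.
    - assert (h0 := Hpos s ltac:(lra)). lra. }
  assert (Hp1 : p 1 = x).
  { unfold p. rewrite clamp_id by lra. apply functional_extensionality. intros i. unfold along. ring. }
  exists (lam 1). destruct (Hlam 1) as [H1 [H2 H3]]. rewrite Hp1 in H2, H3.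
  repeat split; try assumption. intros j Hj.
  apply Rlt_le_trans with (1 := HF1). apply (min_upto_le k (fun j => esym (lam 1) j)), Hj.
Qed.

(** At a maximum of [u - w] one has [D^2 u <= D^2 w = a I + N x x^T] as forms, and [S_k] increases
    on the way up from [D^2 u], which lies in the cone. The right-hand side is [S_k (D^2 w)]. *)
Lemma hessian_comparison_at_max (n k : nat) (u : (nat -> R) -> R) (Du : nat -> (nat -> R) -> R)
  (D2u : nat -> nat -> (nat -> R) -> R) (g : (nat -> R) -> R)
  (w : (nat -> R) -> R) (Dw : nat -> (nat -> R) -> R) (D2w : nat -> nat -> (nat -> R) -> R)
  (x : nat -> R) (a N : R) :
  (0 < n)%nat -> (k <= n)%nat ->
  C2B n u Du D2u ->
  (forall x, inBc n x -> cont_on (inBc n) n u x) ->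
  (forall x, inB n x -> Sk_is n k (fun i j => D2u i j x) (g x)) ->
  (forall x, inB n x -> 0 < g x) ->
  (forall x, inB n x -> u x < 0) ->
  (forall x, inSub n x -> sqnorm n x = 1 -> u x = 0) ->
  C2B n w Dw D2w -> inB n x ->
  (forall i j, D2w i j x = (if Nat.eqb i j then a else 0) + N * (x i * x j)) -> N <= 0 ->
  (forall y, inB n y -> u y - w y <= u x - w x) ->
  g x <= esym ((a + N * sqnorm n x) :: repeat a (n - 1)) k.
Proof.
  intros Hn Hkn Hu Hcont HSk Hg Hneg Hbd Hw Hx HD HN Hmax.
  destruct (hessian_in_cone n k u Du D2u g Hkn Hu Hcont HSk Hg Hneg Hbd x Hx) as [lam [H1 [H2 [H3 H4]]]].
  rewrite <- H3. apply (esym_le_rank_one n k (fun i j => D2u i j x)); auto; [apply Hx| |].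
  - intros i j Hi Hj. apply (hessian_symmetric n u Du D2u); assumption.
  - intros xi Hxi. apply Rle_trans with (1 := hessian_le_at_max n u w Du Dw D2u D2w x xi Hu Hw Hx Hxi Hmax).
    right. unfold qform, sqnorm, dotn.
    replace (rsumn n (fun i => x i * xi i) ^ 2)
      with (rsumn n (fun i => x i * xi i) * rsumn n (fun i => x i * xi i)) by ring.
    rewrite <- !rsumn_scal, <- rsumn_plus. apply rsumn_ext. intros i Hi.
    rewrite (rsumn_ext n _ (fun j => xi i * a * (if Nat.eqb j i then xi i else 0) + N * (x i * xi i) * (x j * xi j))).
    + rewrite rsumn_plus, !rsumn_scal, rsumn_single by exact Hi. ring.
    + intros j Hj. rewrite HD. rewrite Nat.eqb_sym. destruct (Nat.eqb_spec j i) as [->|]; ring.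
Qed.

Lemma Sk_rank_one (n k : nat) (a N : R) (x : nat -> R) : (1 < n)%nat ->
  Sk_is n k (fun i j => (if Nat.eqb i j then a else 0) + N * (x i * x j))
    (esym ((a + N * sqnorm n x) :: repeat a (n - 1)) k).
Proof.
  intros Hn. eexists. split; [|split; [|reflexivity]].
  - cbn [length]. rewrite repeat_length. lia.
  - intros t.
    replace (fun i j => (if Nat.eqb i j then t else 0) - ((if Nat.eqb i j then a else 0) + N * (x i * x j)))
      with (fun i j => (if Nat.eqb i j then t - a else 0) - N * (x i * x j)).
    + transitivity ((t - a) ^ (n - 1) * ((t - a) - N * sqnorm n x)); [exact (@MatrixFacts.det_rank_one n (t - a) N x Hn)|].
      cbn [map fold_right].
      replace (fold_right Rmult 1 (map (fun m => t - m) (repeat a (n - 1)))) with ((t - a) ^ (n - 1)).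
      * ring.
      * induction (n - 1)%nat as [|m IH]; [reflexivity|]. cbn. rewrite <- IH. reflexivity.
    + apply functional_extensionality; intros i. apply functional_extensionality; intros j.
      destruct (Nat.eqb i j); ring.
Qed.

(** * Radial functions *)

Definition normn (n : nat) (x : nat -> R) : R := sqrt (sqnorm n x).

Lemma normn_nonneg (n : nat) (x : nat -> R) : 0 <= normn n x.
Proof. apply sqrt_pos. Qed.

Lemma normn_sq (n : nat) (x : nat -> R) : normn n x ^ 2 = sqnorm n x.
Proof. unfold normn. rewrite pow2_sqrt; [reflexivity|apply sqnorm_nonneg]. Qed.

Lemma normn_lt_1 (n : nat) (x : nat -> R) : inB n x -> 0 <= normn n x < 1.
Proof.
  intros [_ H]. split; [apply normn_nonneg|]. unfold normn. rewrite <- sqrt_1. apply sqrt_lt_1_alt.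
  pose proof (sqnorm_nonneg n x). lra.
Qed.

Lemma normn_le_1 (n : nat) (x : nat -> R) : inBc n x -> 0 <= normn n x <= 1.
Proof.
  intros [_ H]. split; [apply normn_nonneg|]. unfold normn. rewrite <- sqrt_1. apply sqrt_le_1_alt, H.
Qed.

Lemma coord_le_normn (n : nat) (x : nat -> R) (i : nat) : (i < n)%nat -> Rabs (x i) <= normn n x.
Proof.
  intros Hi. unfold normn. rewrite <- sqrt_Rsqr_abs. apply sqrt_le_1_alt. unfold Rsqr.
  replace (x i * x i) with (x i ^ 2) by ring.
  apply (rsumn_term_le n (fun i => x i ^ 2)); [intros; apply pow2_ge_0|exact Hi].
Qed.

Lemma cont_on_sqnorm (D : (nat -> R) -> Prop) (n : nat) (x : nat -> R) : cont_on D n (sqnorm n) x.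
Proof.
  apply cont_on_of_coords. intros e He. destruct (sqnorm_cont n x e He) as [d [Hd H]].
  exists d. split; [exact Hd|]. intros y _. apply H.
Qed.

Lemma cont_on_comp (D : (nat -> R) -> Prop) (n : nat) (f : (nat -> R) -> R) (g : R -> R) (x : nat -> R) :
  cont_on D n f x -> continuity_pt g (f x) -> cont_on D n (fun y => g (f y)) x.
Proof.
  intros Hf Hg e He. destruct (Hg e He) as [a [Ha H]]. destruct (Hf a Ha) as [d [Hd H']].
  exists d. split; [exact Hd|]. intros y Hy Hxy. specialize (H' y Hy Hxy).
  destruct (Req_dec (f y) (f x)) as [->|hn]; [rewrite Rminus_diag, Rabs_R0; exact He|].
  apply H. split; [split; [exact I|auto]|exact H'].
Qed.

Lemma cont_on_comp2 (D : (nat -> R) -> Prop) (n : nat) (f g : (nat -> R) -> R) (h : R -> R -> R) (x : nat -> R) :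
  cont_on D n f x -> cont_on D n g x -> continuity_2d_pt h (f x) (g x) -> cont_on D n (fun y => h (f y) (g y)) x.
Proof.
  intros Hf Hg Hh e He. destruct (Hh (mkposreal e He)) as [[d Hd] H]. cbn in H.
  destruct (Hf d Hd) as [d1 [Hd1 H1]]. destruct (Hg d Hd) as [d2 [Hd2 H2]].
  exists (Rmin d1 d2). split; [apply Rmin_pos; assumption|]. intros y Hy Hxy. apply H.
  - apply H1; [exact Hy|]. apply Rlt_le_trans with (1 := Hxy), Rmin_l.
  - apply H2; [exact Hy|]. apply Rlt_le_trans with (1 := Hxy), Rmin_r.
Qed.

Lemma cont_on_mult (D : (nat -> R) -> Prop) (n : nat) (f g : (nat -> R) -> R) (x : nat -> R) :
  cont_on D n f x -> cont_on D n g x -> cont_on D n (fun y => f y * g y) x.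
Proof.
  intros Hf Hg. apply (cont_on_comp2 D n f g Rmult); [exact Hf|exact Hg|].
  apply continuity_2d_pt_mult; [apply continuity_2d_pt_id1|apply continuity_2d_pt_id2].
Qed.

Lemma cont_on_plus (D : (nat -> R) -> Prop) (n : nat) (f g : (nat -> R) -> R) (x : nat -> R) :
  cont_on D n f x -> cont_on D n g x -> cont_on D n (fun y => f y + g y) x.
Proof.
  intros Hf Hg. apply (cont_on_comp2 D n f g Rplus); [exact Hf|exact Hg|].
  apply continuity_2d_pt_plus; [apply continuity_2d_pt_id1|apply continuity_2d_pt_id2].
Qed.

Lemma cont_on_const (D : (nat -> R) -> Prop) (n : nat) (c : R) (x : nat -> R) : cont_on D n (fun _ => c) x.
Proof. intros e He. exists 1. split; [lra|]. intros. rewrite Rminus_diag, Rabs_R0. exact He. Qed.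

Lemma cont_on_coord (D : (nat -> R) -> Prop) (n i : nat) (x : nat -> R) : (i < n)%nat -> cont_on D n (fun y => y i) x.
Proof.
  intros Hi. apply cont_on_of_coords. intros e He. exists e. split; [exact He|]. intros y _ H. apply H, Hi.
Qed.

Lemma cont_on_normn (D : (nat -> R) -> Prop) (n : nat) (x : nat -> R) : cont_on D n (normn n) x.
Proof.
  apply (cont_on_comp D n (sqnorm n) sqrt); [apply cont_on_sqnorm|].
  apply continuity_pt_sqrt, sqnorm_nonneg.
Qed.

Lemma sqnorm_upd (n : nat) (x : nat -> R) (i : nat) (t : R) : (i < n)%nat ->
  sqnorm n (upd x i t) = sqnorm n x - x i ^ 2 + t ^ 2.
Proof.
  intros Hi. unfold sqnorm.
  rewrite (rsumn_ext n (fun j => upd x i t j ^ 2) (fun j => x j ^ 2 + (if Nat.eqb j i then t ^ 2 - x i ^ 2 else 0))).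
  - rewrite rsumn_plus, rsumn_single by exact Hi. ring.
  - intros j _. unfold upd. destruct (Nat.eqb_spec j i) as [->|]; ring.
Qed.

Lemma normn_upd_deriv (n : nat) (x : nat -> R) (i : nat) : (i < n)%nat -> 0 < normn n x ->
  derivable_pt_lim (fun t => normn n (upd x i t)) (x i) (x i / normn n x).
Proof.
  intros Hi Hx.
  apply derivable_pt_lim_ext with (fun t => sqrt (sqnorm n x - x i ^ 2 + t ^ 2)).
  { intros t. unfold normn. rewrite sqnorm_upd by exact Hi. reflexivity. }
  assert (Hs : 0 < sqnorm n x) by (rewrite <- normn_sq; nra).
  apply is_derive_Reals. auto_derive.
  - cbn. lra.
  - replace (sqnorm n x - x i * (x i * 1) + x i * (x i * 1)) with (sqnorm n x) by ring.
    fold (normn n x). field. lra.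
Qed.

Lemma normn_zero (n : nat) (x : nat -> R) : normn n x = 0 -> forall i, (i < n)%nat -> x i = 0.
Proof. intros H. apply sqnorm_zero. rewrite <- normn_sq, H. ring. Qed.

Lemma normn_upd_zero (n : nat) (x : nat -> R) (i : nat) (t : R) : (i < n)%nat -> normn n x = 0 ->
  normn n (upd x i t) = Rabs t.
Proof.
  intros Hi H. unfold normn. rewrite sqnorm_upd by exact Hi.
  rewrite <- (normn_sq n x), H, (normn_zero n x H i Hi).
  replace (0 ^ 2 - 0 ^ 2 + t ^ 2) with (Rsqr t) by (unfold Rsqr; ring). apply sqrt_Rsqr_abs.
Qed.

(** With [J' = r m] and [m1 = m'], this is the Hessian [m I + (m' / r) x x^T] of [J(|x|)]. At the
    origin the second term is 0 through its factor [x_i x_j]. *)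
Definition radial_hessian (n : nat) (m m1 : R -> R) (i j : nat) (x : nat -> R) : R :=
  (if Nat.eqb i j then m (normn n x) else 0) + m1 (normn n x) / normn n x * (x i * x j).

(** At the origin the second derivatives exist because [m] is continuous there, and they are
    continuous because [|x_i x_j| <= |x|^2] and [r m'(r)] tends to 0. *)
Lemma radial_C2B (n : nat) (J m m1 : R -> R) :
  (forall r, 0 <= r < 1 -> derivable_pt_lim J r (r * m r)) ->
  (forall r, 0 <= r < 1 -> continuity_pt m r) ->
  (forall r, 0 < r < 1 -> derivable_pt_lim m r (m1 r)) ->
  (forall r, 0 < r < 1 -> continuity_pt m1 r) ->
  (forall e, 0 < e -> exists d, 0 < d /\ forall r, 0 < r < d -> Rabs (r * m1 r) < e) ->
  C2B n (fun x => J (normn n x)) (fun i x => m (normn n x) * x i) (radial_hessian n m m1).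
Proof.
  intros HJ Hm Hm1 Hm1c Hm10 x Hx.
  assert (Hr := normn_lt_1 n x Hx).
  assert (Hcm : cont_on (inB n) n (fun y => m (normn n y)) x).
  { apply (cont_on_comp _ n (normn n) m); [apply cont_on_normn|apply Hm, Hr]. }
  repeat split.
  - intros i Hi. destruct (Req_dec (normn n x) 0) as [H0|H0].
    + rewrite (normn_zero n x H0 i Hi), Rmult_0_r.
      intros e He. destruct (HJ 0 ltac:(lra) e He) as [d H]. exists d. intros h Hh0 Hh.
      rewrite !(normn_upd_zero n x i) by assumption. rewrite Rplus_0_l, Rabs_R0, Rminus_0_r.
      assert (hp : 0 < Rabs h) by (apply Rabs_pos_lt, Hh0).
      assert (h' := H (Rabs h) ltac:(lra) ltac:(rewrite Rabs_Rabsolu; exact Hh)).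
      rewrite Rplus_0_l, Rmult_0_l, Rminus_0_r in h'.
      unfold Rdiv in *. rewrite Rabs_mult, Rabs_inv in *. rewrite Rabs_Rabsolu in h'. exact h'.
    + assert (Hp : 0 < normn n x) by lra.
      replace (m (normn n x) * x i) with (normn n x * m (normn n x) * (x i / normn n x)) by (field; lra).
      apply (derivable_pt_lim_comp (fun t => normn n (upd x i t)) J).
      * apply normn_upd_deriv; assumption.
      * rewrite upd_id. apply HJ, Hr.
  - intros i j Hi Hj. unfold radial_hessian. destruct (Req_dec (normn n x) 0) as [H0|H0].
    + rewrite (normn_zero n x H0 i Hi), (normn_zero n x H0 j Hj), Rmult_0_r, Rmult_0_r, Rplus_0_r, H0.
      destruct (Nat.eqb_spec i j) as [->|hij].
      * intros e He. destruct (Hm 0 ltac:(lra) e He) as [d [Hd H]]. exists (mkposreal d Hd). cbn.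
        intros h Hh0 Hh. rewrite !(normn_upd_zero n x j) by assumption. rewrite Rplus_0_l, !upd_same, Rabs_R0.
        replace ((m (Rabs h) * h - m 0 * 0) / h - m 0) with (m (Rabs h) - m 0) by (field; exact Hh0).
        apply H. split; [split; [exact I|]|].
        -- apply not_eq_sym, Rabs_no_R0, Hh0.
        -- simpl. unfold Rdist. rewrite Rminus_0_r, Rabs_Rabsolu. exact Hh.
      * apply derivable_pt_lim_ext with (fun _ => 0); [|apply derivable_pt_lim_const].
        intros t. rewrite (upd_other x j i) by auto. rewrite (normn_zero n x H0 i Hi). ring.
    + assert (Hp : 0 < normn n x) by lra.
      assert (Hd : derivable_pt_lim (fun t => m (normn n (upd x j t))) (x j) (m1 (normn n x) * (x j / normn n x))).
      { apply (derivable_pt_lim_comp (fun t => normn n (upd x j t)) m).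
        - apply normn_upd_deriv; assumption.
        - rewrite upd_id. apply Hm1. lra. }
      assert (Hc : derivable_pt_lim (fun t => upd x j t i) (x j) (if Nat.eqb i j then 1 else 0)).
      { unfold upd. destruct (Nat.eqb i j); [apply derivable_pt_lim_id|apply derivable_pt_lim_const]. }
      assert (h := derivable_pt_lim_mult _ _ _ _ _ Hd Hc). cbv beta in h. rewrite upd_id in h.
      replace ((if Nat.eqb i j then m (normn n x) else 0) + m1 (normn n x) / normn n x * (x i * x j))
        with (m1 (normn n x) * (x j / normn n x) * x i + m (normn n x) * (if Nat.eqb i j then 1 else 0)).
      * exact h.
      * destruct (Nat.eqb i j); field; lra.
  - apply (cont_on_comp _ n (normn n) J); [apply cont_on_normn|].
    apply derivable_continuous_pt. eexists. apply HJ, Hr.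
  - intros i Hi. apply cont_on_mult; [exact Hcm|apply cont_on_coord, Hi].
  - intros i j Hi Hj. unfold radial_hessian.
    apply (cont_on_plus _ n (fun y => if Nat.eqb i j then m (normn n y) else 0)
      (fun y => m1 (normn n y) / normn n y * (y i * y j))).
    { destruct (Nat.eqb i j); [exact Hcm|apply cont_on_const]. }
    destruct (Req_dec (normn n x) 0) as [H0|H0].
    + intros e He. destruct (Hm10 e He) as [d [Hd H]].
      destruct (cont_on_normn (inB n) n x d Hd) as [d' [Hd' H']].
      exists d'. split; [exact Hd'|]. intros y Hy Hxy. specialize (H' y Hy Hxy). rewrite H0, Rminus_0_r in H'.
      rewrite (normn_zero n x H0 i Hi), Rmult_0_l, Rmult_0_r, Rminus_0_r.
      destruct (Req_dec (normn n y) 0) as [Hy0|Hy0].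
      * rewrite (normn_zero n y Hy0 i Hi), Rmult_0_l, Rmult_0_r, Rabs_R0. exact He.
      * assert (Hp : 0 < normn n y) by (pose proof (normn_nonneg n y); lra).
        rewrite Rabs_right in H' by lra.
        apply Rle_lt_trans with (2 := H (normn n y) (conj Hp H')).
        replace (normn n y * m1 (normn n y)) with (m1 (normn n y) / normn n y * (normn n y * normn n y)) by (field; lra).
        rewrite !(Rabs_mult (m1 (normn n y) / normn n y)). apply Rmult_le_compat_l; [apply Rabs_pos|].
        rewrite !Rabs_mult, (Rabs_right (normn n y)) by lra.
        apply Rmult_le_compat; try apply Rabs_pos; apply coord_le_normn; assumption.
    + assert (Hp : 0 < normn n x) by lra.
      apply (cont_on_mult _ n (fun y => m1 (normn n y) / normn n y) (fun y => y i * y j)).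
      * apply (cont_on_comp _ n (normn n) (fun r => m1 r / r)); [apply cont_on_normn|].
        apply continuity_pt_div; [apply Hm1c; lra|apply continuity_pt_id|exact H0].
      * apply cont_on_mult; apply cont_on_coord; assumption.
Qed.

(** * The scaling profile *)

(** [Rpower x q] is 1 for x <= 0, as [ln] is 0 there. Truncation by 0 gives a Lipschitz right-hand
    side, so the profile can be continued past the first zero of [z]. *)
Definition ppow (q x : R) : R := if Rlt_dec 0 x then Rpower x q else 0.

Lemma Rpower_pos (x q : R) : 0 < Rpower x q.
Proof. apply exp_pos. Qed.

Lemma ppow_pos_eq (q x : R) : 0 < x -> ppow q x = Rpower x q.
Proof. intros H. unfold ppow. destruct (Rlt_dec 0 x); [reflexivity|contradiction]. Qed.

Lemma ppow_nonneg (q x : R) : 0 <= ppow q x.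
Proof. unfold ppow. destruct (Rlt_dec 0 x); [left; apply Rpower_pos|lra]. Qed.

Lemma ppow_le (q x y : R) : 0 <= q -> x <= y -> ppow q x <= ppow q y.
Proof.
  intros Hq Hxy. unfold ppow. destruct (Rlt_dec 0 x), (Rlt_dec 0 y); try lra.
  - apply Rle_Rpower_l; lra.
  - left; apply Rpower_pos.
Qed.

Lemma ppow_1 (q : R) : ppow q 1 = 1.
Proof. rewrite ppow_pos_eq by lra. unfold Rpower. rewrite ln_1, Rmult_0_r. apply exp_0. Qed.

Lemma ppow_le_1 (q x : R) : 0 <= q -> x <= 1 -> ppow q x <= 1.
Proof. intros Hq Hx. rewrite <- (ppow_1 q). apply ppow_le; assumption. Qed.

Lemma Rpower_deriv (x a : R) : 0 < x -> derivable_pt_lim (fun x => Rpower x a) x (a * Rpower x (a - 1)).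
Proof. intros H. apply derivable_pt_lim_power, H. Qed.

(** The derivative [q x^(q-1)] is at most q on (0, 1]; across 0 the bound is [y^q <= y]. *)
Lemma ppow_lipschitz (q x y : R) : 1 <= q -> x <= 1 -> y <= 1 ->
  Rabs (ppow q x - ppow q y) <= q * Rabs (x - y).
Proof.
  intros Hq.
  assert (G : forall x y, x <= y -> y <= 1 -> ppow q y - ppow q x <= q * (y - x)).
  { clear x y. intros x y Hxy Hy.
    destruct (Rlt_dec 0 y) as [hy|hy].
    2: { unfold ppow. destruct (Rlt_dec 0 y), (Rlt_dec 0 x); try lra. nra. }
    destruct (Rlt_dec 0 x) as [hx|hx].
    - destruct (Req_dec x y) as [->|hn]; [lra|].
      rewrite !ppow_pos_eq by assumption.
      destruct (MVT_lim (fun x => Rpower x q) (fun x => q * Rpower x (q - 1)) x y ltac:(lra)) as [s [Hs ->]].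
      { intros s Hs. apply Rpower_deriv. lra. }
      apply Rmult_le_compat_r; [lra|].
      assert (Rpower s (q - 1) <= 1); [|nra].
      rewrite <- (ppow_pos_eq (q - 1) s) by lra. apply ppow_le_1; lra.
    - rewrite (ppow_pos_eq q y) by exact hy. unfold ppow. destruct (Rlt_dec 0 x); [contradiction|].
      assert (Rpower y q <= y); [|nra].
      replace q with (1 + (q - 1)) by ring. rewrite Rpower_plus, Rpower_1 by exact hy.
      assert (Rpower y (q - 1) <= 1); [|nra].
      rewrite <- (ppow_pos_eq (q - 1) y) by lra. apply ppow_le_1; lra. }
  intros Hx Hy. destruct (Rle_dec x y) as [h|h].
  - assert (h1 := G x y h Hy). assert (h2 := ppow_le q x y ltac:(lra) h).
    rewrite (Rabs_left1 (x - y)), (Rabs_left1 (ppow q x - ppow q y)) by lra. lra.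
  - assert (h1 := G y x ltac:(lra) Hx). assert (h2 := ppow_le q y x ltac:(lra) ltac:(lra)).
    rewrite (Rabs_right (x - y)), (Rabs_right (ppow q x - ppow q y)) by lra. lra.
Qed.

(** For p = 1/k the root is in general Lipschitz only away from 0, hence the common lower bound
    [a]. *)
Lemma Rpower_root_lipschitz (a x y p : R) : 0 < a -> a <= x -> a <= y -> 0 <= p <= 1 ->
  Rabs (Rpower x p - Rpower y p) <= p * Rpower a (p - 1) * Rabs (x - y).
Proof.
  intros Ha.
  assert (G : forall x y, a <= x -> x <= y -> 0 <= p <= 1 -> 0 <= Rpower y p - Rpower x p <= p * Rpower a (p - 1) * (y - x)).
  { clear x y. intros x y Hx Hxy Hp. destruct (Req_dec x y) as [->|hn]; [split; lra|].
    destruct (MVT_lim (fun x => Rpower x p) (fun x => p * Rpower x (p - 1)) x y ltac:(lra)) as [s [Hs ->]].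
    { intros s Hs. apply Rpower_deriv. lra. }
    assert (H0 := Rpower_pos s (p - 1)).
    split; [apply Rmult_le_pos; [apply Rmult_le_pos|]; lra|].
    apply Rmult_le_compat_r; [lra|]. apply Rmult_le_compat_l; [lra|].
    replace (p - 1) with (- (1 - p)) by ring. rewrite !Rpower_Ropp.
    apply Rinv_le_contravar; [apply Rpower_pos|]. apply Rle_Rpower_l; lra. }
  intros Hx Hy Hp. destruct (Rle_dec x y) as [h|h].
  - assert (h1 := G x y Hx h Hp).
    rewrite (Rabs_left1 (x - y)), (Rabs_left1 (Rpower x p - Rpower y p)) by lra. lra.
  - assert (h1 := G y x Hy ltac:(lra) Hp).
    rewrite (Rabs_right (x - y)), (Rabs_right (Rpower x p - Rpower y p)) by lra. lra.
Qed.

Lemma exp_mono (x y : R) : x <= y -> exp x <= exp y.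
Proof. intros [h| ->]; [left; apply exp_increasing, h|lra]. Qed.

Lemma is_RInt_pow (n : nat) (r : R) : (0 < n)%nat -> is_RInt (fun s => s ^ (n - 1)) 0 r (r ^ n / INR n).
Proof.
  intros Hn. assert (HN : 0 < INR n) by (apply lt_0_INR, Hn).
  replace (r ^ n / INR n) with (minus (r ^ n / INR n) (0 ^ n / INR n)).
  - apply (is_RInt_derive (fun s => s ^ n / INR n)).
    + intros s _. auto_derive; [exact I|]. rewrite <- Nat.sub_1_r. field. lra.
    + intros s _. apply continuity_pt_filterlim. apply derivable_continuous_pt, derivable_pt_pow.
  - rewrite pow_i by exact Hn. unfold minus, plus, opp. simpl. field. lra.
Qed.

(** * Picard iteration for the initial value problem *)

Section Profile.
Variables (n k : nat) (q c : R).
Hypotheses (Hk : (1 <= k)%nat) (Hn : (1 <= n)%nat) (Hq : 1 <= q) (Hc : 0 < c).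

Let HK : 1 <= INR k.
Proof. change 1 with (INR 1). apply le_INR, Hk. Qed.
Let HNp : 0 < INR n.
Proof. apply lt_0_INR. lia. Qed.

Definition mass (z : R -> R) (r : R) : R := RInt (fun s => s ^ (n - 1) * ppow q (z s)) 0 r.
(** The function [m = - z' / r], solved from [c r^n m^k = mass z r]; for r <= 0 it takes its limit
    at the origin. *)
Definition slope (z : R -> R) (r : R) : R :=
  if Rlt_dec 0 r then Rpower (mass z r / (c * r ^ n)) (/ INR k) else Rpower (/ (INR n * c)) (/ INR k).
(** [Rmax 0 s] makes the iterates constant to the left of 0, so that continuity and derivatives are
    two-sided at the origin. *)
Definition picard (z : R -> R) (r : R) : R := 1 - RInt (fun s => Rmax 0 s * slope z s) 0 r.

Definition m0 : R := Rpower (/ (INR n * c)) (/ INR k).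

(** A set invariant under [picard], because every slope is at most its value [m0] at the origin. The
    lower bound keeps [z] close to 1 near 0, so that the argument of the k-th root stays away from
    0. *)
Definition profile_class (z : R -> R) : Prop :=
  continuity z /\ forall r, 1 - m0 / 2 * r ^ 2 <= z r <= 1.

Lemma m0_pos : 0 < m0.
Proof. apply Rpower_pos. Qed.

Lemma integrand_continuous (z : R -> R) : profile_class z ->
  continuity (fun s => s ^ (n - 1) * ppow q (z s)).
Proof.
  intros [Hz Hb] s. apply (continuity_pt_mult (fun s => s ^ (n - 1)) (fun s => ppow q (z s))).
  - apply derivable_continuous_pt, derivable_pt_pow.
  - intros e He. destruct (Hz s (e / q)) as [d [Hd H]]; [apply Rdiv_lt_0_compat; lra|].
    exists d. split; [exact Hd|]. intros t Ht. specialize (H t Ht). simpl in *. unfold Rdist in *.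
    apply Rle_lt_trans with (q * Rabs (z t - z s)).
    + apply ppow_lipschitz; [exact Hq|apply Hb|apply Hb].
    + apply Rmult_lt_reg_r with (/ q); [apply Rinv_0_lt_compat; lra|].
      replace (q * Rabs (z t - z s) * / q) with (Rabs (z t - z s)) by (field; lra). exact H.
Qed.

Lemma ex_RInt_continuity (f : R -> R) (a b : R) : continuity f -> ex_RInt f a b.
Proof. intros Hf. apply (ex_RInt_continuous (V := R_CompleteNormedModule)). intros s _. apply continuity_pt_filterlim, Hf. Qed.

Lemma RInt_deriv (f : R -> R) (a r : R) : continuity f -> derivable_pt_lim (fun r => RInt f a r) r (f r).
Proof.
  intros Hf. apply is_derive_Reals. apply (is_derive_RInt f (fun r => RInt f a r) a r).
  - apply filter_forall. intros s. apply (RInt_correct f), ex_RInt_continuity, Hf.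
  - apply continuity_pt_filterlim, Hf.
Qed.

Lemma mass_bounds_gen (z : R -> R) (r a b : R) : profile_class z -> 0 < r ->
  (forall s, 0 < s < r -> a <= ppow q (z s) <= b) ->
  a * (r ^ n / INR n) <= mass z r <= b * (r ^ n / INR n).
Proof.
  intros Hz Hr Hab.
  assert (HI : is_RInt (fun s => s ^ (n - 1) * ppow q (z s)) 0 r (mass z r)).
  { apply (RInt_correct (fun s => s ^ (n - 1) * ppow q (z s))), ex_RInt_continuity, integrand_continuous, Hz. }
  assert (HP : forall t, is_RInt (fun s => t * s ^ (n - 1)) 0 r (t * (r ^ n / INR n))).
  { intros t. apply (is_RInt_scal (fun s => s ^ (n - 1)) 0 r t), is_RInt_pow. lia. }
  split.
  - apply (is_RInt_le _ _ 0 r _ _ (Rlt_le _ _ Hr) (HP a) HI). intros s Hs.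
    rewrite Rmult_comm. apply Rmult_le_compat_l; [apply pow_le; lra|apply Hab, Hs].
  - apply (is_RInt_le _ _ 0 r _ _ (Rlt_le _ _ Hr) HI (HP b)). intros s Hs.
    rewrite (Rmult_comm b). apply Rmult_le_compat_l; [apply pow_le; lra|apply Hab, Hs].
Qed.

Lemma mass_le (z : R -> R) (r : R) : profile_class z -> 0 < r -> mass z r <= r ^ n / INR n.
Proof.
  intros Hz Hr. rewrite <- (Rmult_1_l (r ^ n / INR n)).
  apply (mass_bounds_gen z r 0 1 Hz Hr). intros s _. split; [apply ppow_nonneg|].
  apply ppow_le_1; [lra|apply Hz].
Qed.

(* Near the origin every [z] of the class exceeds 1/2, whence a bound from below on [0, Rad]. *)
Lemma mass_lower (Rad : R) : 0 < Rad -> exists a, 0 < a /\ forall z r, profile_class z -> 0 < r <= Rad ->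
  a * r ^ n <= mass z r.
Proof.
  (* Chosen so that [m0 r1^2 <= 1]. *)
  intros HR. set (r1 := Rmin Rad (Rmin 1 (/ m0))).
  assert (Hm := m0_pos).
  assert (Hr1 : 0 < r1 <= Rad).
  { unfold r1. split; [repeat apply Rmin_pos; try lra; apply Rinv_0_lt_compat, Hm|apply Rmin_l]. }
  assert (Hr1' : m0 * r1 ^ 2 <= 1).
  { assert (h1 : r1 <= 1) by (unfold r1; apply Rle_trans with (1 := Rmin_r _ _), Rmin_l).
    assert (h2 : r1 <= / m0) by (unfold r1; apply Rle_trans with (1 := Rmin_r _ _), Rmin_r).
    assert (m0 * r1 <= 1).
    { apply Rmult_le_reg_r with (/ m0); [apply Rinv_0_lt_compat, Hm|].
      replace (m0 * r1 * / m0) with r1 by (field; lra). lra. }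
    cbn. nra. }
  set (h := Rpower (1 / 2) q).
  assert (Hh : 0 < h) by apply Rpower_pos.
  assert (Hlow : forall z s, profile_class z -> 0 < s <= r1 -> h <= ppow q (z s)).
  { intros z s Hz Hs. unfold h. rewrite <- ppow_pos_eq by lra. apply ppow_le; [lra|].
    destruct Hz as [_ Hb]. specialize (Hb s).
    assert (s ^ 2 <= r1 ^ 2) by (apply pow_incr; lra). nra. }
  assert (Hp1 : 0 < r1 ^ n) by (apply pow_lt; lra).
  assert (HpR : 0 < Rad ^ n) by (apply pow_lt; lra).
  assert (Hratio : 0 < r1 ^ n / Rad ^ n <= 1).
  { split; [apply Rdiv_lt_0_compat; assumption|].
    apply Rmult_le_reg_r with (Rad ^ n); [exact HpR|].
    unfold Rdiv. rewrite Rmult_assoc, Rinv_l, Rmult_1_r, Rmult_1_l by lra. apply pow_incr; lra. }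
  (* Beyond [r1] the mass is at least its value at [r1]; the factor [r1^n / Rad^n] turns this into a
     multiple of [r^n] up to [Rad]. *)
  exists (h / INR n * (r1 ^ n / Rad ^ n)). split.
  { apply Rmult_lt_0_compat; [apply Rdiv_lt_0_compat; lra|apply Hratio]. }
  intros z r Hz Hr.
  assert (Hrn : 0 < r ^ n) by (apply pow_lt; lra).
  assert (HhN : 0 < h / INR n) by (apply Rdiv_lt_0_compat; lra).
  destruct (Rle_dec r r1) as [hr|hr].
  - apply Rle_trans with (h * (r ^ n / INR n)).
    + replace (h * (r ^ n / INR n)) with (h / INR n * 1 * r ^ n) by (field; lra).
      apply Rmult_le_compat_r; [lra|]. apply Rmult_le_compat_l; lra.
    + apply (mass_bounds_gen z r h 1 Hz); [lra|]. intros s Hs. split; [apply Hlow; [exact Hz|lra]|].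
      apply ppow_le_1; [lra|apply Hz].
  - apply Rle_trans with (mass z r1).
    + apply Rle_trans with (h * (r1 ^ n / INR n)).
      * replace (h * (r1 ^ n / INR n)) with (h / INR n * (r1 ^ n / Rad ^ n) * Rad ^ n) by (field; lra).
        apply Rmult_le_compat_l; [apply Rmult_le_pos; lra|]. apply pow_incr; lra.
      * apply (mass_bounds_gen z r1 h 1 Hz); [lra|]. intros s Hs. split; [apply Hlow; [exact Hz|lra]|].
        apply ppow_le_1; [lra|apply Hz].
    + unfold mass. rewrite <- (RInt_Chasles (fun s => s ^ (n - 1) * ppow q (z s)) 0 r1 r)
        by (apply ex_RInt_continuity, integrand_continuous, Hz).
      assert (0 <= RInt (fun s => s ^ (n - 1) * ppow q (z s)) r1 r).
      { apply RInt_ge_0; [lra|apply ex_RInt_continuity, integrand_continuous, Hz|].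
        intros s Hs. apply Rmult_le_pos; [apply pow_le; lra|apply ppow_nonneg]. }
      unfold plus. simpl. lra.
Qed.

Lemma mass_pos (z : R -> R) (r : R) : profile_class z -> 0 < r -> 0 < mass z r.
Proof.
  intros Hz Hr. destruct (mass_lower r Hr) as [a [Ha H]].
  apply Rlt_le_trans with (2 := H z r Hz ltac:(lra)). apply Rmult_lt_0_compat; [exact Ha|apply pow_lt, Hr].
Qed.

Lemma avg_bounds (z : R -> R) (r : R) : profile_class z -> 0 < r ->
  0 < mass z r / (c * r ^ n) <= / (INR n * c).
Proof.
  intros Hz Hr. assert (Hp : 0 < r ^ n) by (apply pow_lt, Hr).
  assert (Hcp : 0 < c * r ^ n) by (apply Rmult_lt_0_compat; assumption).
  split; [apply Rdiv_lt_0_compat; [apply mass_pos; assumption|exact Hcp]|].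
  replace (/ (INR n * c)) with (r ^ n / INR n / (c * r ^ n)) by (field; repeat split; lra).
  unfold Rdiv at 1 3. apply Rmult_le_compat_r; [left; apply Rinv_0_lt_compat, Hcp|apply mass_le; assumption].
Qed.

Lemma slope_bounds (z : R -> R) (r : R) : profile_class z -> 0 < slope z r <= m0.
Proof.
  intros Hz. unfold slope. destruct (Rlt_dec 0 r) as [h|h].
  - split; [apply Rpower_pos|]. apply Rle_Rpower_l; [left; apply Rinv_0_lt_compat; lra|].
    apply avg_bounds; assumption.
  - split; [apply Rpower_pos|]. unfold m0. lra.
Qed.

Lemma mass_deriv (z : R -> R) (r : R) : profile_class z ->
  derivable_pt_lim (mass z) r (r ^ (n - 1) * ppow q (z r)).
Proof. intros Hz. apply (RInt_deriv (fun s => s ^ (n - 1) * ppow q (z s))), integrand_continuous, Hz. Qed.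

Lemma slope_continuous_pos (z : R -> R) (r : R) : profile_class z -> 0 < r -> continuity_pt (slope z) r.
Proof.
  intros Hz Hr.
  apply continuity_pt_ext_loc with (fun r => Rpower (mass z r / (c * r ^ n)) (/ INR k)).
  - exists (mkposreal r Hr). intros s Hs. change (Rabs (s - r) < r) in Hs. apply Rabs_def2 in Hs.
    unfold slope. destruct (Rlt_dec 0 s); [reflexivity|lra].
  - apply (continuity_pt_comp (fun r => mass z r / (c * r ^ n)) (fun x => Rpower x (/ INR k))).
    + apply continuity_pt_div.
      * apply derivable_continuous_pt. eexists. apply mass_deriv, Hz.
      * apply (continuity_pt_scal (fun r => r ^ n)), derivable_continuous_pt, derivable_pt_pow.
      * apply Rgt_not_eq, Rmult_lt_0_compat; [exact Hc|apply pow_lt, Hr].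
    + apply derivable_continuous_pt. eexists. apply Rpower_deriv. apply avg_bounds; assumption.
Qed.

Lemma flux_continuous (z : R -> R) : profile_class z -> continuity (fun s => Rmax 0 s * slope z s).
Proof.
  intros Hz s. destruct (Rlt_dec 0 s) as [h|h].
  - apply continuity_pt_mult; [|apply slope_continuous_pos; assumption].
    apply continuity_pt_ext_loc with (fun s => s); [|apply continuity_pt_id].
    exists (mkposreal s h). intros t Ht. change (Rabs (t - s) < s) in Ht. apply Rabs_def2 in Ht.
    rewrite Rmax_right; lra.
  - assert (Hm := m0_pos).
    intros e He. exists (e / m0). split; [apply Rdiv_lt_0_compat; lra|].
    intros t [_ Ht]. simpl in *. unfold Rdist in *.
    rewrite (Rmax_left 0 s) by lra. rewrite Rmult_0_l, Rminus_0_r.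
    assert (hb := slope_bounds z t Hz).
    assert (h0 : 0 <= Rmax 0 t) by apply Rmax_l.
    assert (h1 : Rmax 0 t < e / m0).
    { apply Rle_lt_trans with (2 := Ht). unfold Rmax. destruct (Rle_dec 0 t); [|apply Rabs_pos].
      rewrite Rabs_right by lra. lra. }
    rewrite Rabs_right by (apply Rle_ge, Rmult_le_pos; lra).
    apply Rle_lt_trans with (Rmax 0 t * m0); [apply Rmult_le_compat_l; lra|].
    apply Rmult_lt_reg_r with (/ m0); [apply Rinv_0_lt_compat, Hm|].
    rewrite Rmult_assoc, Rinv_r, Rmult_1_r by lra. exact h1.
Qed.

Lemma picard_deriv (z : R -> R) (r : R) : profile_class z ->
  derivable_pt_lim (picard z) r (- (Rmax 0 r * slope z r)).
Proof.
  intros Hz. replace (- (Rmax 0 r * slope z r)) with (0 - Rmax 0 r * slope z r) by ring.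
  apply (derivable_pt_lim_minus (fun _ => 1)); [apply derivable_pt_lim_const|].
  apply (RInt_deriv (fun s => Rmax 0 s * slope z s)), flux_continuous, Hz.
Qed.

Lemma picard_0 (z : R -> R) : picard z 0 = 1.
Proof. unfold picard. rewrite RInt_point. unfold zero. simpl. ring. Qed.

Lemma picard_class (z : R -> R) : profile_class z -> profile_class (picard z).
Proof.
  intros Hz. assert (Hm := m0_pos). split.
  - intros r. apply derivable_continuous_pt. eexists. apply picard_deriv, Hz.
  - intros r. destruct (Rtotal_order r 0) as [h|[->|h]].
    + destruct (MVT_lim (picard z) (fun r => - (Rmax 0 r * slope z r)) r 0 h) as [s [Hs Heq]].
      { intros; apply picard_deriv, Hz. }
      rewrite Rmax_left, picard_0 in Heq by lra. assert (0 <= r ^ 2) by apply pow2_ge_0. nra.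
    + rewrite picard_0. lra.
    + split.
      * assert (Hd : forall s, derivable_pt_lim (fun r => picard z r + m0 / 2 * r ^ 2) s
           (- (Rmax 0 s * slope z s) + m0 * s)).
        { intros s. apply derivable_pt_lim_plus; [apply picard_deriv, Hz|].
          apply is_derive_Reals. auto_derive; [exact I|]. field. }
        destruct (MVT_lim _ _ 0 r h (fun s _ => Hd s)) as [s [Hs Heq]].
        rewrite picard_0, Rmax_right in Heq by lra.
        assert (hb := slope_bounds z s Hz).
        assert (0 <= (- (s * slope z s) + m0 * s) * (r - 0)) by (apply Rmult_le_pos; [nra|lra]).
        nra.
      * destruct (MVT_lim (picard z) (fun r => - (Rmax 0 r * slope z r)) 0 r h) as [s [Hs Heq]].
        { intros; apply picard_deriv, Hz. }
        rewrite Rmax_right, picard_0 in Heq by lra.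
        assert (hb := slope_bounds z s Hz).
        assert (0 <= s * slope z s * (r - 0)) by (apply Rmult_le_pos; [apply Rmult_le_pos|]; lra). lra.
Qed.

Lemma picard_nonpos (z : R -> R) (r : R) : r <= 0 -> profile_class z -> picard z r = 1.
Proof.
  intros Hr Hz. destruct (Req_dec r 0) as [->|hn]; [apply picard_0|].
  destruct (MVT_lim (picard z) (fun r => - (Rmax 0 r * slope z r)) r 0 ltac:(lra)) as [s [Hs Heq]].
  { intros; apply picard_deriv, Hz. }
  rewrite Rmax_left, picard_0 in Heq by lra. lra.
Qed.

Lemma mass_diff (z1 z2 : R -> R) (r D : R) : profile_class z1 -> profile_class z2 -> 0 < r ->
  (forall s, 0 < s < r -> Rabs (z1 s - z2 s) <= D) ->
  mass z1 r - mass z2 r <= q * D * (r ^ n / INR n).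
Proof.
  intros H1 H2 Hr HD.
  assert (HI : forall z, profile_class z -> is_RInt (fun s => s ^ (n - 1) * ppow q (z s)) 0 r (mass z r)).
  { intros z Hz. apply (RInt_correct (fun s => s ^ (n - 1) * ppow q (z s))), ex_RInt_continuity, integrand_continuous, Hz. }
  assert (Hm := is_RInt_minus _ _ 0 r _ _ (HI z1 H1) (HI z2 H2)).
  assert (HP : is_RInt (fun s => q * D * s ^ (n - 1)) 0 r (q * D * (r ^ n / INR n))).
  { apply (is_RInt_scal (fun s => s ^ (n - 1)) 0 r (q * D)), is_RInt_pow. lia. }
  apply (is_RInt_le _ _ 0 r _ _ (Rlt_le _ _ Hr) Hm HP). intros s Hs.
  unfold minus, plus, opp. simpl.
  assert (h := ppow_lipschitz q (z1 s) (z2 s) Hq (proj2 (proj2 H1 s)) (proj2 (proj2 H2 s))).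
  assert (h1 := HD s Hs). assert (h2 : 0 <= s ^ (n - 1)) by (apply pow_le; lra).
  apply Rabs_le_between in h.
  assert (q * Rabs (z1 s - z2 s) <= q * D) by (apply Rmult_le_compat_l; lra).
  assert (s ^ (n - 1) * (ppow q (z1 s) - ppow q (z2 s)) <= s ^ (n - 1) * (q * D))
    by (apply Rmult_le_compat_l; lra).
  lra.
Qed.

(** The masses differ by at most a multiple of [D r^n], so division by [c r^n] leaves a bound
    uniform down to r = 0; [mass_lower] keeps the root Lipschitz. *)
Lemma slope_diff (Rad : R) : 0 < Rad -> exists L, 0 < L /\ forall z1 z2 r D,
  profile_class z1 -> profile_class z2 -> 0 < r <= Rad -> 0 <= D ->
  (forall s, 0 < s < r -> Rabs (z1 s - z2 s) <= D) -> Rabs (slope z1 r - slope z2 r) <= L * D.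
Proof.
  intros HR. destruct (mass_lower Rad HR) as [a [Ha Hlow]].
  set (p := / INR k).
  assert (Hp : 0 < p <= 1).
  { unfold p. split; [apply Rinv_0_lt_compat; lra|]. rewrite <- Rinv_1. apply Rinv_le_contravar; lra. }
  assert (Hac : 0 < a / c) by (apply Rdiv_lt_0_compat; assumption).
  assert (HA := Rpower_pos (a / c) (p - 1)).
  exists (p * Rpower (a / c) (p - 1) * (q / (INR n * c))). split.
  { apply Rmult_lt_0_compat; [apply Rmult_lt_0_compat; lra|]. apply Rdiv_lt_0_compat; [lra|].
    apply Rmult_lt_0_compat; assumption. }
  intros z1 z2 r D H1 H2 Hr HD Hz.
  assert (Hrn : 0 < r ^ n) by (apply pow_lt; lra).
  assert (Hcr : 0 < c * r ^ n) by (apply Rmult_lt_0_compat; assumption).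
  assert (Hge : forall z, profile_class z -> a / c <= mass z r / (c * r ^ n)).
  { intros z Hz'. apply Rmult_le_reg_r with (c * r ^ n); [exact Hcr|].
    replace (a / c * (c * r ^ n)) with (a * r ^ n) by (field; lra).
    replace (mass z r / (c * r ^ n) * (c * r ^ n)) with (mass z r) by (field; lra). apply Hlow; assumption. }
  unfold slope. destruct (Rlt_dec 0 r) as [h|h]; [|lra]. fold p.
  apply Rle_trans with (1 := Rpower_root_lipschitz (a / c) _ _ p Hac (Hge z1 H1) (Hge z2 H2) ltac:(lra)).
  rewrite (Rmult_assoc (p * Rpower (a / c) (p - 1))). apply Rmult_le_compat_l; [apply Rmult_le_pos; lra|].
  replace (mass z1 r / (c * r ^ n) - mass z2 r / (c * r ^ n)) with ((mass z1 r - mass z2 r) / (c * r ^ n)) by (field; lra).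
  unfold Rdiv at 1. rewrite Rabs_mult, (Rabs_right (/ (c * r ^ n))) by (left; apply Rinv_0_lt_compat, Hcr).
  apply Rmult_le_reg_r with (c * r ^ n); [exact Hcr|].
  rewrite Rmult_assoc, Rinv_l, Rmult_1_r by lra.
  replace (q / (INR n * c) * D * (c * r ^ n)) with (q * D * (r ^ n / INR n)) by (field; lra).
  assert (d1 := mass_diff z1 z2 r D H1 H2 ltac:(lra) Hz).
  assert (d2 := mass_diff z2 z1 r D H2 H1 ltac:(lra)
    (fun s hs => eq_ind _ (fun t => t <= D) (Hz s hs) _ (Rabs_minus_sym _ _))).
  apply Rabs_le; lra.
Qed.

(** In the weighted norm [sup |z(r)| exp(- K r)] the Lipschitz constant of [picard] is L / K, so a
    large K gives a contraction on every interval [0, Rad] at once. *)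
Lemma picard_contract (Rad : R) : 0 < Rad -> exists L, 0 < L /\ forall z1 z2 D K,
  profile_class z1 -> profile_class z2 -> 0 <= D -> 0 < K ->
  (forall s, 0 <= s <= Rad -> Rabs (z1 s - z2 s) <= D * exp (K * s)) ->
  forall r, 0 <= r <= Rad -> Rabs (picard z1 r - picard z2 r) <= L / K * D * exp (K * r).
Proof.
  intros HR. destruct (slope_diff Rad HR) as [L [HL Hs]].
  exists (Rad * L). split; [apply Rmult_lt_0_compat; assumption|].
  assert (G : forall z1 z2 D K, profile_class z1 -> profile_class z2 -> 0 <= D -> 0 < K ->
    (forall s, 0 <= s <= Rad -> Rabs (z1 s - z2 s) <= D * exp (K * s)) ->
    forall r, 0 <= r <= Rad -> picard z1 r - picard z2 r <= Rad * L / K * D * exp (K * r)).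
  { intros z1 z2 D K H1 H2 HD HK' Hz r Hr.
    assert (HC : 0 <= Rad * L / K * D).
    { apply Rmult_le_pos; [|exact HD]. left. apply Rdiv_lt_0_compat; [apply Rmult_lt_0_compat|]; assumption. }
    destruct (Req_dec r 0) as [->|hr].
    { rewrite !picard_0, Rmult_0_r, exp_0. lra. }
    assert (Hd : forall s, derivable_pt_lim
       (fun s => Rad * L / K * D * exp (K * s) - (picard z1 s - picard z2 s)) s
       (Rad * L * D * exp (K * s) - (- (Rmax 0 s * slope z1 s) - - (Rmax 0 s * slope z2 s)))).
    { intros s. apply (derivable_pt_lim_minus (fun s => Rad * L / K * D * exp (K * s))).
      - apply is_derive_Reals. auto_derive; [exact I|]. field. lra.
      - apply derivable_pt_lim_minus; apply picard_deriv; assumption. }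
    destruct (MVT_lim _ _ 0 r ltac:(lra) (fun s _ => Hd s)) as [s [Hs' Heq]].
    rewrite !picard_0, Rmult_0_r, exp_0, Rmax_right in Heq by lra.
    assert (h : Rabs (slope z1 s - slope z2 s) <= L * (D * exp (K * s))).
    { apply Hs; auto; [lra| |].
      - apply Rmult_le_pos; [exact HD|left; apply exp_pos].
      - intros t Ht. apply Rle_trans with (1 := Hz t ltac:(lra)).
        apply Rmult_le_compat_l; [exact HD|]. left. apply exp_increasing. apply Rmult_lt_compat_l; lra. }
    apply Rabs_le_between in h.
    assert (hE : 0 <= L * (D * exp (K * s))).
    { apply Rmult_le_pos; [lra|]. apply Rmult_le_pos; [exact HD|left; apply exp_pos]. }
    assert (0 <= (Rad * L * D * exp (K * s) - (- (s * slope z1 s) - - (s * slope z2 s))) * (r - 0)).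
    { apply Rmult_le_pos; [|lra].
      assert (s * (slope z2 s - slope z1 s) <= Rad * (L * (D * exp (K * s)))).
      { apply Rle_trans with (s * (L * (D * exp (K * s)))); [apply Rmult_le_compat_l; lra|apply Rmult_le_compat_r; lra]. }
      lra. }
    lra. }
  intros z1 z2 D K H1 H2 HD HK' Hz r Hr. apply Rabs_le. split.
  - assert (h := G z2 z1 D K H2 H1 HD HK'
      (fun s hs => eq_ind _ (fun t => t <= D * exp (K * s)) (Hz s hs) _ (Rabs_minus_sym _ _)) r Hr). lra.
  - apply G; assumption.
Qed.

Fixpoint iterate (j : nat) : R -> R :=
  match j with O => fun _ => 1 | S j' => picard (iterate j') end.

Lemma iterate_class (j : nat) : profile_class (iterate j).
Proof.
  induction j as [|j IH]; [|apply picard_class, IH]. split.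
  - intros r. apply continuity_pt_const. intros a b; reflexivity.
  - intros r. cbn [iterate]. assert (Hm := m0_pos). assert (0 <= r ^ 2) by apply pow2_ge_0. nra.
Qed.

Lemma iterate_nonpos (j : nat) (r : R) : r <= 0 -> iterate j r = 1.
Proof. intros Hr. destruct j; [reflexivity|]. apply picard_nonpos; [exact Hr|apply iterate_class]. Qed.

Lemma iterate_cauchy (Rad : R) : 0 < Rad -> exists M, 0 <= M /\ forall j p r, r <= Rad ->
  Rabs (iterate (j + p) r - iterate j r) <= M * (/ 2) ^ j.
Proof.
  intros HR. destruct (picard_contract Rad HR) as [L [HL Hcon]].
  (* This K makes the contraction factor 1/2; [D0] bounds the distance from the first iterate to the
     constant 1. *)
  set (K := 2 * L). set (D0 := m0 / 2 * Rad ^ 2).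
  assert (Hm := m0_pos).
  assert (HD0 : 0 <= D0) by (unfold D0; apply Rmult_le_pos; [lra|apply pow2_ge_0]).
  assert (Hhalf : forall j, 0 < (/ 2) ^ j) by (intros j; apply pow_lt; lra).
  assert (Hstep : forall j r, 0 <= r <= Rad ->
    Rabs (iterate (S j) r - iterate j r) <= D0 * (/ 2) ^ j * exp (K * r)).
  { induction j as [|j IH]; intros r Hr.
    - cbn [pow]. rewrite Rmult_1_r.
      assert (h := proj2 (iterate_class 1) r). change (iterate 0 r) with 1.
      rewrite Rabs_left1 by lra.
      apply Rle_trans with D0.
      + unfold D0. assert (r ^ 2 <= Rad ^ 2) by (apply pow_incr; lra). nra.
      + rewrite <- (Rmult_1_r D0) at 1. apply Rmult_le_compat_l; [exact HD0|].
        rewrite <- exp_0. apply exp_mono. apply Rmult_le_pos; unfold K; lra.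
    - assert (h := Hcon (iterate (S j)) (iterate j) (D0 * (/ 2) ^ j) K (iterate_class _) (iterate_class _)
        ltac:(apply Rmult_le_pos; [exact HD0|left; apply Hhalf]) ltac:(unfold K; lra) IH r Hr).
      change (picard (iterate (S j))) with (iterate (S (S j))) in h.
      change (picard (iterate j)) with (iterate (S j)) in h.
      replace (L / K * (D0 * (/ 2) ^ j) * exp (K * r)) with (D0 * (/ 2) ^ S j * exp (K * r)) in h; [exact h|].
      cbn [pow]. unfold K. field. lra. }
  set (M := 2 * D0 * exp (K * Rad)).
  assert (HM : 0 <= M).
  { unfold M. apply Rmult_le_pos; [lra|left; apply exp_pos]. }
  exists M. split; [exact HM|]. intros j p r Hr.
  destruct (Rle_dec r 0) as [h0|h0].
  { rewrite !iterate_nonpos, Rminus_diag, Rabs_R0 by exact h0.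
    apply Rmult_le_pos; [exact HM|left; apply Hhalf]. }
  (* The geometric sum in closed form, so that the induction on p telescopes. *)
  assert (G : Rabs (iterate (j + p) r - iterate j r) <= M * ((/ 2) ^ j - (/ 2) ^ (j + p))).
  { induction p as [|p IH].
    - rewrite Nat.add_0_r, Rminus_diag, Rabs_R0, Rminus_diag. lra.
    - replace (iterate (j + S p) r - iterate j r) with
        ((iterate (S (j + p)) r - iterate (j + p) r) + (iterate (j + p) r - iterate j r))
        by (rewrite Nat.add_succ_r; ring).
      apply Rle_trans with (1 := Rabs_triang _ _).
      assert (h := Hstep (j + p)%nat r ltac:(lra)).
      assert (h' : D0 * (/ 2) ^ (j + p) * exp (K * r) <= M * ((/ 2) ^ (j + p) - (/ 2) ^ (j + S p))).
      { rewrite Nat.add_succ_r. cbn [pow]. unfold M.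
        assert (exp (K * r) <= exp (K * Rad)) by (apply exp_mono; apply Rmult_le_compat_l; unfold K; lra).
        assert (0 <= D0 * (/ 2) ^ (j + p)) by (apply Rmult_le_pos; [exact HD0|left; apply Hhalf]).
        assert (D0 * (/ 2) ^ (j + p) * exp (K * r) <= D0 * (/ 2) ^ (j + p) * exp (K * Rad))
          by (apply Rmult_le_compat_l; assumption).
        lra. }
      lra. }
  assert (h := Hhalf (j + p)%nat). nra.
Qed.

Definition profile (r : R) : R := real (Lim_seq (fun j => iterate j r)).

Lemma half_pow_small (M e : R) : 0 <= M -> 0 < e -> exists j, M * (/ 2) ^ j < e.
Proof.
  intros HM He. destruct (pow_lt_1_zero (/ 2) ltac:(rewrite Rabs_right; lra) (e / (M + 1))) as [N HN].
  { apply Rdiv_lt_0_compat; lra. }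
  exists N. assert (h := HN N (Nat.le_refl N)). rewrite Rabs_right in h by (left; apply pow_lt; lra).
  assert (0 < (/ 2) ^ N) by (apply pow_lt; lra).
  apply Rle_lt_trans with ((M + 1) * (/ 2) ^ N); [nra|].
  apply Rmult_lt_reg_r with (/ (M + 1)); [apply Rinv_0_lt_compat; lra|].
  replace ((M + 1) * (/ 2) ^ N * / (M + 1)) with ((/ 2) ^ N) by (field; lra). exact h.
Qed.

Lemma profile_limit (r : R) : is_lim_seq (fun j => iterate j r) (profile r).
Proof.
  destruct (iterate_cauchy (Rabs r + 1)) as [M [HM H]]; [pose proof (Rabs_pos r); lra|].
  assert (Hr : r <= Rabs r + 1) by (pose proof (Rle_abs r); lra).
  assert (Hex : ex_finite_lim_seq (fun j => iterate j r)).
  { apply ex_lim_seq_cauchy_corr. intros [e He]. cbn.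
    destruct (half_pow_small M (e / 2) HM ltac:(lra)) as [N HN]. exists N. intros a b Ha Hb.
    assert (h1 := H N (a - N)%nat r Hr). assert (h2 := H N (b - N)%nat r Hr).
    replace (N + (a - N))%nat with a in h1 by lia. replace (N + (b - N))%nat with b in h2 by lia.
    apply Rabs_le_between in h1. apply Rabs_le_between in h2. apply Rabs_def1; lra. }
  apply Lim_seq_correct' in Hex. exact Hex.
Qed.

Lemma profile_error (Rad : R) : 0 < Rad -> exists M, 0 <= M /\ forall j r, r <= Rad ->
  Rabs (profile r - iterate j r) <= M * (/ 2) ^ j.
Proof.
  intros HR. destruct (iterate_cauchy Rad HR) as [M [HM H]]. exists M. split; [exact HM|].
  intros j r Hr.
  apply (is_lim_seq_le (fun p => Rabs (iterate (p + j) r - iterate j r)) (fun _ => M * (/ 2) ^ j)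
    (Rabs (profile r - iterate j r)) (M * (/ 2) ^ j)).
  - intros p. rewrite Nat.add_comm. apply H, Hr.
  - apply (is_lim_seq_abs (fun p => iterate (p + j) r - iterate j r) (profile r - iterate j r)).
    apply is_lim_seq_minus'; [|apply is_lim_seq_const].
    apply (is_lim_seq_incr_n (fun p => iterate p r) j (profile r)), profile_limit.
  - apply is_lim_seq_const.
Qed.

Lemma profile_in_class : profile_class profile.
Proof.
  split.
  - intros r e He.
    destruct (profile_error (Rabs r + 1)) as [M [HM H]]; [pose proof (Rabs_pos r); lra|].
    assert (Hr := Rle_abs r).
    destruct (half_pow_small M (e / 3) HM ltac:(lra)) as [j Hj].
    destruct (proj1 (iterate_class j) r (e / 3) ltac:(lra)) as [d [Hd Hc']].
    exists (Rmin d 1). split; [apply Rmin_pos; lra|].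
    intros s [hs1 hs2]. simpl in hs2. unfold Rdist in hs2.
    assert (s <= Rabs r + 1).
    { assert (Rabs (s - r) < 1) by (apply Rlt_le_trans with (1 := hs2), Rmin_r).
      apply Rabs_def2 in H0. lra. }
    assert (h1 := H j s ltac:(lra)). assert (h2 := H j r ltac:(lra)).
    assert (h3 : Rabs (iterate j s - iterate j r) < e / 3).
    { apply (Hc' s). split; [exact hs1|]. simpl. unfold Rdist. apply Rlt_le_trans with (1 := hs2), Rmin_l. }
    simpl. unfold Rdist.
    apply Rabs_le_between in h1. apply Rabs_le_between in h2. apply Rabs_def2 in h3. apply Rabs_def1; lra.
  - intros r. split.
    + apply (is_lim_seq_le (fun _ => 1 - m0 / 2 * r ^ 2) (fun j => iterate j r) (1 - m0 / 2 * r ^ 2) (profile r));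
        [intros j; apply iterate_class|apply is_lim_seq_const|apply profile_limit].
    + apply (is_lim_seq_le (fun j => iterate j r) (fun _ => 1) (profile r) 1);
        [intros j; apply iterate_class|apply profile_limit|apply is_lim_seq_const].
Qed.

Lemma profile_fixed (r : R) : picard profile r = profile r.
Proof.
  destruct (Rle_dec r 0) as [h|h].
  - rewrite picard_nonpos by (auto using profile_in_class).
    assert (h1 : is_lim_seq (fun j => iterate j r) 1).
    { apply is_lim_seq_ext with (fun _ => 1); [intros j; symmetry; apply iterate_nonpos, h|apply is_lim_seq_const]. }
    apply is_lim_seq_unique in h1. unfold profile. rewrite h1. reflexivity.
  - apply Rminus_diag_uniq.
    apply cond_eq. intros e He. rewrite Rminus_0_r.
    destruct (picard_contract r ltac:(lra)) as [L [HL Hcon]].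
    destruct (profile_error r ltac:(lra)) as [M [HM HE]].
    set (K := 2 * L).
    set (M' := M * exp (K * r)).
    assert (HM' : 0 <= M') by (apply Rmult_le_pos; [exact HM|left; apply exp_pos]).
    destruct (half_pow_small M' (e / 2) HM' ltac:(lra)) as [j Hj].
    assert (Hhalf : 0 < (/ 2) ^ j) by (apply pow_lt; lra).
    assert (h1 : Rabs (picard profile r - picard (iterate j) r) <= L / K * (M * (/ 2) ^ j) * exp (K * r)).
    { apply Hcon; [apply profile_in_class|apply iterate_class| |unfold K; lra| |lra].
      - apply Rmult_le_pos; lra.
      - intros s Hs. apply Rle_trans with (1 := HE j s ltac:(lra)).
        rewrite <- (Rmult_1_r (M * (/ 2) ^ j)) at 1. apply Rmult_le_compat_l; [apply Rmult_le_pos; lra|].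
        rewrite <- exp_0. apply exp_mono. apply Rmult_le_pos; unfold K; lra. }
    assert (h2 := HE (S j) r ltac:(lra)). change (iterate (S j)) with (picard (iterate j)) in h2.
    assert (h3 : M * (/ 2) ^ S j <= / 2 * (M' * (/ 2) ^ j)).
    { cbn [pow]. unfold M'.
      assert (1 <= exp (K * r)) by (rewrite <- exp_0; apply exp_mono; apply Rmult_le_pos; unfold K; lra).
      assert (0 <= M * (/ 2) ^ j) by (apply Rmult_le_pos; lra). nra. }
    replace (L / K * (M * (/ 2) ^ j) * exp (K * r)) with (/ 2 * (M' * (/ 2) ^ j)) in h1
      by (unfold M', K; field; lra).
    apply Rabs_le_between in h1. apply Rabs_le_between in h2. apply Rabs_def1; lra.
Qed.

(** Since [z >= 1 - (m0 / 2) r^2], the weighted mean of [z^q] differs from 1 by a multiple of [r^2],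
    and the root is continuous at the positive limit. *)
Lemma slope_at_origin (z : R -> R) : profile_class z -> continuity_pt (slope z) 0.
Proof.
  intros Hz e He.
  set (v := / (INR n * c)).
  assert (Hv : 0 < v) by (apply Rinv_0_lt_compat, Rmult_lt_0_compat; assumption).
  assert (Hcont : continuity_pt (fun x => Rpower x (/ INR k)) v).
  { apply derivable_continuous_pt. eexists. apply Rpower_deriv, Hv. }
  destruct (Hcont e He) as [d [Hd H]].
  assert (Hm := m0_pos).
  set (Q := v * q * m0).
  assert (HQ : 0 < Q) by (unfold Q; repeat apply Rmult_lt_0_compat; lra).
  exists (Rmin 1 (d / Q)). split; [apply Rmin_pos; [lra|apply Rdiv_lt_0_compat; assumption]|].
  intros r [_ Hr]. simpl in Hr. unfold Rdist in Hr. rewrite Rminus_0_r in Hr.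
  simpl. unfold Rdist. unfold slope at 2. destruct (Rlt_dec 0 0) as [h|_]; [lra|].
  unfold slope. destruct (Rlt_dec 0 r) as [h|h]; [|rewrite Rminus_diag, Rabs_R0; exact He].
  fold v. rewrite Rabs_right in Hr by lra.
  assert (hr1 : r < 1) by (apply Rlt_le_trans with (1 := Hr), Rmin_l).
  assert (hr2 : r < d / Q) by (apply Rlt_le_trans with (1 := Hr), Rmin_r).
  assert (hb := avg_bounds z r Hz h). fold v in hb.
  assert (hlow : v * (1 - q * m0 / 2 * r ^ 2) <= mass z r / (c * r ^ n)).
  { assert (Hrn : 0 < r ^ n) by (apply pow_lt; lra).
    assert (hm : (1 - q * m0 / 2 * r ^ 2) * (r ^ n / INR n) <= mass z r).
    { apply (mass_bounds_gen z r _ 1 Hz h). intros s Hs.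
      split; [|apply ppow_le_1; [lra|apply Hz]].
      assert (hl := ppow_lipschitz q 1 (z s) Hq ltac:(lra) (proj2 (proj2 Hz s))).
      rewrite ppow_1 in hl. assert (hz := proj2 Hz s).
      rewrite (Rabs_right (1 - z s)) in hl by lra. apply Rabs_le_between in hl.
      assert (s ^ 2 <= r ^ 2) by (apply pow_incr; lra).
      assert (1 - z s <= m0 / 2 * r ^ 2) by nra.
      assert (q * (1 - z s) <= q * (m0 / 2 * r ^ 2)) by (apply Rmult_le_compat_l; lra). lra. }
    apply Rmult_le_reg_r with (c * r ^ n); [apply Rmult_lt_0_compat; assumption|].
    replace (mass z r / (c * r ^ n) * (c * r ^ n)) with (mass z r) by (field; lra).
    replace (v * (1 - q * m0 / 2 * r ^ 2) * (c * r ^ n)) with ((1 - q * m0 / 2 * r ^ 2) * (r ^ n / INR n))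
      by (unfold v; field; lra). exact hm. }
  destruct (Req_dec (mass z r / (c * r ^ n)) v) as [->|hn]; [rewrite Rminus_diag, Rabs_R0; exact He|].
  apply (H (mass z r / (c * r ^ n))). split; [split; [exact I|auto]|].
  simpl. unfold Rdist. rewrite Rabs_left1 by lra.
  apply Rle_lt_trans with (Q * r).
  - assert (r ^ 2 <= r) by (cbn; nra). unfold Q.
    assert (v * (q * m0 / 2 * r ^ 2) <= v * (q * m0 / 2 * r)).
    { apply Rmult_le_compat_l; [lra|]. apply Rmult_le_compat_l; [|assumption].
      apply Rmult_le_pos; [apply Rmult_le_pos|]; lra. }
    assert (0 <= v * q * m0 * r) by (apply Rmult_le_pos; [fold Q|]; lra). nra.
  - apply Rmult_lt_reg_r with (/ Q); [apply Rinv_0_lt_compat, HQ|].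
    rewrite (Rmult_comm Q r), Rmult_assoc, Rinv_r, Rmult_1_r by lra. exact hr2.
Qed.

Lemma root_pow (x : R) : 0 < x -> Rpower x (/ INR k) ^ k = x.
Proof.
  intros Hx. rewrite <- Rpower_pow by apply Rpower_pos. rewrite Rpower_mult, Rinv_l, Rpower_1; lra.
Qed.

(** The last clause holds because [z] decreases, so that the mass on [0, r] is at least
    [z(r)^q r^n / n]. It is the source of [xr_le], hence of the monotonicity of [m]. *)
Lemma profile_exists : exists z m : R -> R,
  z 0 = 1 /\
  (forall r, 0 <= r -> derivable_pt_lim z r (- (r * m r))) /\
  (forall r, 0 < m r) /\
  continuity m /\
  INR n * c * m 0 ^ k = 1 /\
  (forall r, 0 < r -> derivable_pt_lim (fun r => c * r ^ n * m r ^ k) r (r ^ (n - 1) * ppow q (z r))) /\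
  (forall r, 0 <= r -> ppow q (z r) <= INR n * c * m r ^ k).
Proof.
  assert (Hz := profile_in_class). set (z := profile) in *.
  assert (Hd : forall r, derivable_pt_lim z r (- (Rmax 0 r * slope z r))).
  { intros r. apply derivable_pt_lim_ext with (picard z); [intros s; apply profile_fixed|].
    apply picard_deriv, Hz. }
  assert (Hz0 : z 0 = 1) by (unfold z; rewrite <- profile_fixed; apply picard_0).
  assert (Hcm : forall r, 0 < r -> c * r ^ n * slope z r ^ k = mass z r).
  { intros r Hr. unfold slope. destruct (Rlt_dec 0 r) as [h|h]; [|lra].
    rewrite root_pow by (apply avg_bounds; assumption).
    assert (0 < r ^ n) by (apply pow_lt; lra). field. lra. }
  assert (Hm0 : INR n * c * slope z 0 ^ k = 1).
  { unfold slope. destruct (Rlt_dec 0 0) as [h|h]; [lra|].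
    rewrite root_pow by (apply Rinv_0_lt_compat, Rmult_lt_0_compat; assumption). field. lra. }
  exists z, (slope z). repeat split.
  - exact Hz0.
  - intros r Hr. assert (h := Hd r). rewrite Rmax_right in h by exact Hr. exact h.
  - intros r. apply slope_bounds, Hz.
  - intros r. destruct (Rtotal_order r 0) as [h|[->|h]].
    + apply continuity_pt_ext_loc with (fun _ => Rpower (/ (INR n * c)) (/ INR k)).
      * exists (mkposreal (- r) ltac:(lra)). intros s Hs. change (Rabs (s - r) < - r) in Hs. apply Rabs_def2 in Hs.
        unfold slope. destruct (Rlt_dec 0 s); [lra|reflexivity].
      * apply continuity_pt_const. intros a b; reflexivity.
    + apply slope_at_origin, Hz.
    + apply slope_continuous_pos; assumption.
  - exact Hm0.
  - intros r Hr. apply is_derive_Reals.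
    apply is_derive_ext_loc with (mass z).
    + exists (mkposreal r Hr). intros s Hs. change (Rabs (s - r) < r) in Hs. apply Rabs_def2 in Hs.
      symmetry. apply Hcm. lra.
    + apply is_derive_Reals. apply mass_deriv, Hz.
  - intros r Hr. destruct (Req_dec r 0) as [->|hn].
    { rewrite Hz0, ppow_1. lra. }
    assert (Hrp : 0 < r) by lra.
    assert (Hrn : 0 < r ^ n) by (apply pow_lt, Hrp).
    apply Rmult_le_reg_r with (r ^ n / INR n); [apply Rdiv_lt_0_compat; assumption|].
    replace (INR n * c * slope z r ^ k * (r ^ n / INR n)) with (c * r ^ n * slope z r ^ k) by (field; lra).
    rewrite Hcm by exact Hrp.
    apply (mass_bounds_gen z r _ 1 Hz Hrp). intros s Hs. split; [|apply ppow_le_1; [lra|apply Hz]].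
    apply ppow_le; [lra|].
    destruct (MVT_lim z (fun r => - (Rmax 0 r * slope z r)) s r ltac:(lra) (fun t _ => Hd t)) as [t [Ht Heq]].
    rewrite Rmax_right in Heq by lra.
    assert (hb := slope_bounds z t Hz).
    assert (0 <= t * slope z t * (r - s)) by (apply Rmult_le_pos; [apply Rmult_le_pos|]; lra). lra.
Qed.
End Profile.

(** * Monotonicity and first crossings *)

Lemma continuity_pt_eps (f : R -> R) (x e : R) : continuity_pt f x -> 0 < e ->
  exists d, 0 < d /\ forall y, Rabs (y - x) < d -> Rabs (f y - f x) < e.
Proof.
  intros H He. destruct (H e He) as [d [Hd H']]. exists d. split; [exact Hd|]. intros y Hy.
  destruct (Req_dec x y) as [->|hn]; [rewrite Rminus_diag, Rabs_R0; exact He|].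
  apply (H' y). split; [split; [exact I|exact hn]|exact Hy].
Qed.

Lemma mono_of_deriv (f f' : R -> R) (a b : R) : a <= b ->
  (forall x, a <= x <= b -> continuity_pt f x) ->
  (forall x, a < x < b -> derivable_pt_lim f x (f' x)) ->
  (forall x, a < x < b -> 0 <= f' x) -> f a <= f b.
Proof.
  intros Hab Hc Hd Hp. destruct (Req_dec a b) as [->|hn]; [lra|].
  assert (pr : forall x, a < x < b -> derivable_pt f x) by (intros x Hx; exists (f' x); apply Hd, Hx).
  destruct (MVT f id a b pr (fun x _ => derivable_pt_id x) ltac:(lra) Hc
    (fun x _ => derivable_continuous_pt _ _ (derivable_pt_id x))) as [x [Hx Heq]].
  assert (h1 : derive_pt f x (pr x Hx) = f' x) by (apply derive_pt_eq_0, Hd, Hx).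
  rewrite h1 in Heq. rewrite (derive_pt_eq_0 id x 1 _ (derivable_pt_lim_id x)) in Heq. unfold id in Heq.
  assert (0 <= (b - a) * f' x) by (apply Rmult_le_pos; [lra|apply Hp, Hx]). lra.
Qed.

Lemma first_crossing (g : R -> R) (a b : R) : a <= b ->
  (forall x, a <= x <= b -> continuity_pt g x) -> g a < 0 -> 0 <= g b ->
  exists r, a < r <= b /\ g r = 0 /\ forall s, a <= s < r -> g s < 0.
Proof.
  intros Hab Hc Ha Hb.
  set (E := fun t => a <= t <= b /\ forall s, a <= s <= t -> g s < 0).
  assert (HEa : E a) by (split; [lra|]; intros s Hs; replace s with a by lra; exact Ha).
  destruct (completeness E) as [r [Hub Hlub]]; [exists b; intros t Ht; apply Ht|exists a; exact HEa|].
  assert (Har : a <= r) by (apply Hub, HEa).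
  assert (Hrb : r <= b) by (apply Hlub; intros t Ht; apply Ht).
  assert (Hlt : forall s, a <= s < r -> g s < 0).
  { intros s Hs. apply NNPP. intros hn. assert (r <= s); [|lra].
    apply Hlub. intros t [Ht1 Ht2]. apply Rnot_lt_le. intros h. apply hn, Ht2. lra. }
  assert (Hr0 : g r = 0).
  { destruct (Rtotal_order (g r) 0) as [h|[h|h]]; [exfalso|exact h|exfalso].
    - destruct (continuity_pt_eps g r (- g r) (Hc r ltac:(lra)) ltac:(lra)) as [d [Hd H]].
      assert (r < b).
      { destruct (Req_dec r b) as [->|hn]; [lra|lra]. }
      set (t := Rmin b (r + d / 2)).
      assert (Ht : r < t /\ t <= b /\ t <= r + d / 2).
      { unfold t. split; [|split; [apply Rmin_l|apply Rmin_r]]. apply Rmin_glb_lt; lra. }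
      assert (E t); [|assert (h1 := Hub t H1); lra].
      split; [lra|]. intros s Hs. destruct (Rlt_dec s r) as [hs|hs]; [apply Hlt; lra|].
      assert (h1 := H s ltac:(apply Rabs_def1; lra)). apply Rabs_def2 in h1. lra.
    - destruct (continuity_pt_eps g r (g r) (Hc r ltac:(lra)) ltac:(lra)) as [d [Hd H]].
      assert (a < r).
      { destruct (Req_dec a r) as [he|hn]; [rewrite <- he in h; lra|lra]. }
      set (s := Rmax a (r - d / 2)).
      assert (Hs : a <= s /\ s < r /\ r - d / 2 <= s).
      { unfold s. split; [apply Rmax_l|split; [apply Rmax_lub_lt; lra|apply Rmax_r]]. }
      assert (h1 := H s ltac:(apply Rabs_def1; lra)). apply Rabs_def2 in h1.
      assert (h2 := Hlt s ltac:(lra)). lra. }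
  exists r. split; [|split; [exact Hr0|exact Hlt]].
  destruct (Req_dec a r) as [he|hn]; [rewrite <- he in Hr0; lra|lra].
Qed.

(** At a negative minimum over [a, b] the difference quotients from the left are at most 0, against
    [g' > 0]. Using only the left side covers a minimum at b. *)
Lemma barrier (g g' : R -> R) (a b : R) : a <= b ->
  (forall x, a <= x <= b -> continuity_pt g x) -> 0 <= g a ->
  (forall x, a < x <= b -> derivable_pt_lim g x (g' x)) ->
  (forall x, a < x <= b -> g x < 0 -> 0 < g' x) -> 0 <= g b.
Proof.
  intros Hab Hc Ha Hd Hp.
  destruct (continuity_ab_min g a b Hab Hc) as [x [Hmin Hx]].
  assert (h := Hmin b ltac:(lra)).
  destruct (Rle_dec 0 (g x)) as [h0|h0]; [lra|exfalso].
  assert (Hxa : a < x) by (destruct (Req_dec a x) as [he|hn]; [rewrite <- he in h0; lra|lra]).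
  assert (hp := Hp x ltac:(lra) ltac:(lra)).
  destruct (Hd x ltac:(lra) (g' x) hp) as [[d Hd'] H]. cbn in H.
  set (t := Rmin (d / 2) (x - a)).
  assert (Ht : 0 < t /\ t <= d / 2 /\ t <= x - a).
  { unfold t. split; [apply Rmin_pos; lra|split; [apply Rmin_l|apply Rmin_r]]. }
  assert (h1 := H (- t) ltac:(lra) ltac:(rewrite Rabs_Ropp, Rabs_right; lra)).
  assert (h2 := Hmin (x + - t) ltac:(lra)).
  apply Rabs_def2 in h1.
  assert (0 < (g (x + - t) - g x) / - t) by lra.
  assert ((g (x + - t) - g x) / - t * - t < 0) by nra.
  replace ((g (x + - t) - g x) / - t * - t) with (g (x + - t) - g x) in H1 by (field; lra). lra.
Qed.

Lemma mono_limit (g : R -> R) (a M : R) :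
  (forall r s, a <= r <= s -> g r <= g s) -> (forall r, a <= r -> g r <= M) ->
  exists l, (forall r, a <= r -> g r <= l) /\ forall e, 0 < e -> exists R0, a <= R0 /\ forall r, R0 <= r -> l - e < g r.
Proof.
  intros Hm HM.
  set (E := fun t => exists r, a <= r /\ t = g r).
  destruct (completeness E) as [l [Hub Hlub]].
  - exists M. intros t [r [Hr ->]]. apply HM, Hr.
  - exists (g a), a. split; [lra|reflexivity].
  - exists l. split; [intros r Hr; apply Hub; exists r; auto|].
    intros e He. apply NNPP. intros hn. assert (l <= l - e); [|lra].
    apply Hlub. intros t [r [Hr ->]]. apply Rnot_lt_le. intros h. apply hn. exists r. split; [exact Hr|].
    intros s Hs. apply Rlt_le_trans with (1 := h). apply Hm. lra.
Qed.

(** In the variable [ln r] the function [g] has slope at least d. *)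
Lemma log_growth_unbounded (g h : R -> R) (a d M : R) : 0 < a -> 0 < d ->
  (forall r, a <= r -> derivable_pt_lim g r (h r / r)) ->
  (forall r, a <= r -> d <= h r) -> (forall r, a <= r -> g r <= M) -> False.
Proof.
  intros Ha Hd Hder Hh HM.
  (* At [ln r = ln a + t] the lower bound [g a + d t] equals [M + d]. *)
  set (t := (M - g a) / d + 1).
  assert (Ht : 0 < t).
  { unfold t. assert (h0 := HM a ltac:(lra)).
    assert (0 <= (M - g a) / d) by (apply Rmult_le_pos; [lra|left; apply Rinv_0_lt_compat, Hd]). lra. }
  set (r := a * exp t).
  assert (Hexp : 1 < exp t) by (rewrite <- exp_0; apply exp_increasing, Ht).
  assert (Hr : a < r) by (unfold r; nra).
  assert (Hg : g a - d * ln a <= g r - d * ln r).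
  { apply (mono_of_deriv (fun r => g r - d * ln r) (fun r => h r / r - d * / r)); [lra| | |].
    - intros x Hx. apply derivable_continuous_pt. exists (h x / x - d * / x).
      apply derivable_pt_lim_minus; [apply Hder; lra|].
      apply (derivable_pt_lim_scal ln). apply derivable_pt_lim_ln. lra.
    - intros x Hx. apply derivable_pt_lim_minus; [apply Hder; lra|].
      apply (derivable_pt_lim_scal ln). apply derivable_pt_lim_ln. lra.
    - intros x Hx. assert (h0 := Hh x ltac:(lra)).
      replace (h x / x - d * / x) with ((h x - d) * / x) by (unfold Rdiv; ring).
      apply Rmult_le_pos; [lra|left; apply Rinv_0_lt_compat; lra]. }
  assert (Hln : ln r = ln a + t).
  { unfold r. rewrite ln_mult, ln_exp by (try apply exp_pos; lra). reflexivity. }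
  rewrite Hln in Hg. assert (h0 := HM r ltac:(lra)).
  assert (d * t = M - g a + d) by (unfold t; field; lra). lra.
Qed.

(** The weighted inequality of arithmetic and geometric means, with equality at y = a. It places the
    maximum of [gy] in [lyapunov_supercritical] at [alpha]. *)
Lemma young_pow (k : nat) (a y : R) : 0 <= a -> 0 <= y ->
  INR (S k) * a * y ^ k <= INR k * y ^ S k + a ^ S k.
Proof.
  intros Ha Hy. induction k as [|k IH].
  - cbn. lra.
  - rewrite !S_INR in *. cbn [pow] in *.
    assert (Hyk : 0 <= y ^ k) by (apply pow_le, Hy).
    assert (Hak : 0 <= a ^ k) by (apply pow_le, Ha).
    assert (H1 : 0 <= (y - a) * (y * y ^ k - a * a ^ k) ).
    { destruct (Rle_dec a y) as [h|h].
      - assert (a * a ^ k <= y * y ^ k).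
        { change (a ^ S k <= y ^ S k). apply pow_incr; lra. } nra.
      - assert (y * y ^ k <= a * a ^ k).
        { change (y ^ S k <= a ^ S k). apply pow_incr; lra. } nra. }
    assert (H2 := Rmult_le_compat_l a _ _ Ha IH).
    pose proof (pos_INR k).
    assert (H3 : 0 <= y ^ k * (y - a) ^ 2) by (apply Rmult_le_pos; [exact Hyk|apply pow2_ge_0]).
    assert (H4 := Rmult_le_compat_l y _ _ Hy IH).
    nra.
Qed.

Lemma deriv_within_interior (f : R -> R) (r l : R) : I01o r -> deriv_within I01c f r l -> derivable_pt_lim f r l.
Proof.
  intros Hr H e He. destruct (H e He) as [d [Hd H']].
  unfold I01o in Hr.
  assert (Hp : 0 < Rmin d (Rmin r (1 - r))) by (repeat apply Rmin_pos; lra).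
  exists (mkposreal _ Hp). cbn. intros h Hh0 Hh.
  assert (h1 : Rabs h < d) by (apply Rlt_le_trans with (1 := Hh), Rmin_l).
  assert (h2 : Rabs h < r) by (apply Rlt_le_trans with (1 := Hh); apply Rle_trans with (1 := Rmin_r _ _), Rmin_l).
  assert (h3 : Rabs h < 1 - r) by (apply Rlt_le_trans with (1 := Hh); apply Rle_trans with (1 := Rmin_r _ _), Rmin_r).
  apply H'; auto. apply Rabs_def2 in h2. apply Rabs_def2 in h3. unfold I01c. lra.
Qed.

Lemma deriv_within_of_derivable (D : R -> Prop) (f : R -> R) (r l : R) : derivable_pt_lim f r l -> deriv_within D f r l.
Proof.
  intros H e He. destruct (H e He) as [[d Hd] H']. exists d. split; [exact Hd|]. intros h Hh0 Hh _. apply H'; assumption.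
Qed.

Lemma cont_within_of_continuity (D : R -> Prop) (f : R -> R) (r : R) : continuity_pt f r -> cont_within D f r.
Proof.
  intros H e He. destruct (continuity_pt_eps f r e H He) as [d [Hd H']]. exists d. split; [exact Hd|]. intros y _ Hy. apply H', Hy.
Qed.

Lemma deriv_within_clamp_cont (f : R -> R) (r l : R) : I01c r -> deriv_within I01c f r l ->
  continuity_pt (fun s => f (clamp s)) r.
Proof.
  intros Hr H e He. destruct (H 1 Rlt_0_1) as [d [Hd H']].
  set (M := Rabs l + 1). assert (HM : 0 < M) by (unfold M; pose proof (Rabs_pos l); lra).
  exists (Rmin d (e / M)). split; [apply Rmin_pos; [exact Hd|apply Rdiv_lt_0_compat; assumption]|].
  intros s [_ Hs]. simpl in *. unfold Rdist in *. rewrite (clamp_id r) by exact Hr.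
  assert (hc := clamp_lipschitz s r). rewrite (clamp_id r Hr) in hc.
  destruct (Req_dec (clamp s) r) as [->|hn]; [rewrite Rminus_diag, Rabs_R0; exact He|].
  set (h := clamp s - r) in *. assert (Hh0 : h <> 0) by (unfold h; lra).
  assert (h1 : Rabs h < d) by (apply Rle_lt_trans with (1 := hc); apply Rlt_le_trans with (1 := Hs), Rmin_l).
  assert (h2 : Rabs h < e / M) by (apply Rle_lt_trans with (1 := hc); apply Rlt_le_trans with (1 := Hs), Rmin_r).
  replace (clamp s) with (r + h) by (unfold h; ring).
  assert (h3 := H' h Hh0 h1 ltac:(replace (r + h) with (clamp s) by (unfold h; ring); apply clamp_range)).
  assert (h4 : Rabs ((f (r + h) - f r) / h) <= M).
  { replace ((f (r + h) - f r) / h) with (((f (r + h) - f r) / h - l) + l) by ring.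
    apply Rle_trans with (1 := Rabs_triang _ _). unfold M. lra. }
  replace (f (r + h) - f r) with ((f (r + h) - f r) / h * h) by (field; exact Hh0).
  rewrite Rabs_mult. apply Rle_lt_trans with (M * Rabs h); [apply Rmult_le_compat_r; [apply Rabs_pos|exact h4]|].
  apply Rmult_lt_reg_r with (/ M); [apply Rinv_0_lt_compat, HM|].
  replace (M * Rabs h * / M) with (Rabs h) by (field; lra). exact h2.
Qed.

Lemma mono_within (f f' : R -> R) (a b : R) : 0 <= a <= b -> b <= 1 ->
  (forall r, I01c r -> deriv_within I01c f r (f' r)) -> (forall r, I01o r -> 0 <= f' r) -> f a <= f b.
Proof.
  intros Ha Hb Hd Hp.
  assert (h : f (clamp a) <= f (clamp b)).
  { apply (mono_of_deriv (fun s => f (clamp s)) f'); [lra| | |].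
    - intros x Hx. apply (deriv_within_clamp_cont f x (f' x)); [|apply Hd]; unfold I01c; lra.
    - intros x Hx. assert (Hx' : I01o x) by (unfold I01o; lra).
      assert (hd := deriv_within_interior f x (f' x) Hx' (Hd x ltac:(unfold I01c; lra))).
      apply is_derive_Reals. apply is_derive_Reals in hd. apply is_derive_ext_loc with (2 := hd).
      assert (Hp' : 0 < Rmin x (1 - x)) by (apply Rmin_pos; unfold I01o in Hx'; lra).
      exists (mkposreal _ Hp'). intros s Hs. change (Rabs (s - x) < Rmin x (1 - x)) in Hs.
      assert (h1 : Rabs (s - x) < x) by (apply Rlt_le_trans with (1 := Hs), Rmin_l).
      assert (h2 : Rabs (s - x) < 1 - x) by (apply Rlt_le_trans with (1 := Hs), Rmin_r).
      apply Rabs_def2 in h1. apply Rabs_def2 in h2. rewrite clamp_id by lra. reflexivity.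
    - intros x Hx. apply Hp. unfold I01o. lra. }
  rewrite !clamp_id in h by lra. exact h.
Qed.

(** [D] is nondecreasing on the open interval, and its limit at the origin replaces a value
    there. *)
Lemma nonneg_from_zero (D : R -> R) :
  (forall r, I01o r -> exists l, derivable_pt_lim D r l /\ 0 <= l) ->
  (forall e, 0 < e -> exists d, 0 < d /\ forall r, 0 < r < d -> r < 1 -> Rabs (D r) < e) ->
  forall r, I01o r -> 0 <= D r.
Proof.
  intros Hd H0 r Hr. unfold I01o in *. apply Rnot_lt_le. intros hneg.
  destruct (H0 (- D r) ltac:(lra)) as [d [Hdp H]].
  set (s := Rmin (d / 2) (r / 2)).
  assert (Hs : 0 < s /\ s <= d / 2 /\ s <= r / 2).
  { unfold s. split; [apply Rmin_pos; lra|split; [apply Rmin_l|apply Rmin_r]]. }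
  assert (h1 := H s ltac:(lra) ltac:(lra)). apply Rabs_def2 in h1.
  assert (h2 : D s <= D r); [|lra].
  assert (HD : forall x, 0 < x < 1 -> derivable_pt_lim D x (Derive D x) /\ 0 <= Derive D x).
  { intros x Hx. destruct (Hd x Hx) as [l [Hl1 Hl2]].
    rewrite (is_derive_unique D x l) by (apply is_derive_Reals; exact Hl1). auto. }
  apply (mono_of_deriv D (Derive D)); [lra| | |].
  - intros x Hx. apply derivable_continuous_pt. eexists. apply HD. lra.
  - intros x Hx. apply HD. lra.
  - intros x Hx. apply HD. lra.
Qed.

Lemma bounded_times_power_small (g : R -> R) (p : nat) : (1 <= p)%nat -> cont_within I01c g 0 ->
  forall e, 0 < e -> exists d, 0 < d /\ forall r, 0 < r < d -> r < 1 -> Rabs (r ^ p * g r) < e.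
Proof.
  intros Hp Hg e He. destruct (Hg 1 Rlt_0_1) as [d [Hd H]].
  set (M := Rabs (g 0) + 1). assert (HM : 0 < M) by (unfold M; pose proof (Rabs_pos (g 0)); lra).
  exists (Rmin d (e / M)). split; [apply Rmin_pos; [exact Hd|apply Rdiv_lt_0_compat; assumption]|].
  intros r Hr Hr1.
  assert (h1 : r < d) by (apply Rlt_le_trans with (1 := proj2 Hr), Rmin_l).
  assert (h2 : r < e / M) by (apply Rlt_le_trans with (1 := proj2 Hr), Rmin_r).
  assert (h3 := H r ltac:(unfold I01c; lra) ltac:(rewrite Rminus_0_r, Rabs_right; lra)).
  assert (h4 : Rabs (g r) <= M).
  { replace (g r) with ((g r - g 0) + g 0) by ring. apply Rle_trans with (1 := Rabs_triang _ _). unfold M. lra. }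
  assert (h5 : 0 <= r ^ p <= r).
  { split; [apply pow_le; lra|]. replace p with (S (p - 1)) by lia. cbn [pow].
    assert (r ^ (p - 1) <= 1) by (rewrite <- (pow1 (p - 1)); apply pow_incr; lra).
    assert (0 <= r ^ (p - 1)) by (apply pow_le; lra). nra. }
  rewrite Rabs_mult, (Rabs_right (r ^ p)) by lra.
  apply Rle_lt_trans with (r * M); [apply Rmult_le_compat; try lra; apply Rabs_pos|].
  apply Rmult_lt_reg_r with (/ M); [apply Rinv_0_lt_compat, HM|].
  replace (r * M * / M) with r by (field; lra). exact h2.
Qed.

Lemma pow_le_reg (k : nat) (a b : R) : (1 <= k)%nat -> 0 <= a -> 0 <= b -> a ^ k <= b ^ k -> a <= b.
Proof.
  intros Hk Ha Hb H. apply Rnot_lt_le. intros h.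
  assert (b ^ k < a ^ k); [|lra]. clear H. destruct k as [|k]; [lia|]. clear Hk.
  induction k as [|k IH]; [cbn; lra|].
  change (b * b ^ S k < a * a ^ S k).
  assert (0 <= b ^ S k) by (apply pow_le, Hb). apply Rmult_le_0_lt_compat; lra.
Qed.

(** * Gauge integrals and the singular solution *)

Lemma tpart_le (P : list (R * R * R)) : forall a b, tpart a b P -> a <= b.
Proof.
  induction P as [|[[l t] r] P IH]; intros a b H; cbn in H; [lra|].
  destruct H as [-> [H1 [H2 H3]]]. apply IH in H3. lra.
Qed.

(* Straddle estimate at every tag except [a], which can only tag the first interval. *)
Lemma HK_FTC (F f : R -> R) (a b : R) : a <= b ->
  (forall x, a < x <= b -> derivable_pt_lim F x (f x)) ->
  cont_within (fun x => a <= x <= b) F a ->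
  HKint a b f (F b - F a).
Proof.
  intros Hab Hd Hc. split; [exact Hab|]. intros e He.
  (* The error is split as e/4 for all straddle estimates together, e/4 for the continuity of [F] at
     a, and e/4 for the term [f a (r - a)]. *)
  set (eta := e / 4 / (b - a + 1)).
  assert (Heta : 0 < eta) by (unfold eta; repeat apply Rdiv_lt_0_compat; lra).
  assert (Hdel : forall x, exists d, 0 < d /\ (a < x <= b -> forall y, Rabs (y - x) < d ->
     Rabs (F y - F x - f x * (y - x)) <= eta * Rabs (y - x))).
  { intros x. destruct (classic (a < x <= b)) as [Hx|Hx]; [|exists 1; split; [lra|contradiction]].
    destruct (Hd x Hx eta Heta) as [[d Hdp] H]. cbn in H. exists d. split; [exact Hdp|]. intros _ y Hy.
    destruct (Req_dec y x) as [->|hn].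
    - rewrite !Rminus_diag, Rmult_0_r, Rminus_0_r, Rabs_R0. lra.
    - assert (h := H (y - x) ltac:(lra) Hy). replace (x + (y - x)) with y in h by ring.
      replace (F y - F x - f x * (y - x)) with (((F y - F x) / (y - x) - f x) * (y - x)) by (field; lra).
      rewrite Rabs_mult. apply Rmult_le_compat_r; [apply Rabs_pos|lra]. }
  set (dl := fun x => proj1_sig (constructive_indefinite_description _ (Hdel x))).
  assert (Hdl : forall x, 0 < dl x /\ (a < x <= b -> forall y, Rabs (y - x) < dl x ->
     Rabs (F y - F x - f x * (y - x)) <= eta * Rabs (y - x))).
  { intros x. exact (proj2_sig (constructive_indefinite_description _ (Hdel x))). }
  destruct (Hc (e / 4) ltac:(lra)) as [d0 [Hd0 H0]].
  (* [f a] is unrelated to [F], so an interval tagged at a is made short enough for its term to be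
     small. *)
  set (d1 := e / 4 / (Rabs (f a) + 1)).
  assert (Hfa := Rabs_pos (f a)).
  assert (Hd1 : 0 < d1) by (unfold d1; repeat apply Rdiv_lt_0_compat; lra).
  exists (fun x => if Req_EM_T x a then Rmin d0 d1 else dl x). split.
  { intros x _. destruct (Req_EM_T x a); [apply Rmin_pos; assumption|apply Hdl]. }
  assert (Hone : forall l t r, a < t -> l <= t <= r -> r <= b -> t - l < dl t -> r - t < dl t ->
     Rabs (f t * (r - l) - (F r - F l)) <= eta * (r - l)).
  { intros l t r Hat Ht Hrb H1 H2. destruct (Hdl t) as [_ H]. specialize (H ltac:(lra)).
    assert (h1 := H r ltac:(rewrite Rabs_right; lra)). assert (h2 := H l ltac:(rewrite Rabs_left1; lra)).
    rewrite (Rabs_right (r - t)) in h1 by lra. rewrite (Rabs_left1 (l - t)) in h2 by lra.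
    apply Rabs_le_between in h1. apply Rabs_le_between in h2. apply Rabs_le. lra. }
  set (G := fun x => if Req_EM_T x a then Rmin d0 d1 else dl x).
  assert (Htail : forall P a', a < a' -> tpart a' b P -> gauge_fine G P -> Rabs (rsum f P - (F b - F a')) <= eta * (b - a')).
  { induction P as [|[[l t] r] P IH]; intros a' Ha' Hp Hg.
    - cbn in Hp. subst a'. cbn. rewrite !Rminus_diag, Rabs_R0. lra.
    - cbn in Hp. destruct Hp as [-> [Ht [Hlr Hp]]].
      assert (Hrb := tpart_le _ _ _ Hp).
      assert (h1 := IH r ltac:(lra) Hp (fun l' t' r' hin => Hg l' t' r' (or_intror hin))).
      assert (h2 := Hg a' t r (or_introl eq_refl)).
      unfold G in h2. destruct (Req_EM_T t a); [lra|].
      assert (h3 := Hone a' t r ltac:(lra) Ht Hrb (proj1 h2) (proj2 h2)).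
      change (rsum f ((a', t, r) :: P)) with (f t * (r - a') + rsum f P).
      apply Rabs_le_between in h1. apply Rabs_le_between in h3. apply Rabs_le. lra. }
  assert (Hsmall : forall x, a <= x <= b -> eta * (b - x) <= e / 4).
  { intros x Hx. apply Rle_trans with (eta * (b - a + 1)); [apply Rmult_le_compat_l; lra|].
    unfold eta. right. field. lra. }
  intros P Hp Hg. destruct P as [|[[l t] r] P].
  - cbn in Hp. subst b. cbn. rewrite !Rminus_diag, Rabs_R0. exact He.
  - cbn in Hp. destruct Hp as [-> [Ht [Hlr Hp]]].
    assert (Hrb := tpart_le _ _ _ Hp).
    assert (h1 := Htail P r Hlr Hp (fun l' t' r' hin => Hg l' t' r' (or_intror hin))).
    assert (h1' := Hsmall r ltac:(lra)).
    assert (h2 := Hg a t r (or_introl eq_refl)).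
    change (rsum f ((a, t, r) :: P)) with (f t * (r - a) + rsum f P).
    assert (h3 : Rabs (f t * (r - a) - (F r - F a)) <= e / 2).
    { unfold G in h2. destruct (Req_EM_T t a) as [->|hn].
      - destruct h2 as [_ h2].
        assert (a1 : r - a < d0) by (apply Rlt_le_trans with (1 := h2), Rmin_l).
        assert (a2 : r - a < d1) by (apply Rlt_le_trans with (1 := h2), Rmin_r).
        assert (a3 := H0 r ltac:(lra) ltac:(rewrite Rabs_right; lra)).
        assert (a4 : Rabs (f a * (r - a)) <= e / 4).
        { rewrite Rabs_mult, (Rabs_right (r - a)) by lra.
          apply Rle_trans with ((Rabs (f a) + 1) * d1); [apply Rmult_le_compat; lra|].
          unfold d1. right. field. lra. }
        apply Rabs_def2 in a3. apply Rabs_le_between in a4. apply Rabs_le. lra.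
      - apply Rle_trans with (eta * (r - a)).
        + apply Hone; try lra; apply h2.
        + assert (h4 := Hsmall a ltac:(lra)).
          assert (eta * (r - a) <= eta * (b - a)) by (apply Rmult_le_compat_l; lra). lra. }
    apply Rabs_le_between in h1. apply Rabs_le_between in h3. apply Rabs_def1; lra.
Qed.

(** [HK_FTC] looks at the integrand only on (a, b], where |f| = f, so one antiderivative serves both
    integrals. *)
Lemma L1_of_antiderivative (F f : R -> R) (a b : R) : a <= b ->
  (forall x, a < x <= b -> derivable_pt_lim F x (f x)) ->
  (forall x, a < x <= b -> 0 <= f x) ->
  cont_within (fun x => a <= x <= b) F a -> L1 a b f.
Proof.
  intros Hab Hd Hp Hc. split; exists (F b - F a); apply HK_FTC; auto.
  intros x Hx. rewrite Rabs_right by (apply Rle_ge, Hp, Hx). auto.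
Qed.

Lemma abs_cont_of_bounded_deriv (u u' : R -> R) (a b M : R) : 0 <= M ->
  (forall r, a <= r <= b -> derivable_pt_lim u r (u' r)) ->
  (forall r, a <= r <= b -> Rabs (u' r) <= M) -> abs_cont a b u.
Proof.
  intros HM Hd Hb e He. exists (e / (M + 1)). split; [apply Rdiv_lt_0_compat; lra|].
  intros L HL _ Hsum.
  assert (Hlip : forall x y, a <= x <= y -> y <= b -> Rabs (u y - u x) <= M * (y - x)).
  { intros x y Hx Hy. destruct (Req_dec x y) as [->|hn]; [rewrite !Rminus_diag, Rabs_R0; lra|].
    destruct (MVT_lim u u' x y ltac:(lra)) as [s [Hs ->]]; [intros; apply Hd; lra|].
    rewrite Rabs_mult, (Rabs_right (y - x)) by lra. apply Rmult_le_compat_r; [lra|apply Hb; lra]. }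
  assert (h : fold_right (fun p acc => Rabs (u (snd p) - u (fst p)) + acc) 0 L <=
     M * fold_right (fun p acc => snd p - fst p + acc) 0 L /\
     0 <= fold_right (fun p acc => snd p - fst p + acc) 0 L).
  { clear Hsum. induction L as [|p L IH]; [cbn; lra|]. cbn [fold_right].
    assert (h1 := HL p (or_introl eq_refl)).
    assert (h2 := IH (fun p' hp' => HL p' (or_intror hp'))).
    assert (h3 := Hlip (fst p) (snd p) ltac:(lra) ltac:(lra)). lra. }
  destruct h as [h h0]. apply Rle_lt_trans with (1 := h).
  apply Rle_lt_trans with ((M + 1) * fold_right (fun p acc => snd p - fst p + acc) 0 L); [nra|].
  apply Rmult_lt_reg_r with (/ (M + 1)); [apply Rinv_0_lt_compat; lra|].
  replace ((M + 1) * fold_right (fun p acc => snd p - fst p + acc) 0 L * / (M + 1)) with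
    (fold_right (fun p acc => snd p - fst p + acc) 0 L) by (field; lra). exact Hsum.
Qed.

Lemma null_set_empty (E : R -> Prop) : (forall x, ~ E x) -> null_set E.
Proof.
  intros HE e He. exists (fun _ => 0), (fun _ => 0). split; [intros; lra|]. split.
  - intros x Hx. destruct (HE x Hx).
  - intros N. assert (h : sum_f_R0 (fun _ => 0 - 0) N = 0).
    { induction N as [|N IH]; simpl; lra. }
    rewrite h. exact He.
Qed.

Lemma ppow_small (p e : R) : 0 < p -> 0 < e -> exists d, 0 < d /\ forall r, r < d -> ppow p r < e.
Proof.
  intros Hp He. exists (Rpower e (/ p)). split; [apply Rpower_pos|]. intros r Hr.
  unfold ppow. destruct (Rlt_dec 0 r) as [h|h]; [|exact He].
  replace e with (Rpower (Rpower e (/ p)) p).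
  - apply Rlt_Rpower_l; [exact Hp|split; assumption].
  - rewrite Rpower_mult, Rinv_l, Rpower_1; lra.
Qed.

Lemma ppow_antiderivative (p x : R) : p <> 0 -> 0 < x ->
  derivable_pt_lim (fun s => ppow p s / p) x (Rpower x (p - 1)).
Proof.
  intros Hp Hx. apply is_derive_Reals.
  apply is_derive_ext_loc with (fun s => / p * Rpower s p).
  - exists (mkposreal x Hx). intros s Hs. change (Rabs (s - x) < x) in Hs. apply Rabs_def2 in Hs.
    rewrite ppow_pos_eq by lra. unfold Rdiv. apply Rmult_comm.
  - apply is_derive_Reals. replace (Rpower x (p - 1)) with (/ p * (p * Rpower x (p - 1))) by (field; exact Hp).
    apply (derivable_pt_lim_scal (fun s => Rpower s p)), Rpower_deriv, Hx.
Qed.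

Lemma ppow_div_cont_0 (D : R -> Prop) (p : R) : 0 < p -> cont_within D (fun s => ppow p s / p) 0.
Proof.
  intros Hp e He. destruct (ppow_small p (e * p) Hp) as [d [Hd H]]; [apply Rmult_lt_0_compat; assumption|].
  exists d. split; [exact Hd|]. intros y _ Hy.
  assert (h0 : ppow p 0 = 0) by (unfold ppow; destruct (Rlt_dec 0 0); [lra|reflexivity]).
  rewrite h0. unfold Rdiv. rewrite Rmult_0_l, Rminus_0_r.
  assert (h := H y ltac:(rewrite Rminus_0_r in Hy; apply Rle_lt_trans with (1 := Rle_abs y), Hy)).
  assert (h1 := ppow_nonneg p y).
  rewrite Rabs_right by (apply Rle_ge, Rmult_le_pos; [exact h1|left; apply Rinv_0_lt_compat, Hp]).
  apply Rmult_lt_reg_r with p; [exact Hp|]. rewrite Rmult_assoc, Rinv_l, Rmult_1_r by lra. exact h.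
Qed.

Lemma pow_Rpower (x : R) (j : nat) : 0 < x -> x ^ j = Rpower x (INR j).
Proof. intros Hx. symmetry. apply Rpower_pow, Hx. Qed.

(** For [u = 1 - r^(-al)] both sides of the equation are powers of r, and [(q - k) al = 2 k] makes
    both exponents equal to [xb]. Positivity of [xb] makes the right-hand integral converge at 0,
    and [(q + 1) al < n] does the same for [r^(n-k) (u')^(k+1)]. *)
Lemma singular_integral_solution (n k : nat) (q al xb : R) :
  (1 <= k)%nat -> (2 * k < n)%nat -> INR k < q -> 0 < al -> (q - INR k) * al = 2 * INR k ->
  xb = INR n - q * al -> 0 < xb -> (q + 1) * al < INR n ->
  integral_solution n k q (cnk n k * xb * al ^ k) (fun r => 1 - Rpower r (- al)).
Proof.
  intros Hk Hkn Hkq Hal Hae Hxb Hxp Hsup.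
  set (u := fun r => 1 - Rpower r (- al)). set (d := fun r => al * Rpower r (- al - 1)).
  assert (Hud : forall r, 0 < r -> derivable_pt_lim u r (d r)).
  { intros r Hr. replace (d r) with (0 - - al * Rpower r (- al - 1)) by (unfold d; ring).
    apply (derivable_pt_lim_minus (fun _ => 1)); [apply derivable_pt_lim_const|apply Rpower_deriv, Hr]. }
  assert (Huc : forall r, 0 < r -> continuity_pt u r).
  { intros r Hr. apply derivable_continuous_pt. eexists. apply Hud, Hr. }
  assert (HNk : INR (n - k) = INR n - INR k) by (apply minus_INR; lia).
  assert (Hqa : q * al = 2 * INR k + INR k * al) by lra.
  split; [|split; [|split; [|split]]].
  - intros r Hr. apply cont_within_of_continuity, Huc, Hr.
  (* Below this radius [r^(-al)] exceeds [|M| + 2]. *)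
  - right. intros M. exists (Rpower (Rabs M + 2) (- / al)). split; [apply Rpower_pos|].
    intros r Hr. unfold u.
    assert (HM := Rabs_pos M). assert (HM' := Rle_abs (- M)). rewrite Rabs_Ropp in HM'.
    assert (h : Rabs M + 2 < Rpower r (- al)).
    { replace (Rabs M + 2) with (Rpower (Rpower (Rabs M + 2) (- / al)) (- al)).
      - rewrite !(Rpower_Ropp _ al). apply Rinv_lt_contravar; [apply Rmult_lt_0_compat; apply Rpower_pos|].
        apply Rlt_Rpower_l; [exact Hal|exact Hr].
      - rewrite Rpower_mult. replace (- / al * - al) with 1 by (field; lra). apply Rpower_1. lra. }
    lra.
  - intros a Ha. apply (abs_cont_of_bounded_deriv u d a 1 (al * Rpower a (- al - 1))).
    + apply Rmult_le_pos; [lra|left; apply Rpower_pos].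
    + intros r Hr. apply Hud. lra.
    + intros r Hr. unfold d. assert (h := Rpower_pos r (- al - 1)).
      rewrite Rabs_right by (apply Rle_ge, Rmult_le_pos; lra). apply Rmult_le_compat_l; [lra|].
      replace (- al - 1) with (- (al + 1)) by ring. rewrite !Rpower_Ropp.
      apply Rinv_le_contravar; [apply Rpower_pos|]. apply Rle_Rpower_l; lra.
  - unfold u, Rpower. rewrite ln_1, Rmult_0_r, exp_0. ring.
  - exists d. split.
    + set (p := INR n - (q + 1) * al). assert (Hp : 0 < p) by (unfold p; lra).
      assert (Hval : forall r, 0 < r -> r ^ (n - k) * d r ^ (k + 1) = al ^ (k + 1) * Rpower r (p - 1)).
      { intros r Hr. unfold d. rewrite Rpow_mult_distr, !(pow_Rpower r), (pow_Rpower (Rpower r _)), Rpower_mult by (auto using Rpower_pos).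
        replace (Rpower r (INR (n - k)) * (al ^ (k + 1) * Rpower r ((- al - 1) * INR (k + 1))))
          with (al ^ (k + 1) * (Rpower r (INR (n - k)) * Rpower r ((- al - 1) * INR (k + 1)))) by ring.
        rewrite <- Rpower_plus. do 2 f_equal. rewrite HNk, plus_INR. cbn [INR]. unfold p. lra. }
      apply (L1_of_antiderivative (fun s => al ^ (k + 1) * (ppow p s / p))); [lra| | |].
      * intros x Hx. rewrite Hval by lra. apply (derivable_pt_lim_scal (fun s => ppow p s / p)).
        apply ppow_antiderivative; lra.
      * intros x Hx. rewrite Hval by lra. apply Rmult_le_pos; [apply pow_le; lra|left; apply Rpower_pos].
      * intros e He. assert (hp : 0 < al ^ (k + 1)) by (apply pow_lt, Hal).
        destruct (ppow_div_cont_0 (fun x => 0 <= x <= 1) p Hp (e / al ^ (k + 1))) as [d0 [Hd0 H]];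
          [apply Rdiv_lt_0_compat; assumption|].
        exists d0. split; [exact Hd0|]. intros y Hy Hyd. specialize (H y Hy Hyd).
        rewrite <- Rmult_minus_distr_l, Rabs_mult, (Rabs_right (al ^ (k + 1))) by lra.
        apply Rmult_lt_reg_r with (/ al ^ (k + 1)); [apply Rinv_0_lt_compat, hp|].
        rewrite (Rmult_comm (al ^ (k + 1))), Rmult_assoc, Rinv_r, Rmult_1_r by lra. exact H.
    + apply null_set_empty. intros r [Hr Hn]. apply Hn. unfold I01o in Hr. split; [apply Hud; lra|].
      exists (ppow xb r / xb - ppow xb 0 / xb). split.
      * apply (HK_FTC (fun s => ppow xb s / xb)); [lra| |apply ppow_div_cont_0, Hxp].
        intros s Hs. replace (s ^ (n - 1) * Rpower (1 - u s) q) with (Rpower s (xb - 1)).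
        -- apply ppow_antiderivative; lra.
        -- unfold u. replace (1 - (1 - Rpower s (- al))) with (Rpower s (- al)) by ring.
           rewrite Rpower_mult, pow_Rpower, <- Rpower_plus by lra. f_equal.
           rewrite minus_INR by lia. cbn [INR]. lra.
      * assert (h0 : ppow xb 0 = 0) by (unfold ppow; destruct (Rlt_dec 0 0); [lra|reflexivity]).
        rewrite h0, ppow_pos_eq by lra. unfold d.
        rewrite Rpow_mult_distr, !(pow_Rpower r), (pow_Rpower (Rpower r _)), Rpower_mult by (auto using Rpower_pos; lra).
        replace (cnk n k * Rpower r (INR (n - k)) * (al ^ k * Rpower r ((- al - 1) * INR k)))
          with (cnk n k * al ^ k * (Rpower r (INR (n - k)) * Rpower r ((- al - 1) * INR k))) by ring.
        rewrite <- Rpower_plus. replace (INR (n - k) + (- al - 1) * INR k) with xb by (rewrite HNk; lra).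
        field. lra.
Qed.

(** * The branch of radial solutions *)

Definition is_profile (n k : nat) (q c : R) (z m : R -> R) : Prop :=
  z 0 = 1 /\
  (forall r, 0 <= r -> derivable_pt_lim z r (- (r * m r))) /\
  (forall r, 0 < m r) /\
  continuity m /\
  INR n * c * m 0 ^ k = 1 /\
  (forall r, 0 < r -> derivable_pt_lim (fun r => c * r ^ n * m r ^ k) r (r ^ (n - 1) * ppow q (z r))) /\
  (forall r, 0 <= r -> ppow q (z r) <= INR n * c * m r ^ k).

Section ProfileDynamics.
Variables (n k : nat) (q c : R) (z m : R -> R).
Hypotheses (Hk : (1 <= k)%nat) (Hkn : (2 * k < n)%nat) (Hkq : INR k < q) (Hc : 0 < c)
  (HP : is_profile n k q c z m).

Let HK : 1 <= INR k.
Proof. change 1 with (INR 1). apply le_INR, Hk. Qed.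
Let HN : 2 * INR k < INR n.
Proof. replace (2 * INR k) with (INR (2 * k)) by (rewrite mult_INR; cbn; ring). apply lt_INR, Hkn. Qed.

(** This is [r G' / G] for the mass [G = c r^n m^k]. As also [r G' / G = n + k r m' / m], it gives
    the formula [m1] for [m']. *)
Definition xr (r : R) : R := ppow q (z r) / (c * m r ^ k).
Definition m1 (r : R) : R := m r * (xr r - INR n) / (INR k * r).

Lemma m_pos (r : R) : 0 < m r. Proof. apply HP. Qed.
Lemma mk_pos (r : R) : 0 < c * m r ^ k.
Proof. apply Rmult_lt_0_compat; [exact Hc|apply pow_lt, m_pos]. Qed.

Lemma z_deriv (r : R) : 0 <= r -> derivable_pt_lim z r (- (r * m r)).
Proof. apply HP. Qed.

Lemma z_cont (r : R) : 0 <= r -> continuity_pt z r.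
Proof. intros Hr. apply derivable_continuous_pt. eexists. apply z_deriv, Hr. Qed.

Lemma z_0 : z 0 = 1. Proof. apply HP. Qed.

Lemma z_decr (r s : R) : 0 <= r <= s -> z s <= z r.
Proof.
  intros Hrs. apply Ropp_le_cancel.
  apply (mono_of_deriv (fun r => - z r) (fun r => - - (r * m r))); [lra| | |].
  - intros x Hx. apply continuity_pt_opp, z_cont. lra.
  - intros x Hx. apply derivable_pt_lim_opp, z_deriv. lra.
  - intros x Hx. assert (h := m_pos x). rewrite Ropp_involutive. apply Rmult_le_pos; lra.
Qed.

Lemma z_le_1 (r : R) : 0 <= r -> z r <= 1.
Proof. intros Hr. rewrite <- z_0. apply z_decr. lra. Qed.

Lemma z_pos_before (r s : R) : 0 <= r <= s -> 0 < z s -> 0 < z r.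
Proof. intros Hrs Hs. apply Rlt_le_trans with (1 := Hs), z_decr, Hrs. Qed.

Lemma ppow_z_cont (r : R) : 0 <= r -> 0 < z r -> continuity_pt (fun r => ppow q (z r)) r.
Proof.
  intros Hr Hz. destruct (continuity_pt_eps z r (z r) (z_cont r Hr) Hz) as [d [Hd H]].
  apply continuity_pt_ext_loc with (fun r => Rpower (z r) q).
  - exists (mkposreal d Hd). intros s Hs. assert (h := H s Hs). apply Rabs_def2 in h.
    symmetry. apply ppow_pos_eq. lra.
  - apply (continuity_pt_comp z (fun x => Rpower x q)); [apply z_cont, Hr|].
    apply derivable_continuous_pt. eexists. apply Rpower_deriv, Hz.
Qed.

Lemma xr_le (r : R) : 0 <= r -> xr r <= INR n.
Proof.
  intros Hr. unfold xr. apply Rmult_le_reg_r with (c * m r ^ k); [apply mk_pos|].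
  assert (h := mk_pos r).
  replace (ppow q (z r) / (c * m r ^ k) * (c * m r ^ k)) with (ppow q (z r)) by (field; split; [|lra]; apply pow_nonzero, Rgt_not_eq, m_pos).
  rewrite <- Rmult_assoc. apply HP, Hr.
Qed.

Lemma xr_0 : xr 0 = INR n.
Proof.
  unfold xr. rewrite z_0, ppow_1.
  assert (h : INR n * c * m 0 ^ k = 1) by apply HP. assert (h' := mk_pos 0).
  transitivity (INR n * c * m 0 ^ k / (c * m 0 ^ k)); [rewrite h; reflexivity|field].
  split; [|lra]. apply pow_nonzero, Rgt_not_eq, m_pos.
Qed.

Lemma mk_cont (r : R) : continuity_pt (fun r => c * m r ^ k) r.
Proof.
  apply (continuity_pt_scal (fun r => m r ^ k)).
  apply (continuity_pt_comp m (fun x => x ^ k)); [apply HP|].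
  apply derivable_continuous_pt, derivable_pt_pow.
Qed.

Lemma xr_cont (r : R) : 0 <= r -> 0 < z r -> continuity_pt xr r.
Proof.
  intros Hr Hz. apply continuity_pt_div; [apply ppow_z_cont; assumption|apply mk_cont|].
  apply Rgt_not_eq, mk_pos.
Qed.

Lemma m_deriv (r : R) : 0 < r -> derivable_pt_lim m r (m1 r).
Proof.
  intros Hr.
  assert (HPr : derivable_pt_lim (fun r => c * r ^ n * m r ^ k) r (r ^ (n - 1) * ppow q (z r))) by (apply HP, Hr).
  set (G := fun r => c * r ^ n * m r ^ k) in *.
  assert (Hm := m_pos r).
  assert (Hmk : 0 < m r ^ k) by (apply pow_lt, Hm).
  assert (Hrn : 0 < r ^ n) by (apply pow_lt, Hr).
  assert (Hrn1 : 0 < r ^ (n - 1)) by (apply pow_lt, Hr).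
  assert (Hq1 : derivable_pt_lim (fun r => G r / (c * r ^ n)) r
     (ppow q (z r) / (c * r) - INR n * m r ^ k / r)).
  { assert (Hden : derivable_pt_lim (fun r => c * r ^ n) r (c * (INR n * r ^ pred n)))
      by (apply (derivable_pt_lim_scal (fun r => r ^ n)), derivable_pt_lim_pow).
    assert (h := derivable_pt_lim_div G (fun r => c * r ^ n) r _ _ HPr Hden
      ltac:(apply Rgt_not_eq, Rmult_lt_0_compat; lra)).
    replace (ppow q (z r) / (c * r) - INR n * m r ^ k / r) with
      ((r ^ (n - 1) * ppow q (z r) * (c * r ^ n) - c * (INR n * r ^ pred n) * G r) / Rsqr (c * r ^ n)); [exact h|].
    unfold G, Rsqr. replace (pred n) with (n - 1)%nat by lia.
    replace (r ^ n) with (r * r ^ (n - 1)) by (replace n with (S (n - 1)) at 2 by lia; reflexivity).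
    field. lra. }
  assert (HGm : forall s, 0 < s -> G s / (c * s ^ n) = m s ^ k).
  { intros s Hs. unfold G. field. split; [|lra]. apply pow_nonzero. lra. }
  assert (Hroot : forall x, 0 < x -> Rpower (x ^ k) (/ INR k) = x).
  { intros x Hx. rewrite <- Rpower_pow, Rpower_mult, Rinv_r, Rpower_1; lra. }
  apply is_derive_Reals.
  apply is_derive_ext_loc with (fun r => Rpower (G r / (c * r ^ n)) (/ INR k)).
  - exists (mkposreal r Hr). intros s Hs. change (Rabs (s - r) < r) in Hs. apply Rabs_def2 in Hs.
    rewrite HGm by lra. apply Hroot, m_pos.
  - apply is_derive_Reals.
    replace (m1 r) with (/ INR k * Rpower (G r / (c * r ^ n)) (/ INR k - 1) * (ppow q (z r) / (c * r) - INR n * m r ^ k / r)).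
    + apply (derivable_pt_lim_comp (fun r => G r / (c * r ^ n)) (fun x => Rpower x (/ INR k))); [exact Hq1|].
      apply Rpower_deriv. rewrite HGm by exact Hr. exact Hmk.
    + rewrite HGm by exact Hr. unfold Rminus at 1. rewrite Rpower_plus, Hroot, Rpower_Ropp, Rpower_1 by assumption.
      unfold m1, xr. field. repeat split; lra.
Qed.

Lemma m1_nonpos (r : R) : 0 < r -> m1 r <= 0.
Proof.
  intros Hr. unfold m1. assert (h := xr_le r ltac:(lra)). assert (hm := m_pos r).
  unfold Rdiv. assert (0 < / (INR k * r)) by (apply Rinv_0_lt_compat, Rmult_lt_0_compat; lra).
  assert (m r * (xr r - INR n) <= 0) by nra. nra.
Qed.

Lemma m_decr (r s : R) : 0 <= r <= s -> m s <= m r.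
Proof.
  intros Hrs. apply Ropp_le_cancel.
  apply (mono_of_deriv (fun r => - m r) (fun r => - m1 r)); [lra| | |].
  - intros x Hx. apply continuity_pt_opp, HP.
  - intros x Hx. apply derivable_pt_lim_opp, m_deriv. lra.
  - intros x Hx. assert (h := m1_nonpos x ltac:(lra)). lra.
Qed.

Lemma m1_cont (r : R) : 0 < r -> 0 < z r -> continuity_pt m1 r.
Proof.
  intros Hr Hz. apply (continuity_pt_div (fun r => m r * (xr r - INR n)) (fun r => INR k * r)).
  - apply (continuity_pt_mult m (fun r => xr r - INR n)); [apply HP|].
    apply (continuity_pt_minus xr (fun _ => INR n)); [apply xr_cont; [lra|exact Hz]|].
    apply continuity_pt_const. intros a b; reflexivity.
  - apply (continuity_pt_scal (fun r => r)), continuity_pt_id.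
  - apply Rgt_not_eq, Rmult_lt_0_compat; lra.
Qed.

(** [r m' = m (x - n) / k], and [x(0) = n]. *)
Lemma m1_origin (e : R) : 0 < e -> exists d, 0 < d /\ forall r, 0 < r < d -> Rabs (r * m1 r) < e.
Proof.
  intros He.
  assert (Hcont : continuity_pt (fun r => m r * (xr r - INR n) * / INR k) 0).
  { apply (continuity_pt_mult (fun r => m r * (xr r - INR n)) (fun _ => / INR k));
      [|apply continuity_pt_const; intros a b; reflexivity].
    apply (continuity_pt_mult m (fun r => xr r - INR n)); [apply HP|].
    apply (continuity_pt_minus xr (fun _ => INR n)); [apply xr_cont; [lra|rewrite z_0; lra]|].
    apply continuity_pt_const. intros a b; reflexivity. }
  destruct (continuity_pt_eps _ _ e Hcont He) as [d [Hd H]].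
  exists d. split; [exact Hd|]. intros r Hr. specialize (H r ltac:(rewrite Rminus_0_r, Rabs_right; lra)).
  cbv beta in H. rewrite xr_0 in H.
  replace (r * m1 r) with (m r * (xr r - INR n) * / INR k - m 0 * (INR n - INR n) * / INR k); [exact H|].
  unfold m1. field. lra.
Qed.

(** * Phase-plane analysis of [lamf] *)

Definition lamf (r : R) : R := r ^ (2 * k) * Rpower (z r) (q - INR k).
(** Equal to [- r z' / z], the rate of decay of [ln z] in [ln r]. *)
Definition yr (r : R) : R := r ^ 2 * m r / z r.
(** [lamf] is stationary where [y = alpha], and [(xbar, alpha)] is the common zero of the brackets
    in [xr_deriv] and [yr_deriv]. The matching power solution of the equation is [r^(-alpha)]. *)
Definition alpha : R := 2 * INR k / (q - INR k).
Definition xbar : R := INR n - q * alpha.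

Lemma alpha_pos : 0 < alpha.
Proof. apply Rdiv_lt_0_compat; lra. Qed.

Lemma alpha_eq : (q - INR k) * alpha = 2 * INR k.
Proof. unfold alpha. field. lra. Qed.

Lemma lamf_cont (r : R) : 0 <= r -> 0 < z r -> continuity_pt lamf r.
Proof.
  intros Hr Hz. apply (continuity_pt_mult (fun r => r ^ (2 * k)) (fun r => Rpower (z r) (q - INR k))).
  - apply derivable_continuous_pt, derivable_pt_pow.
  - apply (continuity_pt_comp z (fun x => Rpower x (q - INR k))); [apply z_cont, Hr|].
    apply derivable_continuous_pt. eexists. apply Rpower_deriv, Hz.
Qed.

Lemma lamf_0 : lamf 0 = 0.
Proof. unfold lamf. rewrite pow_i by lia. ring. Qed.

Lemma lamf_pos (r : R) : 0 < r -> 0 < lamf r.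
Proof. intros Hr. apply Rmult_lt_0_compat; [apply pow_lt, Hr|apply Rpower_pos]. Qed.

Lemma yr_pos (r : R) : 0 < r -> 0 < z r -> 0 < yr r.
Proof.
  intros Hr Hz. apply Rdiv_lt_0_compat; [|exact Hz]. apply Rmult_lt_0_compat; [apply pow_lt, Hr|apply m_pos].
Qed.

Lemma xr_pos (r : R) : 0 < z r -> 0 < xr r.
Proof. intros Hz. unfold xr. rewrite ppow_pos_eq by exact Hz. apply Rdiv_lt_0_compat; [apply Rpower_pos|apply mk_pos]. Qed.

Lemma yr_cont (r : R) : 0 <= r -> 0 < z r -> continuity_pt yr r.
Proof.
  intros Hr Hz. apply (continuity_pt_div (fun r => r ^ 2 * m r) z).
  - apply (continuity_pt_mult (fun r => r ^ 2) m); [apply derivable_continuous_pt, derivable_pt_pow|apply HP].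
  - apply z_cont, Hr.
  - lra.
Qed.

Lemma lamf_xy (r : R) : 0 < r -> 0 < z r -> lamf r = c * xr r * yr r ^ k.
Proof.
  intros Hr Hz. unfold lamf, xr, yr. rewrite ppow_pos_eq by exact Hz.
  unfold Rminus. rewrite Rpower_plus, Rpower_Ropp, Rpower_pow by exact Hz.
  unfold Rdiv. rewrite !Rpow_mult_distr, pow_inv, <- pow_mult.
  assert (m r ^ k <> 0) by (apply pow_nonzero, Rgt_not_eq, m_pos).
  assert (z r ^ k <> 0) by (apply pow_nonzero; lra).
  field. repeat split; auto. lra.
Qed.

Lemma lnz_deriv (r : R) : 0 < r -> 0 < z r -> derivable_pt_lim (fun r => ln (z r)) r (- yr r / r).
Proof.
  intros Hr Hz. replace (- yr r / r) with (/ z r * - (r * m r)) by (unfold yr; field; lra).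
  apply (derivable_pt_lim_comp z ln); [apply z_deriv; lra|apply derivable_pt_lim_ln, Hz].
Qed.

Lemma lnm_deriv (r : R) : 0 < r -> derivable_pt_lim (fun r => ln (m r)) r ((xr r - INR n) / INR k / r).
Proof.
  intros Hr. assert (h := m_pos r).
  replace ((xr r - INR n) / INR k / r) with (/ m r * m1 r) by (unfold m1; field; lra).
  apply (derivable_pt_lim_comp m ln); [apply m_deriv, Hr|apply derivable_pt_lim_ln, h].
Qed.

Lemma ln_lamf (r : R) : 0 < r -> ln (lamf r) = 2 * INR k * ln r + (q - INR k) * ln (z r).
Proof.
  intros Hr. unfold lamf. rewrite ln_mult by (try apply pow_lt; try apply Rpower_pos; exact Hr).
  rewrite <- Rpower_pow by exact Hr. unfold Rpower. rewrite !ln_exp, mult_INR. cbn [INR]. ring.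
Qed.

Lemma ln_yr (r : R) : 0 < r -> 0 < z r -> ln (yr r) = 2 * ln r + ln (m r) - ln (z r).
Proof.
  intros Hr Hz. assert (h := m_pos r). unfold yr, Rdiv.
  assert (0 < r ^ 2) by (apply pow_lt, Hr).
  rewrite ln_mult, ln_mult, ln_Rinv; try assumption.
  - rewrite <- Rpower_pow by exact Hr. unfold Rpower. rewrite ln_exp. cbn [INR]. ring.
  - apply Rmult_lt_0_compat; assumption.
  - apply Rinv_0_lt_compat, Hz.
Qed.

Lemma ln_xr (r : R) : 0 < z r -> ln (xr r) = q * ln (z r) - INR k * ln (m r) - ln c.
Proof.
  intros Hz. assert (h := m_pos r). unfold xr, Rdiv. rewrite ppow_pos_eq by exact Hz.
  assert (h1 := mk_pos r). assert (0 < m r ^ k) by (apply pow_lt, h).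
  rewrite ln_mult, ln_Rinv, ln_mult; try assumption; try apply Rpower_pos.
  - rewrite <- Rpower_pow by exact h. unfold Rpower. rewrite !ln_exp. ring.
  - apply Rinv_0_lt_compat, h1.
Qed.

Lemma locally_pos (r : R) : 0 < r -> 0 < z r -> exists d, 0 < d /\ forall s, Rabs (s - r) < d -> 0 < s /\ 0 < z s.
Proof.
  intros Hr Hz. destruct (continuity_pt_eps z r (z r) (z_cont r ltac:(lra)) Hz) as [d [Hd H]].
  exists (Rmin d r). split; [apply Rmin_pos; lra|]. intros s Hs.
  assert (h1 := H s ltac:(apply Rlt_le_trans with (1 := Hs), Rmin_l)).
  assert (h2 : Rabs (s - r) < r) by (apply Rlt_le_trans with (1 := Hs), Rmin_r).
  apply Rabs_def2 in h1. apply Rabs_def2 in h2. lra.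
Qed.

Lemma deriv_ext_pos (f g : R -> R) (r l : R) : 0 < r -> 0 < z r ->
  (forall s, 0 < s -> 0 < z s -> f s = g s) -> derivable_pt_lim f r l -> derivable_pt_lim g r l.
Proof.
  intros Hr Hz Hfg Hf. destruct (locally_pos r Hr Hz) as [d [Hd H]].
  apply is_derive_Reals. apply is_derive_Reals in Hf. apply is_derive_ext_loc with (2 := Hf).
  exists (mkposreal d Hd). intros s Hs. apply Hfg; apply H; exact Hs.
Qed.

Lemma lnlam_deriv (r : R) : 0 < r -> 0 < z r ->
  derivable_pt_lim (fun r => ln (lamf r)) r ((q - INR k) * (alpha - yr r) / r).
Proof.
  intros Hr Hz. apply (deriv_ext_pos (fun r => 2 * INR k * ln r + (q - INR k) * ln (z r))); auto.
  { intros s Hs _. symmetry. apply ln_lamf, Hs. }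
  replace ((q - INR k) * (alpha - yr r) / r) with (2 * INR k * / r + (q - INR k) * (- yr r / r))
    by (rewrite Rmult_minus_distr_l, alpha_eq; field; lra).
  apply derivable_pt_lim_plus.
  - apply (derivable_pt_lim_scal ln), derivable_pt_lim_ln, Hr.
  - apply (derivable_pt_lim_scal (fun r => ln (z r))), lnz_deriv; assumption.
Qed.

Lemma lny_deriv (r : R) : 0 < r -> 0 < z r ->
  derivable_pt_lim (fun r => ln (yr r)) r (((xr r - INR n) / INR k + 2 + yr r) / r).
Proof.
  intros Hr Hz. apply (deriv_ext_pos (fun r => 2 * ln r + ln (m r) - ln (z r))); auto.
  { intros s Hs Hzs. symmetry. apply ln_yr; assumption. }
  replace (((xr r - INR n) / INR k + 2 + yr r) / r) with (2 * / r + (xr r - INR n) / INR k / r - - yr r / r)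
    by (field; lra).
  apply (derivable_pt_lim_minus (fun r => 2 * ln r + ln (m r))); [|apply lnz_deriv; assumption].
  apply (derivable_pt_lim_plus (fun r => 2 * ln r)); [|apply lnm_deriv, Hr].
  apply (derivable_pt_lim_scal ln), derivable_pt_lim_ln, Hr.
Qed.

Lemma lnx_deriv (r : R) : 0 < r -> 0 < z r ->
  derivable_pt_lim (fun r => ln (xr r)) r ((INR n - xr r - q * yr r) / r).
Proof.
  intros Hr Hz. apply (deriv_ext_pos (fun r => q * ln (z r) - INR k * ln (m r) - ln c)); auto.
  { intros s Hs Hzs. symmetry. apply ln_xr; assumption. }
  replace ((INR n - xr r - q * yr r) / r) with (q * (- yr r / r) - INR k * ((xr r - INR n) / INR k / r) - 0)
    by (field; lra).
  apply (derivable_pt_lim_minus (fun r => q * ln (z r) - INR k * ln (m r)) (fun _ => ln c)); [|apply derivable_pt_lim_const].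
  apply (derivable_pt_lim_minus (fun r => q * ln (z r))).
  - apply (derivable_pt_lim_scal (fun r => ln (z r))), lnz_deriv; assumption.
  - apply (derivable_pt_lim_scal (fun r => ln (m r))), lnm_deriv, Hr.
Qed.

Lemma deriv_of_ln (f : R -> R) (r l : R) : 0 < r -> 0 < z r -> (forall s, 0 < s -> 0 < z s -> 0 < f s) ->
  derivable_pt_lim (fun r => ln (f r)) r l -> derivable_pt_lim f r (f r * l).
Proof.
  intros Hr Hz Hf Hl. apply (deriv_ext_pos (fun r => exp (ln (f r)))); auto.
  { intros s Hs Hzs. apply exp_ln. auto. }
  replace (f r * l) with (exp (ln (f r)) * l) by (rewrite exp_ln; auto).
  apply (derivable_pt_lim_comp (fun r => ln (f r)) exp); [exact Hl|apply derivable_pt_lim_exp].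
Qed.

Lemma yr_deriv (r : R) : 0 < r -> 0 < z r ->
  derivable_pt_lim yr r (yr r * (((xr r - INR n) / INR k + 2 + yr r) / r)).
Proof. intros Hr Hz. apply deriv_of_ln; auto using yr_pos, lny_deriv. Qed.

Lemma xr_deriv (r : R) : 0 < r -> 0 < z r ->
  derivable_pt_lim xr r (xr r * ((INR n - xr r - q * yr r) / r)).
Proof. intros Hr Hz. apply deriv_of_ln; auto using xr_pos, lnx_deriv. Qed.

Lemma lamf_deriv (r : R) : 0 < r -> 0 < z r ->
  derivable_pt_lim lamf r (lamf r * ((q - INR k) * (alpha - yr r) / r)).
Proof. intros Hr Hz. apply deriv_of_ln; auto using lamf_pos, lnlam_deriv. Qed.

(** The coefficient [A] cancels the terms of [F'] that contain [z^q]; what remains is a multiple of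
    [r^(n+1) m^(k+1)] whose sign is the subcritical condition. As [F 0 = 0], dividing [F r >= 0] by
    [G z] gives the bound. *)
Lemma pohozaev_subcritical : (q + 1) * (INR n - 2 * INR k) <= INR n * (INR k + 1) ->
  forall r, 0 < r -> 0 < z r -> INR n - INR k * (q + 1) / (INR k + 1) * yr r <= xr r.
Proof.
  intros Hsub r Hr Hz.
  set (G := fun r => c * r ^ n * m r ^ k).
  set (A := INR k * (q + 1) / (INR k + 1)).
  set (F := fun r => A * (r ^ 2 * m r * G r) + r ^ n * Rpower (z r) (q + 1) - INR n * (G r * z r)).
  set (F' := fun r => c * r ^ S n * m r ^ S k * (INR n - (q + 1) * (INR n - 2 * INR k) / (INR k + 1))).
  assert (HzR : forall s, 0 <= s <= r -> 0 < z s) by (intros s Hs; apply (z_pos_before s r); assumption).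
  assert (HG : forall s, 0 < s <= r -> derivable_pt_lim G s (s ^ (n - 1) * Rpower (z s) q)).
  { intros s Hs. rewrite <- ppow_pos_eq by (apply HzR; lra). apply HP. lra. }
  assert (HGc : forall s, continuity_pt G s).
  { intros s. apply (continuity_pt_mult (fun r => c * r ^ n) (fun r => m r ^ k)).
    - apply (continuity_pt_scal (fun r => r ^ n)), derivable_continuous_pt, derivable_pt_pow.
    - apply (continuity_pt_comp m (fun x => x ^ k)); [apply HP|]. apply derivable_continuous_pt, derivable_pt_pow. }
  assert (HF : F 0 <= F r).
  { apply (mono_of_deriv F F'); [lra| | |].
    - intros s Hs. apply (continuity_pt_minus (fun r => A * (r ^ 2 * m r * G r) + r ^ n * Rpower (z r) (q + 1))).
      + apply (continuity_pt_plus (fun r => A * (r ^ 2 * m r * G r))).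
        * apply (continuity_pt_scal (fun r => r ^ 2 * m r * G r)).
          apply (continuity_pt_mult (fun r => r ^ 2 * m r)); [|apply HGc].
          apply (continuity_pt_mult (fun r => r ^ 2)); [apply derivable_continuous_pt, derivable_pt_pow|apply HP].
        * apply (continuity_pt_mult (fun r => r ^ n)); [apply derivable_continuous_pt, derivable_pt_pow|].
          apply (continuity_pt_comp z (fun x => Rpower x (q + 1))); [apply z_cont; lra|].
          apply derivable_continuous_pt. eexists. apply Rpower_deriv, HzR. lra.
      + apply (continuity_pt_scal (fun r => G r * z r)). apply continuity_pt_mult; [apply HGc|apply z_cont; lra].
    - intros s Hs. assert (Hzs := HzR s ltac:(lra)).
      assert (hG := HG s ltac:(lra)). assert (hz := z_deriv s ltac:(lra)). assert (hm := m_deriv s ltac:(lra)).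
      assert (hp : derivable_pt_lim (fun r => Rpower (z r) (q + 1)) s ((q + 1) * Rpower (z s) (q + 1 - 1) * - (s * m s))).
      { apply (derivable_pt_lim_comp z (fun x => Rpower x (q + 1))); [exact hz|apply Rpower_deriv, Hzs]. }
      assert (d1 := derivable_pt_lim_scal _ A _ _ (derivable_pt_lim_mult _ _ _ _ _
         (derivable_pt_lim_mult _ _ _ _ _ (derivable_pt_lim_pow s 2) hm) hG)).
      assert (d2 := derivable_pt_lim_mult _ _ _ _ _ (derivable_pt_lim_pow s n) hp).
      assert (d3 := derivable_pt_lim_scal _ (INR n) _ _ (derivable_pt_lim_mult _ _ _ _ _ hG hz)).
      assert (d := derivable_pt_lim_minus _ _ _ _ _ (derivable_pt_lim_plus _ _ _ _ _ d1 d2) d3).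
      match type of d with derivable_pt_lim _ _ ?L => replace (F' s) with L; [exact d|] end.
      unfold mult_fct, plus_fct, minus_fct, mult_real_fct, F', G, A, m1, xr. cbv beta.
      rewrite ppow_pos_eq by exact Hzs.
      replace (q + 1 - 1) with q by ring. rewrite Rpower_plus, Rpower_1 by exact Hzs.
      replace (pred n) with (n - 1)%nat by lia.
      replace (s ^ n) with (s * s ^ (n - 1)) by (replace n with (S (n - 1)) at 2 by lia; reflexivity).
      replace (s ^ S n) with (s * (s * s ^ (n - 1))) by (replace (S n) with (S (S (n - 1))) by lia; reflexivity).
      cbn [pow pred INR].
      assert (m s <> 0) by (apply Rgt_not_eq, m_pos).
      assert (m s ^ k <> 0) by (apply pow_nonzero; assumption).
      field. repeat split; auto; lra.
    - intros s Hs. unfold F'. apply Rmult_le_pos.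
      + left. apply Rmult_lt_0_compat; [apply Rmult_lt_0_compat; [exact Hc|apply pow_lt; lra]|apply pow_lt, m_pos].
      + apply Rmult_le_reg_r with (INR k + 1); [lra|].
        replace ((INR n - (q + 1) * (INR n - 2 * INR k) / (INR k + 1)) * (INR k + 1))
          with (INR n * (INR k + 1) - (q + 1) * (INR n - 2 * INR k)) by (field; lra). lra. }
  assert (HF0 : F 0 = 0).
  { unfold F, G. rewrite !pow_i by lia. ring. }
  rewrite HF0 in HF.
  assert (Hm := m_pos r). assert (Hmk : 0 < m r ^ k) by (apply pow_lt, Hm).
  assert (Hrn : 0 < r ^ n) by (apply pow_lt, Hr).
  assert (HGz : 0 < G r * z r).
  { unfold G. repeat apply Rmult_lt_0_compat; assumption. }
  assert (HFe : F r = G r * z r * (A * yr r + xr r - INR n)).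
  { unfold F, G, yr, xr. rewrite ppow_pos_eq by exact Hz. rewrite Rpower_plus, Rpower_1 by exact Hz.
    field. repeat split; lra. }
  rewrite HFe in HF.
  assert (0 <= A * yr r + xr r - INR n); [|lra].
  apply Rnot_lt_le. intros h. nra.
Qed.

(** [E] is nondecreasing, since [alpha - y] and [alpha^k - y^k] have the same sign. By Young's
    inequality it is at most [e (lamf r)], with equality where [y = alpha]. The exponent [kap]
    places the maximum of [e] at [lt], the value of [lamf] at the rest point, so [e] decreases
    beyond [lt]. From [lamf r > lamf r0 >= lt] it would follow that
    [E r <= e (lamf r) < e (lamf r0) = E r0]. *)
Lemma lyapunov_supercritical : (q + 1) * alpha <= INR n ->
  forall r0 r, 0 < r0 <= r -> 0 < z r -> yr r0 = alpha -> c * xbar * alpha ^ k <= lamf r0 -> lamf r <= lamf r0.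
Proof.
  intros Hsup r0 r Hr Hz Hy0 Hlam0.
  set (kap := (INR k + 1) / (q - INR k)).
  set (dl := INR n - (q + 1) * alpha).
  set (gy := fun y => alpha * y ^ k - INR k / (INR k + 1) * y ^ S k + dl * alpha ^ k / (INR k + 1)).
  set (E := fun r => exp (kap * ln (lamf r)) * (c * gy (yr r) - lamf r / (q + 1))).
  set (E' := fun r => exp (kap * ln (lamf r)) * (c * dl * ((alpha - yr r) * (alpha ^ k - yr r ^ k)) / r)).
  assert (Ha := alpha_pos).
  assert (HzR : forall s, 0 <= s <= r -> 0 < z s) by (intros s Hs; apply (z_pos_before s r); assumption).
  assert (Hder : forall s, 0 < s <= r -> derivable_pt_lim E s (E' s)).
  { intros s Hs. assert (Hzs := HzR s ltac:(lra)).
    assert (hl := lnlam_deriv s ltac:(lra) Hzs). assert (hlam := lamf_deriv s ltac:(lra) Hzs).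
    assert (hy := yr_deriv s ltac:(lra) Hzs).
    assert (d1 : derivable_pt_lim (fun r => exp (kap * ln (lamf r))) s
       (exp (kap * ln (lamf s)) * (kap * ((q - INR k) * (alpha - yr s) / s)))).
    { apply (derivable_pt_lim_comp (fun r => kap * ln (lamf r)) exp); [|apply derivable_pt_lim_exp].
      apply (derivable_pt_lim_scal (fun r => ln (lamf r))), hl. }
    assert (d2 : derivable_pt_lim (fun r => gy (yr r)) s
       ((alpha * (INR k * yr s ^ pred k) - INR k / (INR k + 1) * (INR (S k) * yr s ^ k) + 0) *
        (yr s * (((xr s - INR n) / INR k + 2 + yr s) / s)))).
    { apply (derivable_pt_lim_comp yr gy); [exact hy|].
      apply (derivable_pt_lim_plus (fun y => alpha * y ^ k - INR k / (INR k + 1) * y ^ S k)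
        (fun _ => dl * alpha ^ k / (INR k + 1))); [|apply derivable_pt_lim_const].
      apply (derivable_pt_lim_minus (fun y => alpha * y ^ k)).
      - apply (derivable_pt_lim_scal (fun y => y ^ k)), derivable_pt_lim_pow.
      - apply (derivable_pt_lim_scal (fun y => y ^ S k)), (derivable_pt_lim_pow (yr s) (S k)). }
    assert (d3 : derivable_pt_lim (fun r => c * gy (yr r) - lamf r / (q + 1)) s
       (c * ((alpha * (INR k * yr s ^ pred k) - INR k / (INR k + 1) * (INR (S k) * yr s ^ k) + 0) *
        (yr s * (((xr s - INR n) / INR k + 2 + yr s) / s)))
        - lamf s * ((q - INR k) * (alpha - yr s) / s) * / (q + 1))).
    { apply derivable_pt_lim_minus; [apply (derivable_pt_lim_scal (fun r => gy (yr r))), d2|].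
      apply derivable_pt_lim_ext with (fun r => / (q + 1) * lamf r); [intros; unfold Rdiv; ring|].
      rewrite Rmult_comm. apply (derivable_pt_lim_scal lamf), hlam. }
    assert (d := derivable_pt_lim_mult _ _ _ _ _ d1 d3).
    match type of d with derivable_pt_lim _ _ ?L => replace (E' s) with L; [exact d|] end.
    assert (Hkk : yr s * yr s ^ pred k = yr s ^ k) by (replace k with (S (pred k)) at 2 by lia; reflexivity).
    assert (Hlam : lamf s = c * xr s * yr s ^ k) by (apply lamf_xy; [lra|exact Hzs]).
    unfold E'. rewrite Hlam. unfold gy, kap, dl.
    replace (yr s ^ S k) with (yr s * yr s ^ k) by reflexivity.
    set (w := exp _). set (Y := yr s ^ k) in *. set (P := yr s ^ pred k) in *. rewrite S_INR.
    assert (Hn' : INR n = xbar + q * alpha) by (unfold xbar; ring).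
    (* A middle form in which [y^(k-1)] occurs only in the product [yr s * P], so that [Hkk] can
       remove it. *)
    transitivity (w * ((alpha - yr s) / s * ((INR k + 1) * (c * (alpha * Y - INR k / (INR k + 1) * (yr s * Y)
        + (INR n - (q + 1) * alpha) * alpha ^ k / (INR k + 1)) - c * xr s * Y / (q + 1))))
      + w * (c * INR k * (alpha - yr s) * (yr s * P) * (((xr s - INR n) / INR k + 2 + yr s) / s)
         + c * (yr s * P - Y) * INR k * yr s * (((xr s - INR n) / INR k + 2 + yr s) / s)
         - c * xr s * Y * ((q - INR k) * (alpha - yr s) / s) * / (q + 1))).
    - field. repeat split; lra.
    - rewrite Hkk.
      assert (Hq' : q * alpha = INR k * alpha + 2 * INR k) by (assert (h := alpha_eq); lra).
      replace (c * dl * ((alpha - yr s) * (alpha ^ k - Y)) / s) with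
        (c * (INR n - (q + 1) * alpha) * ((alpha - yr s) * (alpha ^ k - Y)) / s) by reflexivity.
      replace (INR n - (q + 1) * alpha) with (INR n - (INR k * alpha + 2 * INR k) - alpha) by lra.
      field. repeat split; lra. }
  assert (HE : E r0 <= E r).
  { apply (mono_of_deriv E E'); [lra| | |].
    - intros s Hs. apply derivable_continuous_pt. eexists. apply Hder. lra.
    - intros s Hs. apply Hder. lra.
    - intros s Hs. apply Rmult_le_pos; [left; apply exp_pos|].
      apply Rmult_le_pos; [|left; apply Rinv_0_lt_compat; lra].
      apply Rmult_le_pos; [apply Rmult_le_pos; unfold dl; lra|].
      assert (hy := yr_pos s ltac:(lra) (HzR s ltac:(lra))).
      destruct (Rle_dec (yr s) alpha) as [h|h].
      + apply Rmult_le_pos; [lra|]. assert (yr s ^ k <= alpha ^ k) by (apply pow_incr; lra). lra.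
      + assert (alpha ^ k <= yr s ^ k) by (apply pow_incr; lra). nra. }
  set (lt := c * xbar * alpha ^ k).
  set (e := fun l => Rpower l kap * (lt / (INR k + 1) - l / (q + 1))).
  assert (Hgy : forall y, 0 <= y -> c * gy y <= lt / (INR k + 1)).
  { intros y Hy. assert (h := young_pow k alpha y ltac:(lra) Hy). rewrite S_INR in h.
    unfold gy, lt, xbar, dl. replace (c * (INR n - q * alpha) * alpha ^ k / (INR k + 1)) with
      (c * ((alpha ^ S k) / (INR k + 1) + (INR n - (q + 1) * alpha) * alpha ^ k / (INR k + 1))) by (cbn [pow]; field; lra).
    apply Rmult_le_compat_l; [lra|]. apply Rplus_le_compat_r.
    apply Rmult_le_reg_r with (INR k + 1); [lra|].
    replace (alpha ^ S k / (INR k + 1) * (INR k + 1)) with (alpha ^ S k) by (field; lra).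
    replace ((alpha * y ^ k - INR k / (INR k + 1) * y ^ S k) * (INR k + 1)) with
      ((INR k + 1) * alpha * y ^ k - INR k * y ^ S k) by (field; lra). lra. }
  assert (Hgy0 : c * gy alpha = lt / (INR k + 1)).
  { unfold gy, lt, xbar, dl. cbn [pow]. field. lra. }
  apply Rnot_lt_le. intros Hlt.
  assert (Hl0 := lamf_pos r0 ltac:(lra)).
  assert (HEr : E r <= e (lamf r)).
  { unfold E, e, Rpower. apply Rmult_le_compat_l; [left; apply exp_pos|].
    assert (h := Hgy (yr r) (Rlt_le _ _ (yr_pos r ltac:(lra) Hz))). lra. }
  assert (HEr0 : E r0 = e (lamf r0)).
  { unfold E, e, Rpower. rewrite Hy0, Hgy0. reflexivity. }
  assert (Hkap : 0 < kap) by (apply Rdiv_lt_0_compat; lra).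
  destruct (MVT_lim e (fun l => (kap * Rpower l (kap - 1)) * (lt / (INR k + 1) - l / (q + 1)) + Rpower l kap * (- / (q + 1)))
    (lamf r0) (lamf r) Hlt) as [l [Hl Heq]].
  { intros l Hl. apply (derivable_pt_lim_mult (fun l => Rpower l kap) (fun l => lt / (INR k + 1) - l / (q + 1))).
    - apply Rpower_deriv. lra.
    - apply is_derive_Reals. auto_derive; [exact I|]. field. lra. }
  assert (Hd : (kap * Rpower l (kap - 1)) * (lt / (INR k + 1) - l / (q + 1)) + Rpower l kap * (- / (q + 1))
     = Rpower l (kap - 1) * (lt - l) / (q - INR k)).
  { replace kap with (1 + (kap - 1)) at 3 by ring. rewrite Rpower_plus, Rpower_1 by lra.
    unfold kap at 1. field. repeat split; lra. }
  rewrite Hd in Heq.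
  assert (hR := Rpower_pos l (kap - 1)).
  fold lt in Hlam0.
  assert (Rpower l (kap - 1) * (lt - l) / (q - INR k) < 0).
  { unfold Rdiv. assert (0 < / (q - INR k)) by (apply Rinv_0_lt_compat; lra).
    assert (Rpower l (kap - 1) * (lt - l) < 0) by nra. nra. }
  assert (Rpower l (kap - 1) * (lt - l) / (q - INR k) * (lamf r - lamf r0) < 0) by nra.
  lra.
Qed.

Lemma lamf_incr (a b : R) : 0 < a <= b -> 0 < z b -> (forall s, a < s < b -> yr s <= alpha) -> lamf a <= lamf b.
Proof.
  intros Hab Hz Hy.
  assert (HzR : forall s, a <= s <= b -> 0 < z s) by (intros s Hs; apply (z_pos_before s b); [lra|exact Hz]).
  apply (mono_of_deriv lamf (fun r => lamf r * ((q - INR k) * (alpha - yr r) / r))); [lra| | |].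
  - intros s Hs. apply lamf_cont; [lra|apply HzR, Hs].
  - intros s Hs. apply lamf_deriv; [lra|apply HzR; lra].
  - intros s Hs. apply Rmult_le_pos; [left; apply lamf_pos; lra|].
    apply Rmult_le_pos; [apply Rmult_le_pos; [lra|]|left; apply Rinv_0_lt_compat; lra].
    assert (h := Hy s Hs). lra.
Qed.

Lemma lamf_decr (a b : R) : 0 < a <= b -> 0 < z b -> (forall s, a < s < b -> alpha <= yr s) -> lamf b <= lamf a.
Proof.
  intros Hab Hz Hy.
  assert (HzR : forall s, a <= s <= b -> 0 < z s) by (intros s Hs; apply (z_pos_before s b); [lra|exact Hz]).
  apply Ropp_le_cancel.
  apply (mono_of_deriv (fun r => - lamf r) (fun r => - (lamf r * ((q - INR k) * (alpha - yr r) / r)))); [lra| | |].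
  - intros s Hs. apply continuity_pt_opp, lamf_cont; [lra|apply HzR, Hs].
  - intros s Hs. apply derivable_pt_lim_opp, lamf_deriv; [lra|apply HzR; lra].
  - intros s Hs. assert (h := Hy s Hs). assert (h0 := lamf_pos s ltac:(lra)).
    replace (- (lamf s * ((q - INR k) * (alpha - yr s) / s))) with (lamf s * ((q - INR k) * (yr s - alpha) * / s))
      by (unfold Rdiv; ring).
    apply Rmult_le_pos; [lra|]. apply Rmult_le_pos; [apply Rmult_le_pos; lra|left; apply Rinv_0_lt_compat; lra].
Qed.

(** The Pohozaev bound makes the bracket at least [2 - (q - k) y / (k + 1)], and for [y <= alpha]
    this is at least [2 - 2 k / (k + 1) > 0]. *)
Lemma subcritical_y_incr : (q + 1) * (INR n - 2 * INR k) <= INR n * (INR k + 1) ->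
  forall r, 0 < r -> 0 < z r -> yr r <= alpha -> 0 < yr r * (((xr r - INR n) / INR k + 2 + yr r) / r).
Proof.
  intros Hsub r Hr Hz Hy. assert (h := pohozaev_subcritical Hsub r Hr Hz).
  apply Rmult_lt_0_compat; [apply yr_pos; assumption|]. apply Rdiv_lt_0_compat; [|exact Hr].
  assert (hy := yr_pos r Hr Hz).
  assert (h1 : - ((q + 1) / (INR k + 1) * yr r) <= (xr r - INR n) / INR k).
  { apply Rmult_le_reg_r with (INR k); [lra|].
    replace ((xr r - INR n) / INR k * INR k) with (xr r - INR n) by (field; lra).
    replace (- ((q + 1) / (INR k + 1) * yr r) * INR k) with (- (INR k * (q + 1) / (INR k + 1) * yr r)) by (field; lra). lra. }
  assert (h2 : (q + 1) / (INR k + 1) * yr r - yr r <= 2 * INR k / (INR k + 1)).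
  { replace ((q + 1) / (INR k + 1) * yr r - yr r) with ((q - INR k) * yr r / (INR k + 1)) by (field; lra).
    apply Rmult_le_compat_r; [left; apply Rinv_0_lt_compat; lra|]. rewrite <- alpha_eq.
    apply Rmult_le_compat_l; lra. }
  assert (h3 : 2 * INR k / (INR k + 1) < 2).
  { apply Rmult_lt_reg_r with (INR k + 1); [lra|].
    replace (2 * INR k / (INR k + 1) * (INR k + 1)) with (2 * INR k) by (field; lra). lra. }
  lra.
Qed.

Lemma critical_exponent_alpha : INR n * (INR k + 1) < (q + 1) * (INR n - 2 * INR k) -> (q + 1) * alpha < INR n.
Proof.
  intros H. apply Rmult_lt_reg_r with (q - INR k); [lra|].
  replace ((q + 1) * alpha * (q - INR k)) with ((q + 1) * (2 * INR k)) by (rewrite <- alpha_eq; ring). nra.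
Qed.

Lemma max_at_crossing (r1 : R) : 0 < r1 -> 0 < z r1 -> alpha <= yr r1 ->
  exists r0, 0 < r0 /\ 0 < z r0 /\ yr r0 = alpha /\ forall r, 0 < r -> 0 < z r -> lamf r <= lamf r0.
Proof.
  intros Hr1 Hz1 Hy1.
  assert (Ha := alpha_pos).
  destruct (first_crossing (fun r => yr r - alpha) 0 r1) as [r0 [Hr0 [Hy0 Hlt]]]; [lra| | | |].
  - intros s Hs. apply (continuity_pt_minus yr (fun _ => alpha)).
    + apply yr_cont; [lra|apply (z_pos_before s r1); assumption].
    + apply continuity_pt_const. intros a b; reflexivity.
  - unfold yr. rewrite pow_i by lia. unfold Rdiv. lra.
  - lra.
  - assert (Hz0 : 0 < z r0) by (apply (z_pos_before r0 r1); [lra|exact Hz1]).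
    assert (Hy : yr r0 = alpha) by lra.
    exists r0. split; [lra|]. split; [exact Hz0|]. split; [exact Hy|].
    intros r Hr Hz. destruct (Rle_dec r r0) as [h|h].
    { apply lamf_incr; [lra|exact Hz0|]. intros s Hs. assert (h0 := Hlt s ltac:(lra)). lra. }
    destruct (Rle_dec ((q + 1) * (INR n - 2 * INR k)) (INR n * (INR k + 1))) as [Hsub|Hsup].
    (* [y] increases wherever it is below [alpha], so after [r0] it stays at or above [alpha] and
       [lamf] decreases. *)
    + apply lamf_decr; [lra|exact Hz|]. intros s Hs.
      assert (HzS : forall t, r0 <= t <= s -> 0 < z t) by (intros t Ht; apply (z_pos_before t r); [lra|exact Hz]).
      assert (hb := barrier (fun r => yr r - alpha)
        (fun r => yr r * (((xr r - INR n) / INR k + 2 + yr r) / r)) r0 s ltac:(lra)).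
      enough (0 <= yr s - alpha) by lra. apply hb.
      * intros t Ht. apply (continuity_pt_minus yr (fun _ => alpha)); [apply yr_cont; [lra|apply HzS, Ht]|].
        apply continuity_pt_const. intros a b; reflexivity.
      * lra.
      * intros t Ht. rewrite <- (Rminus_0_r (yr t * _)).
        apply (derivable_pt_lim_minus yr (fun _ => alpha)); [apply yr_deriv; [lra|apply HzS; lra]|].
        apply derivable_pt_lim_const.
      * intros t Ht hneg. apply subcritical_y_incr; [exact Hsub|lra|apply HzS; lra|lra].
    + apply lyapunov_supercritical; auto; [|lra|].
      * left. apply critical_exponent_alpha. lra.
      * rewrite lamf_xy, Hy by (auto; lra).
        apply Rmult_le_compat_r; [apply pow_le; lra|]. apply Rmult_le_compat_l; [lra|].
        (* [y' >= 0] at the first crossing *)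
        apply Rnot_lt_le. intros hx.
        assert (hd := yr_deriv r0 ltac:(lra) Hz0).
        set (l := yr r0 * (((xr r0 - INR n) / INR k + 2 + yr r0) / r0)) in *.
        assert (hl : l < 0).
        { unfold l. rewrite Hy. unfold Rdiv at 1.
          assert (h1 : (xr r0 - INR n) / INR k + 2 + alpha < 0).
          { apply Rmult_lt_reg_r with (INR k); [lra|].
            replace (((xr r0 - INR n) / INR k + 2 + alpha) * INR k) with (xr r0 - INR n + 2 * INR k + INR k * alpha) by (field; lra).
            unfold xbar in hx. assert (ha := alpha_eq). lra. }
          assert (0 < / r0) by (apply Rinv_0_lt_compat; lra).
          assert (((xr r0 - INR n) / INR k + 2 + alpha) * / r0 < 0) by nra. nra. }
        destruct (hd (- l) ltac:(lra)) as [[d Hd] H]. cbn in H.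
        set (t := Rmin (d / 2) (r0 / 2)).
        assert (Ht : 0 < t /\ t <= d / 2 /\ t <= r0 / 2).
        { unfold t. split; [apply Rmin_pos; lra|split; [apply Rmin_l|apply Rmin_r]]. }
        assert (h1 := H (- t) ltac:(lra) ltac:(rewrite Rabs_Ropp, Rabs_right; lra)).
        apply Rabs_def2 in h1.
        assert (h2 := Hlt (r0 + - t) ltac:(lra)). cbv beta in h2.
        assert (h3 : 0 < (yr (r0 + - t) - yr r0) / - t).
        { rewrite Hy. replace ((yr (r0 + - t) - alpha) / - t) with ((alpha - yr (r0 + - t)) / t) by (field; lra).
          apply Rdiv_lt_0_compat; lra. }
        lra.
Qed.

(** While [y < alpha], the product [lamf = r^(2k) z^(q-k)] increases, which bounds [z] from below up
    to a supposed first zero. *)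
Lemma z_pos_of_y_small : (forall r, 0 < r -> 0 < z r -> yr r < alpha) -> forall r, 0 <= r -> 0 < z r.
Proof.
  intros Hy r Hr. destruct (Rlt_dec 0 (z r)) as [h|h]; [exact h|exfalso].
  destruct (first_crossing (fun s => - z s) 0 r Hr) as [r0 [Hr0 [Hz0 Hlt]]].
  - intros s Hs. apply continuity_pt_opp, z_cont. lra.
  - rewrite z_0. lra.
  - lra.
  - set (a := r0 / 2).
    assert (Hza : 0 < z a) by (assert (h0 := Hlt a ltac:(unfold a; lra)); cbv beta in h0; lra).
    (* The inequality [lamf a <= lamf s] solved for [ln (z s)], with s replaced by its upper bound
       [r0]. *)
    set (l := (ln (lamf a) - 2 * INR k * ln r0) / (q - INR k)).
    assert (Hlow : forall s, a <= s < r0 -> exp l <= z s).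
    { intros s Hs. assert (Hzs : 0 < z s) by (assert (h0 := Hlt s ltac:(unfold a in *; lra)); cbv beta in h0; lra).
      rewrite <- (exp_ln (z s)) by exact Hzs. apply exp_mono.
      assert (h1 : lamf a <= lamf s).
      { apply lamf_incr; [unfold a in *; lra|exact Hzs|]. intros t Ht. left. apply Hy; [unfold a in *; lra|].
        apply (z_pos_before t s); [unfold a in *; lra|exact Hzs]. }
      assert (h2 : ln (lamf a) <= ln (lamf s)).
      { apply ln_le; [apply lamf_pos; unfold a; lra|exact h1]. }
      rewrite (ln_lamf s) in h2 by (unfold a in *; lra).
      assert (h3 : ln s <= ln r0) by (apply ln_le; unfold a in *; lra).
      unfold l. apply Rmult_le_reg_r with (q - INR k); [lra|].
      replace ((ln (lamf a) - 2 * INR k * ln r0) / (q - INR k) * (q - INR k)) with (ln (lamf a) - 2 * INR k * ln r0) by (field; lra).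
      assert (2 * INR k * ln s <= 2 * INR k * ln r0) by (apply Rmult_le_compat_l; lra). lra. }
    assert (He := exp_pos l).
    destruct (continuity_pt_eps z r0 (exp l) (z_cont r0 ltac:(lra)) He) as [d [Hd H]].
    set (s := Rmax a (r0 - d / 2)).
    assert (Hs : a <= s /\ s < r0 /\ r0 - d / 2 <= s).
    { unfold s. split; [apply Rmax_l|split; [apply Rmax_lub_lt; unfold a; lra|apply Rmax_r]]. }
    assert (h1 := H s ltac:(apply Rabs_def1; lra)). assert (h2 := Hlow s ltac:(lra)).
    apply Rabs_def2 in h1. lra.
Qed.

(* [ln (x y^k)] and [ln (x y^q)] are nondecreasing and bounded, so [x] and [y] converge, and their
   limits are the zeros of the two derivatives. *)
Lemma limit_without_crossing : (forall r, 0 < r -> 0 < z r -> yr r < alpha) ->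
  0 < xbar /\ (q + 1) * alpha < INR n /\
  forall t, is_lub (fun l => exists r, 0 < r /\ l = lamf r) t <-> t = c * xbar * alpha ^ k.
Proof.
  intros Hy0.
  assert (Hz : forall r, 0 <= r -> 0 < z r) by (apply z_pos_of_y_small, Hy0).
  assert (Hy : forall r, 0 < r -> 0 < yr r < alpha) by (intros r Hr; split; [apply yr_pos|apply Hy0]; auto; apply Hz; lra).
  assert (Ha := alpha_pos). assert (Hae := alpha_eq).
  assert (Hxn : forall r, 0 < r -> 0 < xr r <= INR n) by (intros r Hr; split; [apply xr_pos, Hz; lra|apply xr_le; lra]).
  (* Where [x < xbar], the bound [y < alpha] gives [n - x - q y > 0], so [x] increases; and it
     starts from n, above [xbar]. *)
  assert (Hxb : forall r, 0 < r -> xbar <= xr r).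
  { intros r Hr.
    assert (hb := barrier (fun r => xr r - xbar) (fun r => xr r * ((INR n - xr r - q * yr r) / r)) 0 r ltac:(lra)).
    enough (0 <= xr r - xbar) by lra. apply hb.
    - intros s Hs. apply (continuity_pt_minus xr (fun _ => xbar)); [apply xr_cont; [lra|apply Hz; lra]|].
      apply continuity_pt_const. intros a b; reflexivity.
    - rewrite xr_0. unfold xbar. assert (0 < q * alpha) by (apply Rmult_lt_0_compat; lra). lra.
    - intros s Hs. rewrite <- (Rminus_0_r (xr s * _)).
      apply (derivable_pt_lim_minus xr (fun _ => xbar)); [apply xr_deriv; [lra|apply Hz; lra]|apply derivable_pt_lim_const].
    - intros s Hs hneg. assert (h1 := Hy s ltac:(lra)). assert (h2 := Hxn s ltac:(lra)).
      apply Rmult_lt_0_compat; [lra|]. apply Rdiv_lt_0_compat; [|lra]. unfold xbar in hneg.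
      assert (q * yr s < q * alpha) by (apply Rmult_lt_compat_l; lra). lra. }
  (* The weight k of [ln y] removes [x] from the derivative of [G1], and the weight q removes [y]
     from that of [G2]; each derivative then has a sign. *)
  set (G1 := fun r => ln (lamf r)). set (G2 := fun r => ln (xr r) + q * ln (yr r)).
  assert (HG1d : forall r, 0 < r -> derivable_pt_lim G1 r ((q - INR k) * (alpha - yr r) / r)).
  { intros r Hr. apply lnlam_deriv; [exact Hr|apply Hz; lra]. }
  assert (HG2d : forall r, 0 < r -> derivable_pt_lim G2 r ((q - INR k) / INR k * (xr r - xbar) / r)).
  { intros r Hr. replace ((q - INR k) / INR k * (xr r - xbar) / r) with
      ((INR n - xr r - q * yr r) / r + q * (((xr r - INR n) / INR k + 2 + yr r) / r)).
    - apply derivable_pt_lim_plus; [apply lnx_deriv; [exact Hr|apply Hz; lra]|].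
      apply (derivable_pt_lim_scal (fun r => ln (yr r))), lny_deriv; [exact Hr|apply Hz; lra].
    - unfold xbar. replace (q * alpha) with (2 * INR k + INR k * alpha) by lra.
      apply Rmult_eq_reg_r with (INR k * r); [|apply Rgt_not_eq, Rmult_lt_0_compat; lra].
      unfold alpha. field. repeat split; lra. }
  assert (Hlny : forall r, 0 < r -> ln (yr r) < ln alpha) by (intros r Hr; apply ln_increasing; apply Hy, Hr).
  assert (Hlnx : forall r, 0 < r -> ln (xr r) <= ln (INR n)) by (intros r Hr; apply ln_le; apply Hxn, Hr).
  assert (HG1e : forall r, 0 < r -> G1 r = ln c + ln (xr r) + INR k * ln (yr r)).
  { intros r Hr. unfold G1. rewrite lamf_xy by (auto; apply Hz; lra).
    assert (h1 := Hy r Hr). assert (h2 := Hxn r Hr).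
    rewrite ln_mult, ln_mult; try lra.
    - rewrite <- Rpower_pow by lra. unfold Rpower. rewrite ln_exp. reflexivity.
    - apply Rmult_lt_0_compat; lra.
    - apply pow_lt; lra. }
  assert (HG1m : forall r s, 1 <= r <= s -> G1 r <= G1 s).
  { intros r s Hrs. apply (mono_of_deriv G1 (fun r => (q - INR k) * (alpha - yr r) / r)); [lra| | |].
    - intros t Ht. apply derivable_continuous_pt. eexists. apply HG1d. lra.
    - intros t Ht. apply HG1d. lra.
    - intros t Ht. assert (h := Hy t ltac:(lra)). apply Rmult_le_pos; [apply Rmult_le_pos; lra|left; apply Rinv_0_lt_compat; lra]. }
  assert (Hqk : 0 < (q - INR k) / INR k) by (apply Rdiv_lt_0_compat; lra).
  assert (HG2m : forall r s, 1 <= r <= s -> G2 r <= G2 s).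
  { intros r s Hrs. apply (mono_of_deriv G2 (fun r => (q - INR k) / INR k * (xr r - xbar) / r)); [lra| | |].
    - intros t Ht. apply derivable_continuous_pt. eexists. apply HG2d. lra.
    - intros t Ht. apply HG2d. lra.
    - intros t Ht. assert (h := Hxb t ltac:(lra)). apply Rmult_le_pos; [apply Rmult_le_pos; lra|left; apply Rinv_0_lt_compat; lra]. }
  set (M1 := ln c + ln (INR n) + INR k * ln alpha). set (M2 := ln (INR n) + q * ln alpha).
  assert (HG1b : forall r, 1 <= r -> G1 r <= M1).
  { intros r Hr. rewrite HG1e by lra. unfold M1. assert (h1 := Hlnx r ltac:(lra)). assert (h2 := Hlny r ltac:(lra)).
    assert (INR k * ln (yr r) <= INR k * ln alpha) by (apply Rmult_le_compat_l; lra). lra. }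
  assert (HG2b : forall r, 1 <= r -> G2 r <= M2).
  { intros r Hr. unfold G2, M2. assert (h1 := Hlnx r ltac:(lra)). assert (h2 := Hlny r ltac:(lra)).
    assert (q * ln (yr r) <= q * ln alpha) by (apply Rmult_le_compat_l; lra). lra. }
  destruct (mono_limit G1 1 M1 HG1m HG1b) as [l1 [Hl1 Hl1']].
  destruct (mono_limit G2 1 M2 HG2m HG2b) as [l2 [Hl2 Hl2']].
  (* [G2 - G1 = (q - k) ln y - ln c], so the two limits determine that of [ln y], and then that of
     [ln x]. *)
  set (ly := (l2 - l1 + ln c) / (q - INR k)).
  assert (Hlye : forall r, 0 < r -> ln (yr r) = (G2 r - G1 r + ln c) / (q - INR k)).
  { intros r Hr. rewrite HG1e by exact Hr. unfold G2. field. lra. }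
  assert (HlimY : forall e, 0 < e -> exists R0, 1 <= R0 /\ forall r, R0 <= r -> Rabs (ln (yr r) - ly) < e).
  { intros e He. destruct (Hl1' (e * (q - INR k)) ltac:(apply Rmult_lt_0_compat; lra)) as [R1 [HR1 H1]].
    destruct (Hl2' (e * (q - INR k)) ltac:(apply Rmult_lt_0_compat; lra)) as [R2 [HR2 H2]].
    exists (Rmax R1 R2). split; [apply Rle_trans with (1 := HR1), Rmax_l|]. intros r Hr.
    assert (Hr1 : R1 <= r) by (apply Rle_trans with (2 := Hr), Rmax_l).
    assert (Hr2 : R2 <= r) by (apply Rle_trans with (2 := Hr), Rmax_r).
    assert (a1 := H1 r Hr1). assert (a2 := H2 r Hr2). assert (b1 := Hl1 r ltac:(lra)). assert (b2 := Hl2 r ltac:(lra)).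
    rewrite Hlye by lra. unfold ly.
    replace ((G2 r - G1 r + ln c) / (q - INR k) - (l2 - l1 + ln c) / (q - INR k)) with (((l1 - G1 r) - (l2 - G2 r)) / (q - INR k)) by (field; lra).
    unfold Rdiv. rewrite Rabs_mult, (Rabs_right (/ (q - INR k))) by (left; apply Rinv_0_lt_compat; lra).
    apply Rmult_lt_reg_r with (q - INR k); [lra|]. rewrite Rmult_assoc, Rinv_l, Rmult_1_r by lra.
    apply Rabs_def1; lra. }
  set (lx := l1 - ln c - INR k * ly).
  assert (HlimX : forall e, 0 < e -> exists R0, 1 <= R0 /\ forall r, R0 <= r -> Rabs (ln (xr r) - lx) < e).
  { intros e He. destruct (Hl1' (e / 2) ltac:(lra)) as [R1 [HR1 H1]].
    destruct (HlimY (e / 2 / INR k) ltac:(apply Rdiv_lt_0_compat; lra)) as [R2 [HR2 H2]].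
    exists (Rmax R1 R2). split; [apply Rle_trans with (1 := HR1), Rmax_l|]. intros r Hr.
    assert (Hr1 : R1 <= r) by (apply Rle_trans with (2 := Hr), Rmax_l).
    assert (Hr2 : R2 <= r) by (apply Rle_trans with (2 := Hr), Rmax_r).
    assert (a1 := H1 r Hr1). assert (b1 := Hl1 r ltac:(lra)). assert (a2 := H2 r Hr2).
    assert (a3 : INR k * Rabs (ln (yr r) - ly) < e / 2).
    { apply Rmult_lt_reg_r with (/ INR k); [apply Rinv_0_lt_compat; lra|].
      replace (INR k * Rabs (ln (yr r) - ly) * / INR k) with (Rabs (ln (yr r) - ly)) by (field; lra). exact a2. }
    assert (a4 := HG1e r ltac:(lra)). unfold lx.
    assert (a5 : Rabs (INR k * (ln (yr r) - ly)) < e / 2) by (rewrite Rabs_mult, (Rabs_right (INR k)) by lra; exact a3).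
    apply Rabs_def2 in a5. apply Rabs_def1; lra. }
  (* If [y] stayed below some [b < alpha], then [G1] would grow like [ln r]. The same argument with
     [G2] settles the limit of [x]. *)
  assert (Hly : ly = ln alpha).
  { destruct (Rtotal_order ly (ln alpha)) as [h|[h|h]]; [exfalso|exact h|exfalso].
    - destruct (HlimY ((ln alpha - ly) / 2) ltac:(lra)) as [R0 [HR0 H]].
      set (b := exp ((ln alpha + ly) / 2)).
      assert (Hb : b < alpha) by (unfold b; rewrite <- (exp_ln alpha) at 2 by exact Ha; apply exp_increasing; lra).
      apply (log_growth_unbounded G1 (fun r => (q - INR k) * (alpha - yr r)) R0 ((q - INR k) * (alpha - b)) M1);
        [lra|apply Rmult_lt_0_compat; lra|intros; apply HG1d; lra| |intros; apply HG1b; lra].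
      intros r Hr. apply Rmult_le_compat_l; [lra|].
      assert (h1 := H r Hr). apply Rabs_def2 in h1.
      assert (yr r <= b); [|lra]. unfold b. rewrite <- (exp_ln (yr r)) by (apply Hy; lra). apply exp_mono. lra.
    - destruct (HlimY (ly - ln alpha) ltac:(lra)) as [R0 [HR0 H]].
      assert (h1 := H R0 ltac:(lra)). assert (h2 := Hlny R0 ltac:(lra)). apply Rabs_def2 in h1. lra. }
  assert (Hlx : xbar = exp lx).
  { destruct (Rtotal_order xbar (exp lx)) as [h|[h|h]]; [exfalso|exact h|exfalso].
    - set (b := (xbar + exp lx) / 2).
      assert (Hbp : 0 < exp lx) by apply exp_pos.
      destruct (Rle_dec b 0) as [hb|hb].
      + (* then [xbar < 0] and [x - xbar] is bounded below by [- xbar] *)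
        apply (log_growth_unbounded G2 (fun r => (q - INR k) / INR k * (xr r - xbar)) 1 ((q - INR k) / INR k * (- xbar)) M2);
          [lra|apply Rmult_lt_0_compat; [lra|unfold b in hb; lra]|intros; apply HG2d; lra| |intros; apply HG2b; lra].
        intros r Hr. apply Rmult_le_compat_l; [lra|]. assert (h1 := Hxn r ltac:(lra)). lra.
      + assert (Hbl : ln b < lx) by (rewrite <- (ln_exp lx); apply ln_increasing; unfold b in *; lra).
        destruct (HlimX (lx - ln b) ltac:(lra)) as [R0 [HR0 H]].
        apply (log_growth_unbounded G2 (fun r => (q - INR k) / INR k * (xr r - xbar)) R0 ((q - INR k) / INR k * (b - xbar)) M2);
          [lra|apply Rmult_lt_0_compat; [lra|unfold b; lra]|intros; apply HG2d; lra| |intros; apply HG2b; lra].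
        intros r Hr. apply Rmult_le_compat_l; [lra|]. assert (h1 := H r Hr). apply Rabs_def2 in h1.
        assert (b <= xr r); [|lra].
        rewrite <- (exp_ln b), <- (exp_ln (xr r)) by (try lra; apply Hxn; lra). apply exp_mono. lra.
    - assert (Hlt : lx < ln xbar) by (rewrite <- (ln_exp lx); apply ln_increasing; [apply exp_pos|exact h]).
      destruct (HlimX (ln xbar - lx) ltac:(lra)) as [R0 [HR0 H]].
      assert (h1 := H R0 ltac:(lra)). apply Rabs_def2 in h1.
      assert (h2 : ln xbar <= ln (xr R0)).
      { apply ln_le; [apply Rlt_trans with (2 := h), exp_pos|apply Hxb; lra]. }
      lra. }
  assert (Hxpos : 0 < xbar) by (rewrite Hlx; apply exp_pos).
  split; [exact Hxpos|]. split.
  (* In the limit [pohozaev_subcritical] would read [n - A alpha <= xbar = n - q alpha], which is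
     impossible because [A < q]. *)
  - destruct (Rle_dec ((q + 1) * (INR n - 2 * INR k)) (INR n * (INR k + 1))) as [Hsub|Hsup];
      [exfalso|apply critical_exponent_alpha; lra].
    set (A := INR k * (q + 1) / (INR k + 1)).
    assert (HA : 0 < A) by (apply Rdiv_lt_0_compat; [apply Rmult_lt_0_compat|]; lra).
    assert (HAq : A < q).
    { unfold A. apply Rmult_lt_reg_r with (INR k + 1); [lra|].
      replace (INR k * (q + 1) / (INR k + 1) * (INR k + 1)) with (INR k * (q + 1)) by (field; lra). lra. }
    set (gap := (q - A) * alpha).
    assert (Hgap : 0 < gap) by (apply Rmult_lt_0_compat; lra).
    assert (Hl : lx < ln (xbar + gap)) by (rewrite <- (ln_exp lx), <- Hlx; apply ln_increasing; lra).
    destruct (HlimX (ln (xbar + gap) - lx) ltac:(lra)) as [R0 [HR0 H]].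
    assert (h1 := H R0 ltac:(lra)). apply Rabs_def2 in h1.
    assert (h2 := pohozaev_subcritical Hsub R0 ltac:(lra) (Hz R0 ltac:(lra))). fold A in h2.
    assert (h3 := Hy R0 ltac:(lra)).
    assert (h4 : xr R0 < xbar + gap).
    { apply ln_lt_inv; [apply Hxn; lra|lra|lra]. }
    assert (A * yr R0 <= A * alpha) by (apply Rmult_le_compat_l; lra).
    unfold gap, xbar in h4. lra.
  - assert (Hl1e : exp l1 = c * xbar * alpha ^ k).
    { replace l1 with (ln c + lx + INR k * ly) by (unfold lx; ring).
      rewrite !exp_plus, exp_ln, <- Hlx, Hly by exact Hc. f_equal.
      rewrite <- Rpower_pow by exact Ha. reflexivity. }
    assert (Hmain : is_lub (fun l => exists r, 0 < r /\ l = lamf r) (exp l1)).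
    { split.
      - intros l [r [Hr ->]]. rewrite <- (exp_ln (lamf r)) by (apply lamf_pos, Hr). apply exp_mono.
        destruct (Rle_dec 1 r) as [h|h]; [apply Hl1, h|].
        apply Rle_trans with (G1 1); [|apply Hl1; lra]. unfold G1. apply ln_le; [apply lamf_pos, Hr|].
        apply lamf_incr; [lra|apply Hz; lra|]. intros s Hs. left. apply Hy. lra.
      - intros b Hb. assert (Hbp : 0 < b).
        { apply Rlt_le_trans with (lamf 1); [apply lamf_pos; lra|apply Hb; exists 1; split; [lra|reflexivity]]. }
        apply Rnot_lt_le. intros h.
        assert (hl : ln b < l1) by (rewrite <- (ln_exp l1); apply ln_increasing; assumption).
        destruct (Hl1' (l1 - ln b) ltac:(lra)) as [R0 [HR0 H]].
        assert (h1 := H R0 ltac:(lra)).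
        assert (h2 : lamf R0 <= b) by (apply Hb; exists R0; split; [lra|reflexivity]).
        assert (h3 : ln (lamf R0) <= ln b) by (apply ln_le; [apply lamf_pos; lra|exact h2]).
        fold (G1 R0) in h3. lra. }
    rewrite Hl1e in Hmain. intros t. split; [|intros ->; exact Hmain].
    intros [h1 h2]. destruct Hmain as [h3 h4]. apply Rle_antisym; auto.
Qed.

Theorem profile_dichotomy : exists lstar, 0 < lstar /\
  is_lub (fun l => exists r, 0 < r /\ 0 < z r /\ l = lamf r) lstar /\
  ((exists r0, 0 < r0 /\ 0 < z r0 /\ lamf r0 = lstar) \/
   (0 < xbar /\ (q + 1) * alpha < INR n /\ lstar = c * xbar * alpha ^ k)).
Proof.
  destruct (classic (exists r, 0 < r /\ 0 < z r /\ alpha <= yr r)) as [[r1 [H1 [H2 H3]]]|Hno].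
  - destruct (max_at_crossing r1 H1 H2 H3) as [r0 [Hr0 [Hz0 [_ Hmax]]]].
    exists (lamf r0). split; [apply lamf_pos, Hr0|]. split; [split|left; exists r0; auto].
    + intros l [r [Hr [Hz ->]]]. auto.
    + intros b Hb. apply Hb. exists r0. auto.
  - assert (Hy : forall r, 0 < r -> 0 < z r -> yr r < alpha).
    { intros r Hr Hz. apply Rnot_le_lt. intros h. apply Hno. exists r. auto. }
    destruct (limit_without_crossing Hy) as [h1 [h2 h3]].
    assert (Hz := z_pos_of_y_small Hy).
    exists (c * xbar * alpha ^ k). split; [|split; [|right; auto]].
    + repeat apply Rmult_lt_0_compat; auto. apply pow_lt, alpha_pos.
    + destruct (proj2 (h3 _) eq_refl) as [a1 a2]. split.
      * intros l [r [Hr [_ ->]]]. apply a1. exists r. auto.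
      * intros b Hb. apply a2. intros l [r [Hr ->]]. apply Hb. exists r. repeat split; auto. apply Hz. lra.
Qed.

(** * Scaled profiles and comparison along the branch *)

Hypothesis (Hcnk : c = cnk n k).

Lemma s_m1 (s : R) : 0 <= s -> s * m1 s = m s * (xr s - INR n) / INR k.
Proof.
  intros Hs. destruct (Req_dec s 0) as [->|hn].
  - rewrite xr_0. unfold Rdiv. ring.
  - unfold m1. field. lra.
Qed.

(** The value B = 0 is included because the continuation starts there; then [m (B r)] is the
    constant [m 0], and the identity is [n c (m 0)^k = 1]. *)
Lemma scaled_mass_deriv (B r : R) : 0 <= B -> 0 < r ->
  derivable_pt_lim (fun r => r ^ n * m (B * r) ^ k) r (r ^ (n - 1) * ppow q (z (B * r)) / c).
Proof.
  intros HB Hr. destruct (Req_dec B 0) as [->|hB].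
  - apply derivable_pt_lim_ext with (fun r => m 0 ^ k * r ^ n).
    { intros s. rewrite Rmult_0_l. ring. }
    rewrite Rmult_0_l, z_0, ppow_1.
    assert (h : INR n * c * m 0 ^ k = 1) by apply HP.
    replace (r ^ (n - 1) * 1 / c) with (m 0 ^ k * (INR n * r ^ pred n)).
    + apply (derivable_pt_lim_scal (fun r => r ^ n)), derivable_pt_lim_pow.
    + replace (pred n) with (n - 1)%nat by lia.
      replace (r ^ (n - 1) * 1 / c) with (r ^ (n - 1) * (INR n * c * m 0 ^ k) / c) by (rewrite h; reflexivity).
      field. lra.
  - assert (HBp : 0 < B) by lra.
    assert (HBn : B ^ n <> 0) by (apply pow_nonzero; lra).
    apply derivable_pt_lim_ext with (fun r => / (c * B ^ n) * (c * (r * B) ^ n * m (r * B) ^ k)).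
    { intros s. rewrite Rpow_mult_distr, (Rmult_comm s B). field. split; [exact HBn|lra]. }
    replace (r ^ (n - 1) * ppow q (z (B * r)) / c) with
      (/ (c * B ^ n) * ((r * B) ^ (n - 1) * ppow q (z (r * B)) * B)).
    + apply (derivable_pt_lim_scal (fun r => c * (r * B) ^ n * m (r * B) ^ k)).
      apply (derivable_pt_lim_comp (fun r => r * B) (fun s => c * s ^ n * m s ^ k)).
      * apply is_derive_Reals. auto_derive; [exact I|ring].
      * apply HP, Rmult_lt_0_compat; assumption.
    + rewrite Rpow_mult_distr, (Rmult_comm r B).
      replace (B ^ n) with (B * B ^ (n - 1)) by (replace n with (S (n - 1)) at 2 by lia; reflexivity).
      field. repeat split; first [lra|apply pow_nonzero; lra].
Qed.

Lemma scaled_pos (B r : R) : 0 <= B -> 0 < z B -> 0 <= r <= 1 -> 0 < z (B * r).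
Proof. intros HB Hz Hr. apply (z_pos_before (B * r) B); [|exact Hz]. split; nra. Qed.

Lemma scaled_m_cont (B r : R) : continuity_pt (fun r => m (B * r)) r.
Proof.
  apply (continuity_pt_comp (fun r => B * r) m); [|apply HP].
  apply (continuity_pt_scal (fun r => r)), continuity_pt_id.
Qed.

Lemma scaled_m_deriv (B r : R) : 0 <= B -> 0 < r -> derivable_pt_lim (fun r => m (B * r)) r (B * m1 (B * r)).
Proof.
  intros HB Hr. destruct (Req_dec B 0) as [->|hB].
  - apply derivable_pt_lim_ext with (fun _ => m 0); [intros s; rewrite Rmult_0_l; reflexivity|].
    rewrite Rmult_0_l. apply derivable_pt_lim_const.
  - rewrite Rmult_comm. apply (derivable_pt_lim_comp (fun r => B * r) m).
    + apply is_derive_Reals. auto_derive; [exact I|ring].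
    + apply m_deriv. apply Rmult_lt_0_compat; lra.
Qed.

(** Serves both [comparison_fn t B] and [sol B], whose derivatives have this common form. *)
Lemma scaled_radial_C2B (t B : R) (J : R -> R) : 0 <= B -> 0 < z B ->
  (forall r, 0 <= r -> derivable_pt_lim J r (t * (r * m (B * r)))) ->
  C2B n (fun x => J (normn n x)) (fun i x => t * m (B * normn n x) * x i)
    (radial_hessian n (fun r => t * m (B * r)) (fun r => t * (B * m1 (B * r)))).
Proof.
  intros HB Hz HJ. apply (radial_C2B n J (fun r => t * m (B * r)) (fun r => t * (B * m1 (B * r)))).
  - intros r Hr. replace (r * (t * m (B * r))) with (t * (r * m (B * r))) by ring. apply HJ. lra.
  - intros r Hr. apply (continuity_pt_scal (fun r => m (B * r))), scaled_m_cont.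
  - intros r Hr. apply (derivable_pt_lim_scal (fun r => m (B * r))), scaled_m_deriv; lra.
  - intros r Hr. apply (continuity_pt_scal (fun r => B * m1 (B * r))).
    destruct (Req_dec B 0) as [->|hB].
    + apply continuity_pt_ext with (fun _ => 0); [intros s; ring|].
      apply continuity_pt_const. intros a b; reflexivity.
    + apply (continuity_pt_scal (fun r => m1 (B * r))).
      apply (continuity_pt_comp (fun r => B * r) m1); [apply (continuity_pt_scal (fun r => r)), continuity_pt_id|].
      apply m1_cont; [apply Rmult_lt_0_compat; lra|apply scaled_pos; lra].
  - intros e He. destruct (Req_dec B 0) as [->|hB].
    + exists 1. split; [lra|]. intros r Hr. rewrite Rmult_0_l, !Rmult_0_r, Rabs_R0. exact He.
    + destruct (m1_origin (e / (Rabs t + 1))) as [d [Hd H]].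
      { apply Rdiv_lt_0_compat; [exact He|]. pose proof (Rabs_pos t). lra. }
      exists (d / B). split; [apply Rdiv_lt_0_compat; lra|]. intros r Hr.
      assert (h := H (B * r)).
      assert (HBr : 0 < B * r < d).
      { split; [apply Rmult_lt_0_compat; lra|].
        apply Rmult_lt_reg_r with (/ B); [apply Rinv_0_lt_compat; lra|].
        replace (B * r * / B) with r by (field; lra). apply Hr. }
      specialize (h HBr).
      replace (r * (t * (B * m1 (B * r)))) with (t * (B * r * m1 (B * r))) by ring.
      rewrite Rabs_mult. pose proof (Rabs_pos t). pose proof (Rabs_pos (B * r * m1 (B * r))).
      apply Rle_lt_trans with ((Rabs t + 1) * Rabs (B * r * m1 (B * r))); [nra|].
      apply Rmult_lt_reg_r with (/ (Rabs t + 1)); [apply Rinv_0_lt_compat; lra|].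
      replace ((Rabs t + 1) * Rabs (B * r * m1 (B * r)) * / (Rabs t + 1)) with (Rabs (B * r * m1 (B * r))) by (field; lra).
      exact h.
Qed.

Lemma fact_pred (p : nat) : (0 < p)%nat -> INR (fact p) = INR p * INR (fact (p - 1)).
Proof.
  intros Hp. destruct p as [|p]; [lia|]. rewrite fact_simpl, mult_INR. repeat f_equal. lia.
Qed.

(** The ratios of [C(n-1, k)] and [C(n-1, k-1)] to [C(n, k)] are [(n - k) / n] and [k / n], which
    brings out the constant [c = C(n, k) / n]. *)
Lemma esym_radial (a t : R) :
  esym ((a + t) :: repeat a (n - 1)) k = c * (INR n * a ^ k + INR k * a ^ (k - 1) * t).
Proof.
  rewrite Hcnk. unfold cnk.
  replace k with (S (k - 1)) at 1 by lia. rewrite esym_cons, !esym_repeat by lia.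
  replace (S (k - 1)) with k by lia.
  replace (a ^ k) with (a * a ^ (k - 1)) by (replace k with (S (k - 1)) at 2 by lia; reflexivity).
  assert (HC1 : C (n - 1) k = C n k * (INR n - INR k) / INR n).
  { unfold C. rewrite <- minus_INR, (fact_pred n), (fact_pred (n - k)) by lia.
    replace (n - k - 1)%nat with (n - 1 - k)%nat by lia.
    assert (INR (n - k) <> 0) by (apply not_0_INR; lia).
    field. repeat split; first [apply INR_fact_neq_0|assumption|lra]. }
  assert (HC2 : C (n - 1) (k - 1) = C n k * INR k / INR n).
  { unfold C. replace (n - 1 - (k - 1))%nat with (n - k)%nat by lia.
    rewrite (fact_pred n), (fact_pred k) by lia.
    field. repeat split; first [apply INR_fact_neq_0|lra]. }
  rewrite HC1, HC2. field. lra.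
Qed.

(** By [s_m1] the bracket of [esym_radial] becomes [(t m)^k (n + (x - n))], and [c m^k x = z^q]. *)
Lemma esym_radial_value (t B r : R) : 0 <= B -> 0 <= r ->
  esym ((t * m (B * r) + t * (B * m1 (B * r)) / r * r ^ 2) :: repeat (t * m (B * r)) (n - 1)) k
  = t ^ k * ppow q (z (B * r)).
Proof.
  intros HB Hr. set (s := B * r). assert (Hs : 0 <= s) by (apply Rmult_le_pos; assumption).
  replace (t * (B * m1 s) / r * r ^ 2) with (t * (s * m1 s)).
  2: { destruct (Req_dec r 0) as [->|hn]; [unfold s; rewrite Rmult_0_r; ring|unfold s; field; exact hn]. }
  rewrite s_m1 by exact Hs. rewrite esym_radial.
  assert (Hm := m_pos s). assert (Hmk : m s ^ k <> 0) by (apply pow_nonzero; lra).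
  replace ((t * m s) ^ k) with (t * m s * (t * m s) ^ (k - 1)) by (replace k with (S (k - 1)) at 2 by lia; reflexivity).
  replace (c * (INR n * (t * m s * (t * m s) ^ (k - 1)) + INR k * (t * m s) ^ (k - 1) * (t * (m s * (xr s - INR n) / INR k))))
    with (c * (t * m s * (t * m s) ^ (k - 1)) * xr s) by (field; lra).
  replace (t * m s * (t * m s) ^ (k - 1)) with ((t * m s) ^ k) by (replace k with (S (k - 1)) at 1 by lia; reflexivity).
  rewrite Rpow_mult_distr. unfold xr. field. split; [exact Hmk|lra].
Qed.

Definition sol (B r : R) : R := 1 - z (B * r) / z B.
Definition comparison_primitive (B r : R) : R := RInt (fun s => s * m (B * s)) 0 r.
(** Vanishes at r = 1 and has [S_k] equal to [t^k z(B r)^q]. For [t = B^2 / z B] it is [sol B]; with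
    t free the right-hand side can be increased at fixed B, even at B = 0, where [sol 0] is
    identically 0. *)
Definition comparison_fn (t B r : R) : R := t * (comparison_primitive B r - comparison_primitive B 1).

Lemma sol_deriv (B r : R) : 0 <= B -> 0 < z B -> 0 <= r ->
  derivable_pt_lim (sol B) r (B ^ 2 / z B * (r * m (B * r))).
Proof.
  intros HB Hz Hr.
  replace (B ^ 2 / z B * (r * m (B * r))) with (0 - / z B * (- (B * r * m (B * r)) * B)) by (field; lra).
  apply derivable_pt_lim_ext with (fun r => 1 - / z B * z (B * r)); [intros s; unfold sol, Rdiv; ring|].
  apply (derivable_pt_lim_minus (fun _ => 1)); [apply derivable_pt_lim_const|].
  apply (derivable_pt_lim_scal (fun r => z (B * r))).
  apply (derivable_pt_lim_comp (fun r => B * r) z).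
  - apply is_derive_Reals. auto_derive; [exact I|ring].
  - apply z_deriv, Rmult_le_pos; assumption.
Qed.

Lemma flat_deriv (B r : R) : derivable_pt_lim (comparison_primitive B) r (r * m (B * r)).
Proof.
  apply (RInt_deriv (fun s => s * m (B * s))). intros s.
  apply (continuity_pt_mult (fun s => s)); [apply continuity_pt_id|apply scaled_m_cont].
Qed.

Lemma test_deriv (t B r : R) : derivable_pt_lim (comparison_fn t B) r (t * (r * m (B * r))).
Proof.
  apply (derivable_pt_lim_scal (fun r => comparison_primitive B r - comparison_primitive B 1)).
  rewrite <- (Rminus_0_r (r * _)). apply (derivable_pt_lim_minus (comparison_primitive B) (fun _ => comparison_primitive B 1));
    [apply flat_deriv|apply derivable_pt_lim_const].
Qed.

Lemma test_1 (t B : R) : comparison_fn t B 1 = 0.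
Proof. unfold comparison_fn. ring. Qed.

Lemma sol_1 (B : R) : 0 < z B -> sol B 1 = 0.
Proof. intros Hz. unfold sol. rewrite Rmult_1_r. field. lra. Qed.

(** Both functions vanish at r = 1, and their slopes are ordered because [m] decreases. *)
Lemma test_le_sol (t B B' r : R) : 0 <= B <= B' -> 0 < z B' -> B' ^ 2 / z B' <= t -> 0 <= r <= 1 ->
  comparison_fn t B r <= sol B' r.
Proof.
  intros HB Hz Ht Hr.
  assert (h : comparison_fn t B r - sol B' r <= comparison_fn t B 1 - sol B' 1).
  { apply (mono_of_deriv (fun r => comparison_fn t B r - sol B' r)
      (fun r => t * (r * m (B * r)) - B' ^ 2 / z B' * (r * m (B' * r)))); [lra| | |].
    - intros s Hs. apply derivable_continuous_pt. eexists.
      apply derivable_pt_lim_minus; [apply test_deriv|apply sol_deriv; lra].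
    - intros s Hs. apply derivable_pt_lim_minus; [apply test_deriv|apply sol_deriv; lra].
    - intros s Hs. assert (h1 : m (B' * s) <= m (B * s)).
      { apply m_decr. split; [apply Rmult_le_pos; lra|apply Rmult_le_compat_r; lra]. }
      assert (h2 := m_pos (B' * s)).
      assert (h3 : 0 <= B' ^ 2 / z B') by (apply Rmult_le_pos; [apply pow2_ge_0|left; apply Rinv_0_lt_compat, Hz]).
      assert (B' ^ 2 / z B' * (s * m (B' * s)) <= t * (s * m (B * s))); [|lra].
      apply Rmult_le_compat; auto; [apply Rmult_le_pos; lra|apply Rmult_le_compat_l; lra]. }
  rewrite test_1, sol_1 in h by exact Hz. lra.
Qed.

Lemma lamf_scale (B : R) : 0 < z B -> (B ^ 2 / z B) ^ k * Rpower (z B) q = lamf B.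
Proof.
  intros Hz. unfold lamf, Rdiv, Rminus. rewrite Rpow_mult_distr, pow_inv, <- pow_mult.
  rewrite Rpower_plus, Rpower_Ropp, Rpower_pow by exact Hz. ring.
Qed.

(* Continuous induction along the branch [B |-> sol B]. *)
Lemma continuation (X : Type) (u rho : X -> R) (lam : R) :
  (forall x, 0 <= rho x <= 1) -> (forall x, u x <= 0) ->
  (forall B, 0 <= B -> 0 < z B -> (forall x, u x <= sol B (rho x)) ->
     forall t, 0 < t -> t ^ k * Rpower (z B) q < lam -> forall x, u x <= comparison_fn t B (rho x)) ->
  forall B, 0 <= B -> 0 < z B -> (forall b, 0 <= b < B -> lamf b < lam) ->
  forall x, u x <= sol B (rho x).
Proof.
  intros Hrho Hu Hstep B HB Hz Hlam.
  assert (HzB : forall b, 0 <= b <= B -> 0 < z b) by (intros b Hb; apply (z_pos_before b B); assumption).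
  set (E := fun b => 0 <= b <= B /\ forall b', 0 <= b' <= b -> forall x, u x <= sol b' (rho x)).
  assert (E0 : E 0).
  { split; [lra|]. intros b' Hb' x. replace b' with 0 by lra. unfold sol. rewrite Rmult_0_l, z_0.
    assert (h := Hu x). lra. }
  destruct (completeness E) as [s [Hub Hlub]]; [exists B; intros b Hb; apply Hb|exists 0; exact E0|].
  assert (Hs : 0 <= s <= B) by (split; [apply Hub, E0|apply Hlub; intros b Hb; apply Hb]).
  assert (Hbelow : forall b, 0 <= b < s -> forall x, u x <= sol b (rho x)).
  { intros b Hb x. apply NNPP. intros hn. assert (s <= b); [|lra].
    apply Hlub. intros b' [Hb1 Hb2]. apply Rnot_lt_le. intros h. apply hn, (Hb2 b). lra. }
  assert (Hzs := HzB s Hs).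
  (* The set of good parameters is closed, by continuity of [b |-> sol b r]. *)
  assert (Hat : forall x, u x <= sol s (rho x)).
  { intros x. destruct (Req_dec s 0) as [->|hs0]; [apply E0; lra|].
    apply Rnot_lt_le. intros h.
    assert (Hcont : continuity_pt (fun b => sol b (rho x)) s).
    { unfold sol. apply (continuity_pt_minus (fun _ => 1) (fun b => z (b * rho x) / z b));
        [apply continuity_pt_const; intros a b; reflexivity|].
      apply (continuity_pt_div (fun b => z (b * rho x)) z); [|apply z_cont; lra|lra].
      apply (continuity_pt_comp (fun b => b * rho x) z).
      - apply (continuity_pt_mult (fun b => b) (fun _ => rho x)); [apply continuity_pt_id|].
        apply continuity_pt_const; intros a b; reflexivity.
      - apply z_cont, Rmult_le_pos; [lra|apply Hrho]. }
    destruct (continuity_pt_eps _ _ (u x - sol s (rho x)) Hcont ltac:(lra)) as [d [Hd H]].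
    set (b := Rmax 0 (s - d / 2)).
    assert (Hb : 0 <= b /\ b < s /\ s - d / 2 <= b).
    { unfold b. split; [apply Rmax_l|split; [apply Rmax_lub_lt; lra|apply Rmax_r]]. }
    assert (h1 := H b ltac:(apply Rabs_def1; lra)). assert (h2 := Hbelow b ltac:(lra) x).
    cbv beta in h1. apply Rabs_def2 in h1. lra. }
  destruct (Req_dec s B) as [->|hsB]; [exact Hat|exfalso].
  (* Openness at s: [t0] belongs to [sol s], and [lamf s < lam] leaves room for the larger
     [t = t0 + d1 / 2]. The bound by [comparison_fn t s] holds for all x at once, so it passes to
     every [sol b'] with [b' >= s] near s. *)
  set (t0 := s ^ 2 / z s).
  assert (Ht0 : 0 <= t0) by (apply Rmult_le_pos; [apply pow2_ge_0|left; apply Rinv_0_lt_compat, Hzs]).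
  assert (Hl : t0 ^ k * Rpower (z s) q < lam) by (unfold t0; rewrite lamf_scale by exact Hzs; apply Hlam; lra).
  assert (Hc1 : continuity_pt (fun t => t ^ k * Rpower (z s) q) t0).
  { apply (continuity_pt_mult (fun t => t ^ k) (fun _ => Rpower (z s) q));
      [apply derivable_continuous_pt, derivable_pt_pow|apply continuity_pt_const; intros a b; reflexivity]. }
  destruct (continuity_pt_eps _ _ (lam - t0 ^ k * Rpower (z s) q) Hc1 ltac:(lra)) as [d1 [Hd1 H1]].
  set (t := t0 + d1 / 2).
  assert (Ht : t ^ k * Rpower (z s) q < lam).
  { assert (h := H1 t ltac:(unfold t; apply Rabs_def1; lra)). cbv beta in h. apply Rabs_def2 in h. lra. }
  assert (Htest := Hstep s ltac:(lra) Hzs Hat t ltac:(unfold t; lra) Ht).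
  assert (Hc2 : continuity_pt (fun b => b ^ 2 / z b) s).
  { apply (continuity_pt_div (fun b => b ^ 2) z); [apply derivable_continuous_pt, derivable_pt_pow|apply z_cont; lra|lra]. }
  destruct (continuity_pt_eps _ _ (d1 / 2) Hc2 ltac:(lra)) as [d2 [Hd2 H2]].
  set (b := Rmin B (s + d2 / 2)).
  assert (Hb : s < b /\ b <= B /\ b <= s + d2 / 2).
  { unfold b. split; [apply Rmin_glb_lt; lra|split; [apply Rmin_l|apply Rmin_r]]. }
  assert (Eb : E b); [|assert (h := Hub b Eb); lra].
  split; [lra|]. intros b' Hb' x.
  destruct (Rlt_dec b' s) as [h|h]; [apply Hbelow; lra|].
  apply Rle_trans with (1 := Htest x). apply test_le_sol; [lra|apply HzB; lra| |apply Hrho].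
  assert (h2 := H2 b' ltac:(apply Rabs_def1; lra)). cbv beta in h2. apply Rabs_def2 in h2. unfold t, t0. lra.
Qed.

(** If [z] stayed above [e'], then [lamf B] would be at least [B^(2k) e'^(q-k)], which is unbounded.
    So [z] falls to [e'], and the first crossing has the positive value [z B = e']. *)
Lemma z_small (lam e : R) : (forall B, 0 < B -> 0 < z B -> lamf B < lam) -> 0 < e ->
  exists B, 0 <= B /\ 0 < z B < e.
Proof.
  intros Hlam He. set (e' := Rmin e 1 / 2).
  assert (He' : 0 < e' /\ e' < e /\ e' < 1).
  { unfold e'. assert (0 < Rmin e 1) by (apply Rmin_pos; lra). pose proof (Rmin_l e 1). pose proof (Rmin_r e 1). lra. }
  assert (Hex : exists B1, 0 <= B1 /\ z B1 <= e').
  { apply NNPP. intros hn.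
    assert (Hz : forall B, 0 <= B -> e' < z B).
    { intros B HB. apply Rnot_le_lt. intros h. apply hn. exists B. auto. }
    set (w := Rpower e' (q - INR k)). assert (Hw := Rpower_pos e' (q - INR k)). fold w in Hw.
    set (B := Rmax 1 (lam / w)).
    assert (HB1 : 1 <= B) by apply Rmax_l. assert (HB2 : lam / w <= B) by apply Rmax_r.
    assert (h := Hlam B ltac:(lra) ltac:(assert (h0 := Hz B ltac:(lra)); lra)).
    assert (h1 : w <= Rpower (z B) (q - INR k)).
    { apply Rle_Rpower_l; [lra|]. assert (h0 := Hz B ltac:(lra)). lra. }
    assert (h2 : B <= B ^ (2 * k)).
    { rewrite <- (pow_1 B) at 1. apply Rle_pow; [exact HB1|lia]. }
    assert (h3 : lam <= B * w).
    { apply Rmult_le_reg_r with (/ w); [apply Rinv_0_lt_compat, Hw|].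
      replace (B * w * / w) with B by (field; lra). exact HB2. }
    unfold lamf in h.
    assert (B * w <= B ^ (2 * k) * Rpower (z B) (q - INR k)) by (apply Rmult_le_compat; lra). lra. }
  destruct Hex as [B1 [HB1 HzB1]].
  destruct (first_crossing (fun B => e' - z B) 0 B1 HB1) as [B [HB [HzB _]]].
  - intros s Hs. apply (continuity_pt_minus (fun _ => e')); [apply continuity_pt_const; intros a b; reflexivity|apply z_cont; lra].
  - rewrite z_0. lra.
  - lra.
  - exists B. lra.
Qed.

(** At the centre [u <= sol B] reads [1 / z B <= 1 - u x0], whereas [z B] can be made smaller than
    [1 / (2 - u x0)]. [X] stands for [0, 1] or for the closed ball, so that radial and general
    solutions share the argument. *)
Lemma no_subsolution_above (X : Type) (u rho : X -> R) (lam : R) (x0 : X) :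
  (forall x, 0 <= rho x <= 1) -> (forall x, u x <= 0) -> rho x0 = 0 ->
  (forall B, 0 <= B -> 0 < z B -> (forall x, u x <= sol B (rho x)) ->
     forall t, 0 < t -> t ^ k * Rpower (z B) q < lam -> forall x, u x <= comparison_fn t B (rho x)) ->
  0 < lam -> (forall B, 0 < B -> 0 < z B -> lamf B < lam) -> False.
Proof.
  intros Hrho Hu H0 Hstep Hl Hlam.
  destruct (z_small lam (/ (2 - u x0)) Hlam) as [B [HB Hz]].
  { apply Rinv_0_lt_compat. assert (h := Hu x0). lra. }
  assert (h := continuation X u rho lam Hrho Hu Hstep B HB (proj1 Hz)).
  assert (h1 : u x0 <= sol B (rho x0)).
  { apply h. intros b Hb. destruct (Req_dec b 0) as [->|hn]; [rewrite lamf_0; exact Hl|].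
    apply Hlam; [lra|]. apply (z_pos_before b B); lra. }
  unfold sol in h1. rewrite H0, Rmult_0_r, z_0 in h1.
  assert (h2 : 2 - u x0 < / z B).
  { rewrite <- (Rinv_inv (2 - u x0)). apply Rinv_lt_contravar; [|apply Hz].
    apply Rmult_lt_0_compat; [apply Hz|]. apply Rinv_0_lt_compat. assert (h3 := Hu x0). lra. }
  unfold Rdiv in h1. lra.
Qed.

Lemma Rpower_le_base (a b : R) : 0 < a <= b -> Rpower a q <= Rpower b q.
Proof. intros H. apply Rle_Rpower_l; lra. Qed.

(** [u <= sol B r] means [1 - u >= z(B r) / z B]; the strict gain comes from [t^k z(B)^q < lam]. *)
Lemma rhs_bound (u lam B r t : R) : 0 <= B -> 0 < z B -> 0 <= r <= 1 -> 0 < t ->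
  u <= sol B r -> t ^ k * Rpower (z B) q < lam ->
  t ^ k * Rpower (z (B * r)) q < lam * Rpower (1 - u) q.
Proof.
  intros HB Hz Hr Ht Hu Hl. assert (Hzr := scaled_pos B r HB Hz Hr).
  assert (h1 : z (B * r) / z B <= 1 - u) by (unfold sol in Hu; lra).
  assert (h2 : 0 < z (B * r) / z B) by (apply Rdiv_lt_0_compat; assumption).
  assert (h3 := Rpower_le_base _ _ (conj h2 h1)).
  assert (h4 : Rpower (z (B * r)) q = Rpower (z (B * r) / z B) q * Rpower (z B) q).
  { rewrite Rpower_mult_distr by assumption. f_equal. field. lra. }
  rewrite h4. assert (h5 := Rpower_pos (z (B * r) / z B) q).
  assert (0 < lam).
  { apply Rlt_trans with (2 := Hl). apply Rmult_lt_0_compat; [apply pow_lt, Ht|apply Rpower_pos]. }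
  apply Rlt_le_trans with (lam * Rpower (z (B * r) / z B) q); [nra|].
  apply Rmult_le_compat_l; lra.
Qed.

(** Admissibility for i = 1 makes [r^(n-1) u'] nondecreasing, starting from 0. *)
Lemma subsolution_nonpos (u u' : R -> R) : C2C1 u u' -> k_admissible n k u' -> u 1 <= 0 ->
  (forall r, I01o r -> 0 <= u' r) /\ forall r, I01c r -> u r <= 0.
Proof.
  intros [Hd _] Hadm H1.
  assert (Hpos : forall r, I01o r -> 0 <= u' r).
  { intros r Hr. assert (h : 0 <= r ^ (n - 1) * u' r).
    { apply (nonneg_from_zero (fun s => s ^ (n - 1) * u' s)); [|apply bounded_times_power_small; [lia|apply Hd; unfold I01c; lra]|exact Hr].
      intros s Hs. destruct (Hadm 1%nat ltac:(lia) s Hs) as [l [Hl1 Hl2]]. exists l. split; [|exact Hl2].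
      apply derivable_pt_lim_ext with (2 := Hl1). intros w. cbn [pow]. ring. }
    unfold I01o in Hr. assert (0 < r ^ (n - 1)) by (apply pow_lt; lra).
    apply Rnot_lt_le. intros hn. nra. }
  split; [exact Hpos|]. intros r Hr. apply Rle_trans with (2 := H1). unfold I01c in Hr.
  apply (mono_within u u'); [lra|lra|intros s Hs; apply Hd, Hs|exact Hpos].
Qed.

(** The fluxes [r^(n-k) (u')^k] and [t^k r^n m(B r)^k] both vanish at the origin, and [rhs_bound]
    orders their derivatives. Taking k-th roots orders the slopes, and the values at r = 1 then
    order the functions. *)
Lemma subsolution_step (lam : R) (u : R -> R) : subsolution n k q lam u ->
  forall B, 0 <= B -> 0 < z B -> (forall r, I01c r -> u r <= sol B r) ->
  forall t, 0 < t -> t ^ k * Rpower (z B) q < lam -> forall r, I01c r -> u r <= comparison_fn t B r.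
Proof.
  intros [u' [HC [Hadm [Hop H1]]]] B HB Hz Hu t Ht Hl.
  destruct (subsolution_nonpos u u' HC Hadm H1) as [Hpos Hneg].
  destruct HC as [Hd _].
  assert (Hslope : forall r, I01o r -> t * (r * m (B * r)) <= u' r).
  { intros r Hr.
    assert (h : 0 <= r ^ (n - k) * u' r ^ k - t ^ k * (r ^ n * m (B * r) ^ k)).
    { apply (nonneg_from_zero (fun s => s ^ (n - k) * u' s ^ k - t ^ k * (s ^ n * m (B * s) ^ k))); [| |exact Hr].
      - intros s Hs. destruct (Hop s Hs) as [l [Hl1 Hl2]].
        exists (l - t ^ k * (s ^ (n - 1) * ppow q (z (B * s)) / c)). unfold I01o in Hs. split.
        + apply derivable_pt_lim_minus; [exact Hl1|].
          apply (derivable_pt_lim_scal (fun s => s ^ n * m (B * s) ^ k)), scaled_mass_deriv; lra.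
        + rewrite <- Hcnk in Hl2.
          assert (hs : 0 < s ^ (n - 1)) by (apply pow_lt; lra).
          assert (hz := scaled_pos B s HB Hz ltac:(lra)).
          rewrite ppow_pos_eq by exact hz.
          assert (hr := rhs_bound (u s) lam B s t HB Hz ltac:(lra) Ht (Hu s ltac:(unfold I01c; lra)) Hl).
          assert (h1 : t ^ k * Rpower (z (B * s)) q <= c * / s ^ (n - 1) * l) by lra.
          apply Rmult_le_reg_r with (c * / s ^ (n - 1)).
          { apply Rmult_lt_0_compat; [exact Hc|apply Rinv_0_lt_compat, hs]. }
          replace ((l - t ^ k * (s ^ (n - 1) * Rpower (z (B * s)) q / c)) * (c * / s ^ (n - 1))) with
            (c * / s ^ (n - 1) * l - t ^ k * Rpower (z (B * s)) q) by (field; lra). lra.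
      - intros e He.
        destruct (bounded_times_power_small (fun s => u' s ^ k) (n - k) ltac:(lia)) with (e := e / 2) as [d1 [Hd1 H2]]; [|lra|].
        { intros e' He'. assert (hc : cont_within I01c u' 0) by (apply Hd; unfold I01c; lra).
          destruct (continuity_pt_eps (fun x => x ^ k) (u' 0) e') as [d [Hd' H]];
            [apply derivable_continuous_pt, derivable_pt_pow|exact He'|].
          destruct (hc d Hd') as [d' [Hd'' H']]. exists d'. split; [exact Hd''|]. intros y Hy Hy'. apply H, H'; assumption. }
        destruct (bounded_times_power_small (fun s => t ^ k * m (B * s) ^ k) n ltac:(lia)) with (e := e / 2) as [d2 [Hd2 H3]]; [|lra|].
        { apply cont_within_of_continuity. apply (continuity_pt_scal (fun s => m (B * s) ^ k)).
          apply (continuity_pt_comp (fun s => m (B * s)) (fun x => x ^ k)); [apply scaled_m_cont|].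
          apply derivable_continuous_pt, derivable_pt_pow. }
        exists (Rmin d1 d2). split; [apply Rmin_pos; assumption|]. intros s Hs Hs1.
        assert (h1 := H2 s (conj (proj1 Hs) (Rlt_le_trans _ _ _ (proj2 Hs) (Rmin_l _ _))) Hs1).
        assert (h2 := H3 s (conj (proj1 Hs) (Rlt_le_trans _ _ _ (proj2 Hs) (Rmin_r _ _))) Hs1).
        cbv beta in h1, h2. replace (t ^ k * (s ^ n * m (B * s) ^ k)) with (s ^ n * (t ^ k * m (B * s) ^ k)) by ring.
        apply Rabs_def2 in h1. apply Rabs_def2 in h2. apply Rabs_def1; lra. }
    unfold I01o in Hr. assert (hm := m_pos (B * r)).
    apply (pow_le_reg k); [exact Hk| |apply Hpos; unfold I01o; lra|].
    { apply Rmult_le_pos; [lra|apply Rmult_le_pos; lra]. }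
    assert (hp : 0 < r ^ (n - k)) by (apply pow_lt; lra).
    apply Rmult_le_reg_l with (r ^ (n - k)); [exact hp|].
    rewrite !Rpow_mult_distr.
    replace (r ^ (n - k) * (t ^ k * (r ^ k * m (B * r) ^ k))) with (t ^ k * (r ^ n * m (B * r) ^ k)); [lra|].
    replace (r ^ n) with (r ^ (n - k) * r ^ k) by (rewrite <- pow_add; f_equal; lia). ring. }
  intros r Hr. unfold I01c in Hr.
  assert (h : u r - comparison_fn t B r <= u 1 - comparison_fn t B 1).
  { apply (mono_within (fun r => u r - comparison_fn t B r) (fun r => u' r - t * (r * m (B * r)))); [lra|lra| |].
    - intros s Hs e He. destruct (proj1 (Hd s Hs) (e / 2) ltac:(lra)) as [d1 [Hd1 H2]].
      destruct (deriv_within_of_derivable I01c _ _ _ (test_deriv t B s) (e / 2) ltac:(lra)) as [d2 [Hd2 H3]].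
      exists (Rmin d1 d2). split; [apply Rmin_pos; assumption|]. intros h Hh0 Hh HD.
      assert (a1 := H2 h Hh0 (Rlt_le_trans _ _ _ Hh (Rmin_l _ _)) HD).
      assert (a2 := H3 h Hh0 (Rlt_le_trans _ _ _ Hh (Rmin_r _ _)) HD).
      replace ((u (s + h) - comparison_fn t B (s + h) - (u s - comparison_fn t B s)) / h - (u' s - t * (s * m (B * s)))) with
        (((u (s + h) - u s) / h - u' s) - ((comparison_fn t B (s + h) - comparison_fn t B s) / h - t * (s * m (B * s)))) by (field; exact Hh0).
      apply Rabs_def2 in a1. apply Rabs_def2 in a2. apply Rabs_def1; lra.
    - intros s Hs. assert (a := Hslope s Hs). lra. }
  rewrite test_1 in h. lra.
Qed.

Lemma subsolution_le_sol (lam : R) (u : R -> R) (B : R) : subsolution n k q lam u ->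
  0 <= B -> 0 < z B -> (forall b, 0 <= b < B -> lamf b < lam) -> forall r, I01c r -> u r <= sol B r.
Proof.
  intros Hu HB Hz Hlam r Hr.
  assert (Hn : forall r, I01c r -> u r <= 0).
  { destruct Hu as [u' [HC [Hadm [_ H1]]]]. apply (subsolution_nonpos u u' HC Hadm H1). }
  apply (continuation {r | I01c r} (fun x => u (proj1_sig x)) (fun x => proj1_sig x) lam) with (x := exist _ r Hr); auto.
  - intros [s Hs]. exact Hs.
  - intros [s Hs]. apply Hn, Hs.
  - intros b Hb Hzb Hle t Ht Htl [s Hs]. cbn. apply (subsolution_step lam u Hu b Hb Hzb); auto.
    intros w Hw. exact (Hle (exist _ w Hw)).
Qed.

Lemma classical_is_subsolution (lam : R) (u : R -> R) : classical_solution n k q lam u -> subsolution n k q lam u.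
Proof.
  intros [u' [HC [Hadm [_ [H1 [Hop _]]]]]]. exists u'. repeat split; try apply HC; auto; [|lra].
  intros r Hr. destruct (Hop r Hr) as [l [Hl1 Hl2]]. exists l. split; [exact Hl1|lra].
Qed.

Lemma no_classical_above (lam : R) (u : R -> R) : 0 < lam -> (forall B, 0 < B -> 0 < z B -> lamf B < lam) ->
  ~ classical_solution n k q lam u.
Proof.
  intros Hl Hlam Hu. apply classical_is_subsolution in Hu.
  assert (Hn : forall r, I01c r -> u r <= 0).
  { destruct Hu as [u' [HC [Hadm [_ H1]]]]. apply (subsolution_nonpos u u' HC Hadm H1). }
  assert (H0 : I01c 0) by (unfold I01c; lra).
  apply (no_subsolution_above {r | I01c r} (fun x => u (proj1_sig x)) (fun x => proj1_sig x) lam (exist _ 0 H0)); auto.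
  - intros [s Hs]. exact Hs.
  - intros [s Hs]. apply Hn, Hs.
  - intros b Hb Hzb Hle t Ht Htl [s Hs]. cbn. apply (subsolution_step lam u Hu b Hb Hzb); auto.
    intros w Hw. exact (Hle (exist _ w Hw)).
Qed.

(** A positive maximum of [u] minus the comparison function is interior, as both vanish on the
    sphere. There [hessian_comparison_at_max] gives [lam (1 - u)^q <= t^k z(B r)^q], against
    [rhs_bound]. *)
Lemma hessian_step (lam : R) (u : (nat -> R) -> R) (Du : nat -> (nat -> R) -> R) (D2u : nat -> nat -> (nat -> R) -> R) :
  0 < lam -> C2B n u Du D2u ->
  (forall x, inBc n x -> cont_on (inBc n) n u x) ->
  (forall x, inB n x -> Sk_is n k (fun i j => D2u i j x) (lam * Rpower (1 - u x) q)) ->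
  (forall x, inB n x -> u x < 0) ->
  (forall x, inSub n x -> sqnorm n x = 1 -> u x = 0) ->
  forall B, 0 <= B -> 0 < z B -> (forall x, inBc n x -> u x <= sol B (normn n x)) ->
  forall t, 0 < t -> t ^ k * Rpower (z B) q < lam -> forall x, inBc n x -> u x <= comparison_fn t B (normn n x).
Proof.
  intros Hl HC2 Hcont HSk Hneg Hbd B HB Hz Hle t Ht Htl x Hx.
  apply Rnot_lt_le. intros Hlt.
  destruct (closed_ball_max n (fun y => u y + - comparison_fn t B (normn n y))) as [x0 [Hx0 Hmax]].
  { intros y Hy. apply (cont_on_plus _ n u (fun y => - comparison_fn t B (normn n y))); [apply Hcont, Hy|].
    apply (cont_on_comp _ n (normn n) (fun r => - comparison_fn t B r)); [apply cont_on_normn|].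
    apply continuity_pt_opp, derivable_continuous_pt. eexists. apply test_deriv. }
  assert (Hpos : 0 < u x0 - comparison_fn t B (normn n x0)) by (assert (h := Hmax x Hx); cbv beta in h; lra).
  assert (Hx0B : inB n x0).
  { split; [apply Hx0|]. destruct (Rle_lt_or_eq_dec _ _ (proj2 Hx0)) as [h|h]; [exact h|exfalso].
    rewrite (Hbd x0 (proj1 Hx0) h) in Hpos. unfold normn in Hpos. rewrite h, sqrt_1, test_1 in Hpos. lra. }
  set (r := normn n x0). assert (Hr := normn_lt_1 n x0 Hx0B). fold r in Hr.
  (* The sign of the rank-one part comes from [m' <= 0]; at r = 0 the quotient is 0 because
     [/ 0 = 0]. *)
  assert (HNn : t * (B * m1 (B * r)) / r <= 0).
  { destruct (Req_dec r 0) as [h|h]; [rewrite h; unfold Rdiv; rewrite Rinv_0; lra|].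
    assert (hi : 0 < / r) by (apply Rinv_0_lt_compat; lra). unfold Rdiv.
    assert (B * m1 (B * r) <= 0).
    { destruct (Req_dec B 0) as [->|hB]; [lra|].
      assert (h1 := m1_nonpos (B * r) ltac:(apply Rmult_lt_0_compat; lra)). nra. }
    assert (t * (B * m1 (B * r)) <= 0) by nra. nra. }
  assert (HW := scaled_radial_C2B t B (comparison_fn t B) HB Hz (fun r _ => test_deriv t B r)).
  assert (h := hessian_comparison_at_max n k u Du D2u (fun x => lam * Rpower (1 - u x) q)
    (fun x => comparison_fn t B (normn n x)) _ _ x0 (t * m (B * r)) (t * (B * m1 (B * r)) / r)
    ltac:(lia) ltac:(lia) HC2 Hcont HSk
    (fun x _ => Rmult_lt_0_compat _ _ Hl (Rpower_pos _ _)) Hneg Hbd HW Hx0B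
    (fun i j => eq_refl) HNn).
  cbv beta in h. rewrite <- normn_sq in h. fold r in h.
  rewrite esym_radial_value, ppow_pos_eq in h by (try apply scaled_pos; lra).
  assert (h1 := rhs_bound (u x0) lam B r t HB Hz ltac:(lra) Ht (Hle x0 Hx0) Htl).
  assert (h2 : lam * Rpower (1 - u x0) q <= t ^ k * Rpower (z (B * r)) q); [|lra].
  apply h. intros y Hy. destruct Hy as [Hy1 Hy2].
  assert (h3 := Hmax y (conj Hy1 (Rlt_le _ _ Hy2))). cbv beta in h3. fold r in h3. lra.
Qed.

Lemma hessian_not_above (lam : R) : 0 < lam -> (forall B, 0 < B -> 0 < z B -> lamf B < lam) ->
  ~ hessian_problem_solvable n k q lam.
Proof.
  intros Hl Hlam [u [Du [D2u [HC2 [Hcont [HSk [Hneg Hbd]]]]]]].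
  assert (H0 : inBc n (fun _ => 0)) by (destruct (zero_in_ball n); split; [assumption|lra]).
  apply (no_subsolution_above {x | inBc n x} (fun x => u (proj1_sig x)) (fun x => normn n (proj1_sig x)) lam (exist _ _ H0)); auto.
  - intros [x Hx]. apply normn_le_1, Hx.
  - intros [x Hx]. cbn. destruct (Rle_lt_or_eq_dec _ _ (proj2 Hx)) as [h|h].
    + left. apply Hneg. split; [apply Hx|exact h].
    + right. apply Hbd; [apply Hx|exact h].
  - cbn. unfold normn. replace (sqnorm n (fun _ => 0)) with 0; [apply sqrt_0|].
    unfold sqnorm. rewrite (rsumn_ext n _ (fun _ => 0)) by (intros; ring). rewrite rsumn_const. ring.
  - intros b Hb Hzb Hle t Ht Htl [x Hx]. cbn.
    apply (hessian_step lam u Du D2u Hl HC2 Hcont HSk Hneg Hbd b Hb Hzb); auto.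
    intros w Hw. exact (Hle (exist _ w Hw)).
Qed.

(** * The members of the branch as classical, Hessian, maximal and integral solutions *)

Lemma sol_neg (B r : R) : 0 < B -> 0 < z B -> 0 <= r < 1 -> sol B r < 0.
Proof.
  intros HB Hz Hr. rewrite <- (sol_1 B Hz).
  destruct (MVT_lim (sol B) (fun r => B ^ 2 / z B * (r * m (B * r))) r 1 ltac:(lra)) as [s [Hs Heq]].
  { intros s Hs. apply sol_deriv; lra. }
  assert (0 < B ^ 2 / z B * (s * m (B * s)) * (1 - r)).
  { apply Rmult_lt_0_compat; [|lra]. apply Rmult_lt_0_compat.
    - apply Rdiv_lt_0_compat; [apply pow_lt, HB|exact Hz].
    - apply Rmult_lt_0_compat; [lra|apply m_pos]. }
  lra.
Qed.

Lemma sol_rhs (B r : R) : 0 <= B -> 0 < z B -> 0 <= r <= 1 ->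
  lamf B * Rpower (1 - sol B r) q = (B ^ 2 / z B) ^ k * Rpower (z (B * r)) q.
Proof.
  intros HB Hz Hr. assert (Hzr := scaled_pos B r HB Hz Hr).
  rewrite <- lamf_scale by exact Hz. unfold sol.
  replace (1 - (1 - z (B * r) / z B)) with (z (B * r) / z B) by ring.
  rewrite Rmult_assoc, Rpower_mult_distr; [|exact Hz|apply Rdiv_lt_0_compat; assumption].
  do 2 f_equal. field. lra.
Qed.

Lemma sol_classical (B : R) : 0 < B -> 0 < z B -> classical_solution n k q (lamf B) (sol B).
Proof.
  intros HB Hz. set (t := B ^ 2 / z B). set (u' := fun r => t * (r * m (B * r))).
  assert (Ht : 0 < t) by (apply Rdiv_lt_0_compat; [apply pow_lt, HB|exact Hz]).
  assert (Hpow : forall i s, (i <= n)%nat -> s ^ (n - i) * u' s ^ i = t ^ i * (s ^ n * m (B * s) ^ i)).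
  { intros i s Hi. unfold u'. rewrite !Rpow_mult_distr.
    replace (s ^ n) with (s ^ (n - i) * s ^ i) by (rewrite <- pow_add; f_equal; lia). ring. }
  exists u'. split; [split|split; [|split; [|split; [|split]]]].
  - intros r Hr. unfold I01c in Hr. split.
    + apply deriv_within_of_derivable. apply sol_deriv; lra.
    + apply cont_within_of_continuity. apply (continuity_pt_scal (fun r => r * m (B * r))).
      apply (continuity_pt_mult (fun r => r)); [apply continuity_pt_id|apply scaled_m_cont].
  - exists (fun r => t * (1 * m (B * r) + r * (B * m1 (B * r)))). intros r Hr. unfold I01o in Hr. split.
    + apply (derivable_pt_lim_scal (fun r => r * m (B * r))).
      apply (derivable_pt_lim_mult (fun r => r) (fun r => m (B * r))); [apply derivable_pt_lim_id|apply scaled_m_deriv; lra].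
    + apply (continuity_pt_scal (fun r => 1 * m (B * r) + r * (B * m1 (B * r)))).
      apply (continuity_pt_plus (fun r => 1 * m (B * r)) (fun r => r * (B * m1 (B * r)))).
      * apply (continuity_pt_scal (fun r => m (B * r))), scaled_m_cont.
      * apply (continuity_pt_mult (fun r => r)); [apply continuity_pt_id|].
        apply (continuity_pt_scal (fun r => m1 (B * r))).
        apply (continuity_pt_comp (fun r => B * r) m1); [apply (continuity_pt_scal (fun r => r)), continuity_pt_id|].
        apply m1_cont; [apply Rmult_lt_0_compat; lra|apply scaled_pos; lra].
  - intros i Hi r Hr. unfold I01o in Hr. set (s := B * r).
    assert (Hs : 0 < s) by (apply Rmult_lt_0_compat; lra).
    exists (t ^ i * ((INR n * r ^ pred n) * m s ^ i + r ^ n * (INR i * m s ^ pred i * (B * m1 s)))). split.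
    + apply derivable_pt_lim_ext with (fun r => t ^ i * (r ^ n * m (B * r) ^ i)).
      { intros w. symmetry. apply Hpow. lia. }
      apply (derivable_pt_lim_scal (fun r => r ^ n * m (B * r) ^ i)).
      apply (derivable_pt_lim_mult (fun r => r ^ n) (fun r => m (B * r) ^ i)); [apply derivable_pt_lim_pow|].
      apply (derivable_pt_lim_comp (fun r => m (B * r)) (fun x => x ^ i)); [apply scaled_m_deriv; lra|].
      apply derivable_pt_lim_pow.
    + apply Rmult_le_pos; [apply pow_le; lra|].
      assert (hm := m_pos s).
      assert (hx := xr_pos s (scaled_pos B r ltac:(lra) Hz ltac:(lra))).
      replace (INR n * r ^ pred n * m s ^ i + r ^ n * (INR i * m s ^ pred i * (B * m1 s))) with
        (r ^ pred n * m s ^ pred i * (INR n * m s + INR i * (s * m1 s))).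
      2: { replace (r ^ n) with (r * r ^ pred n) by (replace n with (S (pred n)) at 2 by lia; reflexivity).
           replace (m s ^ i) with (m s * m s ^ pred i) by (replace i with (S (pred i)) at 2 by lia; reflexivity).
           unfold s. ring. }
      apply Rmult_le_pos; [apply Rmult_le_pos; apply pow_le; lra|].
      rewrite s_m1 by lra.
      assert (hi : 0 <= INR i <= INR k) by (split; [apply pos_INR|apply le_INR; lia]).
      (* Admissibility reduces to [n (k - i) + i x >= 0], clear from i <= k and x > 0. *)
      replace (INR n * m s + INR i * (m s * (xr s - INR n) / INR k)) with
        (m s * (INR n * (INR k - INR i) + INR i * xr s) / INR k) by (field; lra).
      apply Rmult_le_pos; [|left; apply Rinv_0_lt_compat; lra]. apply Rmult_le_pos; [lra|].
      apply Rplus_le_le_0_compat; apply Rmult_le_pos; lra.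
  - unfold u'. ring.
  - apply sol_1, Hz.
  - intros r Hr. unfold I01o in Hr.
    exists (t ^ k * (r ^ (n - 1) * ppow q (z (B * r)) / c)). split.
    + apply derivable_pt_lim_ext with (fun r => t ^ k * (r ^ n * m (B * r) ^ k)).
      { intros w. symmetry. apply Hpow. lia. }
      apply (derivable_pt_lim_scal (fun r => r ^ n * m (B * r) ^ k)), scaled_mass_deriv; lra.
    + rewrite sol_rhs by lra. rewrite <- Hcnk, ppow_pos_eq by (apply scaled_pos; lra). fold t.
      assert (r ^ (n - 1) <> 0) by (apply pow_nonzero; lra). field. repeat split; first [assumption|lra].
  - intros r Hr. unfold I01o in Hr. apply sol_neg; lra.
Qed.

Lemma sol_hessian (B : R) : 0 < B -> 0 < z B -> hessian_problem_solvable n k q (lamf B).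
Proof.
  intros HB Hz. set (t := B ^ 2 / z B).
  exists (fun x => sol B (normn n x)). eexists. eexists. split.
  { apply (scaled_radial_C2B t B (sol B) ltac:(lra) Hz). intros r Hr. apply sol_deriv; lra. }
  split; [|split; [|split]].
  - intros x Hx. apply (cont_on_comp _ n (normn n) (sol B)); [apply cont_on_normn|].
    apply derivable_continuous_pt. eexists. apply sol_deriv; [lra|exact Hz|apply normn_nonneg].
  - intros x Hx. assert (Hr := normn_lt_1 n x Hx).
    rewrite sol_rhs by lra. rewrite <- ppow_pos_eq by (apply scaled_pos; lra). fold t.
    rewrite <- (esym_radial_value t B (normn n x)) by lra. rewrite normn_sq.
    apply (Sk_rank_one n k (t * m (B * normn n x)) (t * (B * m1 (B * normn n x)) / normn n x) x). lia.
  - intros x Hx. assert (Hr := normn_lt_1 n x Hx). apply sol_neg; lra.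
  - intros x Hx H1. unfold normn. rewrite H1, sqrt_1. apply sol_1, Hz.
Qed.

(** [lamf] need not be injective; the continuation from 0 gets as far as the first B with the given
    value, and [sol B] for that B is the maximal solution. *)
Lemma sol_maximal (B : R) : 0 < B -> 0 < z B -> (forall b, 0 <= b < B -> lamf b < lamf B) ->
  maximal_bounded_solution n k q (lamf B) (sol B).
Proof.
  intros HB Hz Hlt. split; [apply sol_classical; assumption|]. split.
  - exists (/ z B). intros r Hr. unfold I01c in Hr. unfold sol.
    assert (h1 := z_le_1 (B * r) ltac:(apply Rmult_le_pos; lra)).
    assert (h2 := scaled_pos B r ltac:(lra) Hz Hr).
    assert (h3 : z B <= z (B * r)) by (apply z_decr; split; nra).
    assert (h4 : 1 <= z (B * r) / z B).
    { apply Rmult_le_reg_r with (z B); [exact Hz|]. replace (z (B * r) / z B * z B) with (z (B * r)) by (field; lra). lra. }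
    assert (h5 : z (B * r) / z B <= / z B).
    { apply Rmult_le_reg_r with (z B); [exact Hz|]. replace (z (B * r) / z B * z B) with (z (B * r)) by (field; lra).
      rewrite Rinv_l by lra. lra. }
    apply Rabs_le. lra.
  - intros u Hu r Hr. apply (subsolution_le_sol (lamf B) u B Hu); auto. lra.
Qed.

Lemma sol_integral (B : R) : 0 < B -> 0 < z B -> integral_solution n k q (lamf B) (sol B).
Proof.
  intros HB Hz. set (t := B ^ 2 / z B). set (u' := fun r => t * (r * m (B * r))).
  assert (Ht : 0 < t) by (apply Rdiv_lt_0_compat; [apply pow_lt, HB|exact Hz]).
  assert (Hd : forall r, 0 <= r -> derivable_pt_lim (sol B) r (u' r)) by (intros r Hr; apply sol_deriv; lra).
  assert (Hcu : forall r, 0 <= r -> continuity_pt (sol B) r).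
  { intros r Hr. apply derivable_continuous_pt. eexists. apply Hd, Hr. }
  assert (Hu'c : continuity u').
  { intros r. apply (continuity_pt_scal (fun r => r * m (B * r))).
    apply (continuity_pt_mult (fun r => r)); [apply continuity_pt_id|apply scaled_m_cont]. }
  assert (Hu'p : forall r, 0 <= r -> 0 <= u' r).
  { intros r Hr. assert (h := m_pos (B * r)). apply Rmult_le_pos; [lra|apply Rmult_le_pos; lra]. }
  split; [|split; [|split; [|split]]].
  - intros r Hr. unfold I01l in Hr. apply cont_within_of_continuity, Hcu. lra.
  - left. apply cont_within_of_continuity, Hcu. lra.
  - intros a Ha. apply (abs_cont_of_bounded_deriv (sol B) u' a 1 (t * m 0)).
    + assert (h := m_pos 0). apply Rmult_le_pos; lra.
    + intros r Hr. apply Hd. lra.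
    + intros r Hr. rewrite Rabs_right by (apply Rle_ge, Hu'p; lra). apply Rmult_le_compat_l; [lra|].
      assert (h1 : m (B * r) <= m 0) by (apply m_decr; split; [lra|apply Rmult_le_pos; lra]).
      assert (h2 := m_pos (B * r)). nra.
  - apply sol_1, Hz.
  - exists u'. split.
    + set (g := fun r => r ^ (n - k) * u' r ^ (k + 1)).
      assert (Hg : continuity g).
      { intros r. apply (continuity_pt_mult (fun r => r ^ (n - k)) (fun r => u' r ^ (k + 1))).
        - apply derivable_continuous_pt, derivable_pt_pow.
        - apply (continuity_pt_comp u' (fun x => x ^ (k + 1))); [apply Hu'c|]. apply derivable_continuous_pt, derivable_pt_pow. }
      apply (L1_of_antiderivative (fun r => RInt g 0 r)); [lra| | |].
      * intros r _. apply RInt_deriv, Hg.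
      * intros r Hr. apply Rmult_le_pos; [apply pow_le; lra|apply pow_le, Hu'p; lra].
      * apply cont_within_of_continuity, derivable_continuous_pt. eexists. apply RInt_deriv, Hg.
    + apply null_set_empty. intros r [Hr Hn]. apply Hn. unfold I01o in Hr. split; [apply Hd; lra|].
      (* An antiderivative of [s^(n-1) (1 - u)^q], because [1 - u = z(B s) / z B] and
         [scaled_mass_deriv] integrates the power of the numerator. *)
      set (F := fun s => c / Rpower (z B) q * (s ^ n * m (B * s) ^ k)).
      assert (HzB := Rpower_pos (z B) q).
      exists (F r - F 0). split.
      * apply HK_FTC; [lra| |].
        -- intros s Hs.
           replace (s ^ (n - 1) * Rpower (1 - sol B s) q) with
             (c / Rpower (z B) q * (s ^ (n - 1) * ppow q (z (B * s)) / c)).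
           ++ apply (derivable_pt_lim_scal (fun s => s ^ n * m (B * s) ^ k)), scaled_mass_deriv; lra.
           ++ assert (hz := scaled_pos B s ltac:(lra) Hz ltac:(lra)). rewrite ppow_pos_eq by exact hz.
              unfold sol. replace (1 - (1 - z (B * s) / z B)) with (z (B * s) / z B) by ring.
              replace (Rpower (z (B * s)) q) with (Rpower (z (B * s) / z B) q * Rpower (z B) q).
              ** field. lra.
              ** rewrite Rpower_mult_distr; [f_equal; field; lra|apply Rdiv_lt_0_compat; assumption|exact Hz].
        -- apply cont_within_of_continuity. apply (continuity_pt_scal (fun s => s ^ n * m (B * s) ^ k)).
           apply (continuity_pt_mult (fun s => s ^ n) (fun s => m (B * s) ^ k)).
           ++ apply derivable_continuous_pt, derivable_pt_pow.
           ++ apply (continuity_pt_comp (fun s => m (B * s)) (fun x => x ^ k)); [apply scaled_m_cont|].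
              apply derivable_continuous_pt, derivable_pt_pow.
      * unfold F. rewrite pow_i, Rmult_0_l, Rmult_0_r, Rminus_0_r by lia.
        rewrite <- lamf_scale, <- Hcnk by exact Hz. fold t. unfold u'. rewrite !Rpow_mult_distr.
        replace (r ^ n) with (r ^ (n - k) * r ^ k) by (rewrite <- pow_add; f_equal; lia).
        field. lra.
Qed.

Lemma profile_theorem : exists lstar : R,
    is_lub (lambda_set n k q) lstar /\ 0 < lstar /\
    (forall lam, 0 < lam < lstar ->
       exists v, maximal_bounded_solution n k q lam v) /\
    (exists u, integral_solution n k q lstar u) /\
    (forall lam, lstar < lam -> ~ exists u, classical_solution n k q lam u).
Proof.
  destruct profile_dichotomy as [lstar [Hpos [[Hub Hlub] Hcase]]].
  assert (Hle : forall B, 0 < B -> 0 < z B -> lamf B <= lstar) by (intros B HB Hz; apply Hub; exists B; auto).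
  exists lstar. split; [split|split; [exact Hpos|split; [|split]]].
  - intros lam [Hl Hs]. apply Rnot_lt_le. intros h.
    apply (hessian_not_above lam Hl); [|exact Hs]. intros B HB Hz. apply Rle_lt_trans with (2 := h). auto.
  - intros b Hb. apply Hlub. intros l [r [Hr [Hz ->]]]. apply Hb. split; [apply lamf_pos, Hr|apply sol_hessian; assumption].
  - intros lam [Hl0 Hl].
    assert (Hex : exists B1, 0 < B1 /\ 0 < z B1 /\ lam < lamf B1).
    { apply NNPP. intros hn. assert (lstar <= lam); [|lra]. apply Hlub. intros l [r [Hr [Hz ->]]].
      apply Rnot_lt_le. intros h. apply hn. exists r. auto. }
    destruct Hex as [B1 [HB1 [HzB1 HlB1]]].
    (* The first B with [lamf B = lam], as [sol_maximal] requires. *)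
    destruct (first_crossing (fun B => lamf B - lam) 0 B1) as [B [HB [HBl Hlt]]]; [lra| | | |].
    + intros s Hs. apply (continuity_pt_minus lamf (fun _ => lam));
        [apply lamf_cont; [lra|apply (z_pos_before s B1); lra]|apply continuity_pt_const; intros a b; reflexivity].
    + rewrite lamf_0. lra.
    + lra.
    + assert (HzB : 0 < z B) by (apply (z_pos_before B B1); lra).
      assert (He : lamf B = lam) by lra. exists (sol B). rewrite <- He.
      apply sol_maximal; [lra|exact HzB|]. intros b Hb. assert (h := Hlt b Hb). cbv beta in h. lra.
  - destruct Hcase as [[r0 [Hr0 [Hz0 <-]]]|[Hx [Hs ->]]].
    + exists (sol r0). apply sol_integral; assumption.
    + exists (fun r => 1 - Rpower r (- alpha)). rewrite Hcnk.
      apply singular_integral_solution; auto; [apply alpha_pos|apply alpha_eq].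
  - intros lam Hl [u Hu]. apply (no_classical_above lam u); [lra| |exact Hu].
    intros B HB Hz. apply Rle_lt_trans with (2 := Hl). auto.
Qed.
End ProfileDynamics.

Theorem theorem3 (n k : nat) (q : R) :
  (1 <= k)%nat -> (2 * k < n)%nat -> INR k < q ->
  exists lstar : R,
    is_lub (lambda_set n k q) lstar /\ 0 < lstar /\
    (forall lam, 0 < lam < lstar ->
       exists v, maximal_bounded_solution n k q lam v) /\
    (exists u, integral_solution n k q lstar u) /\
    (forall lam, lstar < lam -> ~ exists u, classical_solution n k q lam u).
Proof.
  intros Hk Hkn Hkq.
  assert (HK : 1 <= INR k) by (change 1 with (INR 1); apply le_INR, Hk).
  assert (Hc : 0 < cnk n k).
  { unfold cnk, C. assert (forall j, 0 < INR (fact j)) by (intros j; apply lt_0_INR, lt_O_fact).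
    apply Rdiv_lt_0_compat; [apply Rdiv_lt_0_compat; [auto|apply Rmult_lt_0_compat; auto]|apply lt_0_INR; lia]. }
  destruct (profile_exists n k q (cnk n k) Hk ltac:(lia) ltac:(lra) Hc) as [z [m HP]].
  exact (profile_theorem n k q (cnk n k) z m Hk Hkn Hkq Hc HP eq_refl).
Qed.
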